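(* Let $k\geq 2$ be a fixed integer and let $\tau_k(n)$ denote the number of representations of the positive integer $n$ as an ordered product of $k$ natural numbers. Then for every $\varepsilon>0$ and all $x\geq 2$, $$\sum_{n\leq x}\tau_k\left(\left[\frac{x}{n}\right]\right)=x\sum_{n=1}^{\infty}\frac{\tau_k(n)}{n(n+1)}+O\left(x^{9/19+\varepsilon}\right),$$ where $[t]$ denotes the greatest integer not exceeding $t$, and the implied constant depends only on $k$ and $\varepsilon$.
   Context: $\tau_k(n)=\#\{(n_1,\dots,n_k)\in\mathbb{N}^k: n_1n_2\cdots n_k=n\}$. The sum over $n\le x$ runs over positive integers. *)

(* Defs.v *)
From mathcomp Require Import all_boot.
Set Implicit Arguments.
Unset Strict Implicit.
Unset Printing Implicit Defensive.

(* tau k n = #{(n_1,...,n_k) in N_{>0}^k : n_1 ... n_k = n}.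
   Each n_i divides n, so for n >= 1 the components lie in 1..n; we range
   over 'I_n.+1 and require positivity (so tau k 0 = 0, never used). *)
Definition tau (k n : nat) : nat :=
  #|[set t : {ffun 'I_k -> 'I_n.+1} |
      [forall i, 0 < nat_of_ord (t i)] && (\prod_(i < k) nat_of_ord (t i) == n)]|.

From Stdlib Require Import Reals ZArith.
(* [t] = greatest integer not exceeding t (as a nat; used only for t >= 0). *)
Definition floor_nat (t : R) : nat := Z.to_nat (Int_part t).

(* Main.v *)
(* Put z = x^(1/19) and psi(y) = y - [y] - 1/2.  Grouping n by d = [x/n] turns the sum into
   sum_d tau_k(d) ([x/d] - [x/(d+1)]).  The d <= z^9 contribute their main term up to
   O(z^9 x^eps); there are at most x/z^10 = z^9 values n with [x/n] > z^10, and the tail of the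
   series beyond z^10 is O(x^eps/z^10).  It remains to show, for z^9 <= D <= z^10 and
   delta = 0 or 1, that the sum over D < d <= 2D of tau_k(d) psi(x/(d + delta)) is O(z^9 x^eps).

   Replace psi by its Fourier sum of length about D/z^9; a Fejer-type majorant controls the error.
   For frequencies h in [H, 2H), write tau_k as a k-fold convolution and multiply the variables
   one after the other.
   - If a variable exceeds about D/(4z^4), the sum over it is a long smooth sum (type I) and van der
     Corput's second derivative test suffices.
   - Otherwise, stop as soon as the partial product exceeds 2z^2: both the partial product and its
     cofactor are then at least 2z^2 (type II), say of sizes N <= M.  Keeping the sum over h inside,
     sort the pairs (h, n) into Q classes by the slope h/n before applying Cauchy-Schwarz.  Only pairs
     with |h n' - h' n| <= 8HN/Q meet; those with h n' = h' n are counted by the divisor bound and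
     the others are estimated by the second derivative test in m.  The choice Q = H z^18 N / D^2
     balances the two contributions. *)
Require Import Defs.
From Stdlib Require Import Reals.
From Coquelicot Require Import Coquelicot.
From Stdlib Require Lra Lia ZArith.
From mathcomp Require all_boot all_order all_algebra Rstruct ring lra zify.

(** The exponent 9/19 is decided by the type II sums. Let [E] be the target error and [D = x/E] the
    end of the range. Choosing [Q] so that the pairs with equal slope contribute about [(H E)^2]
    leaves cross differences [|h n' - h' n|] of order at most [D^2/E^2]; the second derivative test
    in [m] then reaches the target as soon as [x D^3 N <= E^6]. The shorter variable has
    [N <= D^(1/2)] up to a constant, so the worst case is [N = M], and [x D^(7/2) = E^6] gives
    [E = x^(9/19)]. The thresholds follow. At least one slope class is available at [D = z^10] only
    if [N >= z^2]. If the product before a variable and the product after it are both at most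
    [2z^2], that variable is at least [D/(4z^4)], long enough for type I. All losses are powers of
    two quantities of size [x^eta]: a bound [t] for the number of divisors of integers up to [x],
    and the number [J] of dyadic scales. Phases are only sampled at integers, so differences replace
    derivatives, and exponential sums are kept real. The estimate is proved for partial sums of the
    series, uniformly in the cutoff; convergence is then a consequence of it. *)

Module RealAnalysis.
Import Lra Lia ZArith.
Local Open Scope R_scope.

(** * The sawtooth series and some elementary inequalities *)

Lemma sin_ge_third x : 0 <= x -> x <= 2 -> x / 3 <= sin x.
Proof.
intros x0 x2.
assert (x4 : x <= 4) by lra.
(* Index 0 of the alternating bounds is [x - x^3/6 <= sin x]; on [0, 2] the factor [1 - x^2/6] is at
   least 1/3. *)
destruct (pre_sin_bound x 0 x0 x4) as [lb _].
apply Rle_trans with (2 := lb).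
unfold sin_approx, sin_term; simpl.
replace (_ + _) with (x - x ^ 3 / 6) by (simpl; field).
nra.
Qed.

(** Partial Fourier sum of [1/2 - t] on (0, 1), so [t - 1/2 + sawtooth_sum H t] is the truncation
    error; its derivative is the Dirichlet kernel. *)
Fixpoint sawtooth_sum (H : nat) (t : R) : R :=
  match H with
  | O => 0
  | S n => sawtooth_sum n t + sin (2 * PI * (t * (INR n + 1))) / (PI * (INR n + 1))
  end.

Fixpoint dirichlet_kernel (H : nat) (t : R) : R :=
  match H with
  | O => 1
  | S n => dirichlet_kernel n t + 2 * cos (2 * PI * (t * (INR n + 1)))
  end.

Lemma is_derive_sawtooth H t :
  is_derive (fun t => t - 1 / 2 + sawtooth_sum H t) t (dirichlet_kernel H t).
Proof.
assert (pp := PI_RGT_0).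
induction H as [|n IH].
- simpl. auto_derive; [easy | ring].
- assert (np : 0 < INR n + 1) by (assert (h := pos_INR n); lra).
  apply is_derive_ext with (fun t => (t - 1 / 2 + sawtooth_sum n t) +
    sin (2 * PI * (t * (INR n + 1))) / (PI * (INR n + 1))).
    intros u; simpl sawtooth_sum; apply Rplus_assoc.
  change (dirichlet_kernel (S n) t) with
    (plus (dirichlet_kernel n t) (2 * cos (2 * PI * (t * (INR n + 1))))).
  apply (is_derive_plus (K := R_AbsRing) (V := R_NormedModule)); [exact IH|].
  auto_derive; [easy|].
  field. split; lra.
Qed.

Lemma dirichlet_kernel_eq H t :
  sin (PI * t) * dirichlet_kernel H t = sin ((2 * INR H + 1) * (PI * t)).
Proof.
induction H as [|n IH].
- simpl. rewrite Rmult_1_r. f_equal. ring.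
- simpl dirichlet_kernel. rewrite Rmult_plus_distr_l, IH.
  rewrite S_INR.
  set (a := 2 * PI * (t * (INR n + 1))).
  replace ((2 * INR n + 1) * (PI * t)) with (a - PI * t) by (unfold a; ring).
  replace ((2 * (INR n + 1) + 1) * (PI * t)) with (a + PI * t) by (unfold a; ring).
  rewrite sin_minus, sin_plus. ring.
Qed.

(** The base point from which the truncation error is recovered out of its derivative. *)
Lemma sawtooth_half H : 1 / 2 - 1 / 2 + sawtooth_sum H (1 / 2) = 0.
Proof.
assert (s : forall n, sin (INR n * PI) = 0).
  intros n. induction n as [|n IH].
  - simpl. rewrite Rmult_0_l. apply sin_0.
  - rewrite S_INR, Rmult_plus_distr_r, Rmult_1_l, neg_sin, IH. ring.
induction H as [|n IH].
- simpl. lra.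
- simpl sawtooth_sum.
  replace (2 * PI * (1 / 2 * (INR n + 1))) with ((INR n + 1) * PI) by field.
  rewrite <- S_INR, s. unfold Rdiv at 4. rewrite Rmult_0_l. lra.
Qed.

(** The error is minus the integral over [t, 1/2] of [sin (N pi u) / sin (pi u)]. Integration by
    parts is done with the mean value theorem: [G] is the boundary term, and what remains has
    derivative at most that of [-Q] in absolute value, so [E - G - Q] and [E - G + Q] are monotone.
    With [|G| <= Q] at both ends this leaves [2 * Q t]. *)
Lemma sawtooth_bound H t : 0 < t -> t <= 1 / 2 ->
  Rabs (t - 1 / 2 + sawtooth_sum H t) <= 2 / ((2 * INR H + 1) * PI * sin (PI * t)).
Proof.
intros t0 t1.
assert (pp := PI_RGT_0).
set (N := 2 * INR H + 1).
assert (N1 : 1 <= N) by (assert (h := pos_INR H); unfold N; lra).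
set (E := fun u => u - 1 / 2 + sawtooth_sum H u).
set (G := fun u => - cos (N * (PI * u)) / (N * PI * sin (PI * u))).
set (Q := fun u => 1 / (N * PI * sin (PI * u))).
assert (sp : forall u, t <= u <= 1 / 2 -> 0 < sin (PI * u)).
  intros u [u0 u1]. apply sin_gt_0; nra.
assert (np : forall u, t <= u <= 1 / 2 -> 0 < N * PI * sin (PI * u)).
  intros u hu. specialize (sp u hu).
  apply Rmult_lt_0_compat; [apply Rmult_lt_0_compat; lra | exact sp].
assert (cp : forall u, t <= u <= 1 / 2 -> 0 <= cos (PI * u)).
  intros u [u0 u1]. apply cos_ge_0; nra.
assert (GQ : forall u, t <= u <= 1 / 2 -> - Q u <= G u <= Q u).
  intros u hu.
  assert (0 < / (N * PI * sin (PI * u))) by (apply Rinv_0_lt_compat, np, hu).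
  destruct (COS_bound (N * (PI * u))). unfold Q, G, Rdiv. nra.
assert (dE : forall u, t <= u <= 1 / 2 -> is_derive E u (sin (N * (PI * u)) / sin (PI * u))).
  intros u hu. specialize (sp u hu).
  replace (sin (N * (PI * u)) / sin (PI * u)) with (dirichlet_kernel H u).
    apply is_derive_sawtooth.
  unfold N. rewrite <- dirichlet_kernel_eq. field. lra.
assert (dG : forall u, t <= u <= 1 / 2 -> is_derive G u
   (sin (N * (PI * u)) / sin (PI * u) + cos (N * (PI * u)) * cos (PI * u) / (N * sin (PI * u) ^ 2))).
  intros u hu. specialize (sp u hu). unfold G.
  assert (N * PI * sin (PI * u) <> 0) by (apply Rgt_not_eq, np, hu).
  auto_derive; [easy|]. field. repeat split; lra.
assert (dQ : forall u, t <= u <= 1 / 2 -> is_derive Q u (- cos (PI * u) / (N * sin (PI * u) ^ 2))).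
  intros u hu. specialize (sp u hu). unfold Q.
  assert (N * PI * sin (PI * u) <> 0) by (apply Rgt_not_eq, np, hu).
  auto_derive; [easy|]. field. repeat split; lra.
assert (key : forall sg, (sg = 1 \/ sg = -1) -> 0 <= sg * ((E (1/2) - G (1/2) - sg * Q (1/2)) - (E t - G t - sg * Q t))).
  intros sg hsg.
  destruct (MVT_gen (fun u => E u - G u - sg * Q u) t (1/2)
    (fun u => (sg - cos (N * (PI * u))) * (cos (PI * u) / (N * sin (PI * u) ^ 2)))) as [c [[c0 c1] e]].
  - rewrite Rmin_left, Rmax_right by lra. intros u hu.
    assert (hu' : t <= u <= 1 / 2) by lra.
    assert (d := is_derive_minus _ _ _ _ _ (is_derive_minus _ _ _ _ _ (dE u hu') (dG u hu'))
      (is_derive_scal _ _ sg _ (dQ u hu'))).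
    specialize (sp u hu').
    replace ((sg - cos (N * (PI * u))) * (cos (PI * u) / (N * sin (PI * u) ^ 2))) with
     (minus (minus (sin (N * (PI * u)) / sin (PI * u))
       (sin (N * (PI * u)) / sin (PI * u) + cos (N * (PI * u)) * cos (PI * u) / (N * sin (PI * u) ^ 2)))
       (sg * (- cos (PI * u) / (N * sin (PI * u) ^ 2)))).
      exact d.
    unfold minus, plus, opp; simpl. field. lra.
  - rewrite Rmin_left, Rmax_right by lra. intros u hu.
    apply derivable_continuous_pt.
    exists (sin (N * (PI * u)) / sin (PI * u)
      - (sin (N * (PI * u)) / sin (PI * u) + cos (N * (PI * u)) * cos (PI * u) / (N * sin (PI * u) ^ 2))
      - sg * (- cos (PI * u) / (N * sin (PI * u) ^ 2))).
    apply is_derive_Reals.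
    exact (is_derive_minus _ _ _ _ _ (is_derive_minus _ _ _ _ _ (dE u hu) (dG u hu))
      (is_derive_scal _ _ sg _ (dQ u hu))).
  - rewrite Rmin_left in c0 by lra. rewrite Rmax_right in c1 by lra.
    cbv beta in e. rewrite e.
    specialize (sp c (conj c0 c1)). specialize (cp c (conj c0 c1)).
    assert (0 <= cos (PI * c) / (N * sin (PI * c) ^ 2)).
      apply Rmult_le_pos; [exact cp|]. apply Rlt_le, Rinv_0_lt_compat, Rmult_lt_0_compat; [lra|].
      apply pow_lt; exact sp.
    destruct (COS_bound (N * (PI * c))) as [b1 b2].
    replace (sg * ((sg - cos (N * (PI * c))) * (cos (PI * c) / (N * sin (PI * c) ^ 2)) * (1 / 2 - t)))
      with ((sg * (sg - cos (N * (PI * c)))) * (cos (PI * c) / (N * sin (PI * c) ^ 2)) * (1 / 2 - t)) by ring.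
    apply Rmult_le_pos; [|lra]. apply Rmult_le_pos; [|assumption].
    destruct hsg; subst sg; lra.
assert (k1 := key 1 (or_introl eq_refl)). assert (k2 := key (-1) (or_intror eq_refl)).
assert (eh : E (1 / 2) = 0) by apply sawtooth_half.
assert (hh : t <= 1 / 2 <= 1 / 2) by lra.
assert (ht : t <= t <= 1 / 2) by lra.
assert (g1 := GQ _ hh). assert (g2 := GQ _ ht).
replace (2 / (N * PI * sin (PI * t))) with (2 * Q t) by (unfold Q, Rdiv; ring).
fold (E t). apply Rabs_le. lra.
Qed.

(** Each term is at most [2 * t] because [|sin y| <= y]. This serves for [t] below about [1/H],
    where [sawtooth_bound] is useless. *)
Lemma sawtooth_sum_le H t : 0 <= t -> Rabs (sawtooth_sum H t) <= 2 * INR H * t.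
Proof.
assert (pp := PI_RGT_0). intros t0.
induction H as [|n IH].
- simpl. rewrite Rabs_R0. lra.
- simpl sawtooth_sum. eapply Rle_trans; [apply Rabs_triang|].
  assert (np : 0 < INR n + 1) by (assert (h := pos_INR n); lra).
  assert (h : Rabs (sin (2 * PI * (t * (INR n + 1))) / (PI * (INR n + 1))) <= 2 * t).
    set (y := 2 * PI * (t * (INR n + 1))).
    assert (y0 : 0 <= y) by (unfold y; apply Rmult_le_pos; [|apply Rmult_le_pos]; lra).
    assert (sy : Rabs (sin y) <= y).
      destruct y0 as [y0|<-]; [|rewrite sin_0, Rabs_R0; lra].
      assert (a := sin_lt_x y y0). apply Rabs_le. split; [|lra].
      destruct (Rle_dec y 1).
      - assert (0 <= sin y); [|lra]. apply sin_ge_0; [lra|]. assert (q := PI2_1). lra.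
      - destruct (SIN_bound y). lra.
    unfold Rdiv. rewrite Rabs_mult, (Rabs_pos_eq (/ _)).
    2: apply Rlt_le, Rinv_0_lt_compat, Rmult_lt_0_compat; lra.
    apply Rle_trans with (y * / (PI * (INR n + 1))).
      apply Rmult_le_compat_r; [|exact sy].
      apply Rlt_le, Rinv_0_lt_compat, Rmult_lt_0_compat; lra.
    right. unfold y. field. lra.
  rewrite S_INR. lra.
Qed.

Lemma cos_ge_half x : 0 <= x -> x <= PI / 3 -> 1 / 2 <= cos x.
Proof.
intros x0 x1. assert (pp := PI_RGT_0). rewrite <- cos_PI3.
apply cos_decr_1; lra.
Qed.

Lemma ln_ratio_ge y : 0 < y -> / (y + 1) <= ln ((y + 1) / y).
Proof.
intros y0. assert (q0 : 0 < (y + 1) / y) by (apply Rdiv_lt_0_compat; lra).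
assert (h := exp_ineq1_le (- ln ((y + 1) / y))).
rewrite exp_Ropp, exp_ln in h by assumption.
replace (/ ((y + 1) / y)) with (1 - / (y + 1)) in h by (field; lra). lra.
Qed.

(** Makes the tail of the series of [y^a / (y (y + 1))] telescope. Only [r = ((y+1)/y)^(1-a)]
    matters: [r <= 2], while [r - 1 >= (1-a) ln((y+1)/y)], which is at least [1/(2(y+1))] since
    [a <= 1/2]. *)
Lemma Rpower_tail_step a y : 0 <= a -> a <= 1 / 2 -> 1 <= y ->
  Rpower y a / (y * (y + 1)) <= 4 * (Rpower y (a - 1) - Rpower (y + 1) (a - 1)).
Proof.
intros a0 a1 y1.
set (q := (y + 1) / y).
assert (q1 : 1 <= q <= 2).
  unfold q; split; apply Rmult_le_reg_r with y; try lra; field_simplify; lra.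
set (u := Rpower y (a - 1)). set (v := Rpower (y + 1) (a - 1)). set (r := Rpower q (1 - a)).
assert (u0 : 0 < u) by apply exp_pos. assert (v0 : 0 < v) by apply exp_pos.
assert (e1 : Rpower y a = y * u).
  unfold u. rewrite <- (Rpower_1 y) at 2 by lra. rewrite <- Rpower_plus. f_equal. ring.
assert (e2 : u = v * r).
  unfold u, v, r. replace (y + 1) with (y * q) by (unfold q; field; lra).
  rewrite <- Rpower_mult_distr, Rmult_assoc, <- Rpower_plus by lra.
  replace (a - 1 + (1 - a)) with 0 by ring. rewrite Rpower_O by lra. ring.
assert (r2 : r <= 2).
  apply Rle_trans with (Rpower q 1); [apply Rle_Rpower; lra | rewrite Rpower_1; lra].
assert (i0 : 0 < / (y + 1)) by (apply Rinv_0_lt_compat; lra).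
assert (r1 : 1 + / (y + 1) / 2 <= r).
  unfold r, Rpower. eapply Rle_trans; [|apply exp_ineq1_le].
  assert (h := ln_ratio_ge y ltac:(lra)). fold q in h. nra.
replace (Rpower y a / (y * (y + 1))) with (u * / (y + 1)) by (rewrite e1; field; lra).
rewrite e2.
set (i := / (y + 1)) in *.
assert (h : r * i <= 4 * (r - 1)) by nra.
replace (v * r * i) with (v * (r * i)) by ring.
replace (4 * (v * r - v)) with (v * (4 * (r - 1))) by ring.
apply Rmult_le_compat_l; lra.
Qed.

Lemma floor_nat_spec x : 0 <= x -> INR (floor_nat x) <= x < INR (floor_nat x) + 1.
Proof.
intros x0. destruct (base_Int_part x) as [h1 h2].
assert (z0 : (-1 < Int_part x)%Z) by (apply lt_IZR; lra).
unfold floor_nat. rewrite INR_IZR_INZ, Z2Nat.id by lia. lra.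
Qed.

End RealAnalysis.

Module TauSums.
Import RealAnalysis.
Import all_boot all_order all_algebra Rstruct ring lra zify.
Import Order.TTheory GRing.Theory Num.Theory.
Set Implicit Arguments.
Unset Strict Implicit.
Unset Printing Implicit Defensive.
Local Open Scope ring_scope.
Bind Scope ring_scope with R.
Local Arguments cos _%_ring_scope.
Local Arguments sin _%_ring_scope.

(** * The second difference test *)

Definition RE := (R0E, R1E, RplusE, RmultE, RoppE, RinvE, RminusE, RdivE, IZRposE, INRE).

(** Real and imaginary parts of [e(t) = exp(2 pi i t)]. *)
Definition ec (t : R) : R := cos (2 * PI * t).
Definition es (t : R) : R := sin (2 * PI * t).

Lemma ecD a b : ec (a + b) = ec a * ec b - es a * es b.
Proof. by rewrite /ec /es mulrDr; exact: cos_plus. Qed.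

Lemma esD a b : es (a + b) = es a * ec b + ec a * es b.
Proof. by rewrite /ec /es mulrDr; exact: sin_plus. Qed.

Lemma ecN a : ec (- a) = ec a.
Proof. by rewrite /ec mulrN; exact: cos_neg. Qed.

Lemma esN a : es (- a) = - es a.
Proof. by rewrite /es mulrN; exact: sin_neg. Qed.

Lemma ecB a b : ec (a - b) = ec a * ec b + es a * es b.
Proof. by rewrite ecD ecN esN mulrN opprK. Qed.

Lemma ec0 : ec 0 = 1.
Proof. by rewrite /ec mulr0; exact: cos_0. Qed.

Lemma ec2es2 a : ec a ^+ 2 + es a ^+ 2 = 1.
Proof. by have := ecB a a; rewrite subrr ec0 -!expr2. Qed.

Lemma normr_ec a : `|ec a| <= 1.
Proof. by rewrite -(@expr_le1 _ 2) // real_normK ?num_real //; have := ec2es2 a; have := sqr_ge0 (es a); lra. Qed.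

Lemma normr_es a : `|es a| <= 1.
Proof. by rewrite -(@expr_le1 _ 2) // real_normK ?num_real //; have := ec2es2 a; have := sqr_ge0 (ec a); lra. Qed.

Lemma ec1 : ec 1 = 1.
Proof. by rewrite /ec mulr1; exact: cos_2PI. Qed.

Lemma es1 : es 1 = 0.
Proof. by rewrite /es mulr1; exact: sin_2PI. Qed.

Lemma ec_es_nat n : ec n%:R = 1 /\ es n%:R = 0.
Proof.
elim: n => [|n [IH1 IH2]]; first by rewrite ec0 /es mulr0; split=> //; exact: sin_0.
by rewrite -natr1 ecD esD IH1 IH2 ec1 es1; split; ring.
Qed.

Lemma ec_es_int (z : int) : ec z%:~R = 1 /\ es z%:~R = 0.
Proof.
case: z => n; first exact: ec_es_nat.
by rewrite NegzE mulrNz ecN esN; have [-> ->] := ec_es_nat n.+1; rewrite oppr0.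
Qed.

Lemma ecDz t (z : int) : ec (t + z%:~R) = ec t.
Proof. by rewrite ecD; have [-> ->] := ec_es_int z; ring. Qed.

Lemma esDz t (z : int) : es (t + z%:~R) = es t.
Proof. by rewrite esD; have [-> ->] := ec_es_int z; ring. Qed.

Lemma PI_gt3 : 3 < PI.
Proof. by rewrite -(INRE 3); apply/RltP => /=; have := PI2_3_2; Lra.lra. Qed.

Lemma PI_le4 : PI <= 4.
Proof. by rewrite -(INRE 4); apply/RleP => /=; have := PI_4; Lra.lra. Qed.

Lemma sin_PI_ge u : 0 <= u -> u <= 1/2 -> u <= sin (PI * u).
Proof.
move=> u0 u1; have p3 := PI_gt3; have p4 := PI_le4.
have x0 : 0 <= PI * u by rewrite mulr_ge0 //; lra.
have x2 : PI * u <= 2 by nra.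
have lb : PI * u / 3 <= sin (PI * u).
  have h := @sin_ge_third (PI * u) _ _.
  rewrite !RE /= in h; apply/RleP/h; apply/RleP; rewrite ?RE //=.
by apply: le_trans lb; nra.
Qed.

Lemma sin_PIB u : sin (PI - u) = sin u.
Proof. by rewrite -[RHS]sin_PI_x. Qed.

Lemma sin_PI_ge2 t u : 0 <= t -> t <= u -> u <= 1 - t -> t <= sin (PI * u).
Proof.
move=> t0 tu ut; have [h|h] := leP u (1/2).
  apply: le_trans (tu) (sin_PI_ge _ _); lra.
rewrite -sin_PIB (_ : PI - PI * u = PI * (1 - u)); last by ring.
by apply: le_trans (sin_PI_ge _ _); lra.
Qed.

Definition ct (u : R) : R := cos (PI * u) / sin (PI * u).

Lemma normr_ct t u : 0 < t -> t <= u -> u <= 1 - t -> `|ct u| <= t^-1.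
Proof.
move=> t0 tu ut; have s0 := sin_PI_ge2 (ltW t0) tu ut.
have sp : 0 < sin (PI * u) by apply: lt_le_trans s0.
have cb : `|cos (PI * u)| <= 1.
  by have := normr_ec (u / 2); rewrite /ec (_ : 2 * PI * (u / 2) = PI * u) //; field.
by rewrite /ct normrM normfV (gtr0_norm sp) -[leRHS]mul1r ler_pM ?invr_ge0 ?(ltW sp) // lef_pV2.
Qed.

Lemma ct_anti t u v : 0 < t -> t <= u -> u <= v -> v <= 1 - t -> ct v <= ct u.
Proof.
move=> t0 tu uv vt.
have su : 0 < sin (PI * u) by apply: (lt_le_trans t0); apply: sin_PI_ge2; lra.
have sv : 0 < sin (PI * v) by apply: (lt_le_trans t0); apply: sin_PI_ge2; lra.
rewrite /ct ler_pdivrMr // [leRHS]mulrAC ler_pdivlMr // -subr_ge0.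
have -> : cos (PI * u) * sin (PI * v) - cos (PI * v) * sin (PI * u) = sin (PI * (v - u)).
  by rewrite mulrBr [RHS]sin_minus !(RmultE, RminusE); ring.
by apply: le_trans (sin_PI_ge2 (t := 0) _ _ _) => //; lra.
Qed.

(** Real part of [e(f) = (e(f+g) - e(f)) / (e(g) - 1)], where [1/(e(g) - 1) = -1/2 - (i/2) ct g].
    Each term becomes a difference with a cotangent coefficient, ready for partial summation. *)
Lemma ec_step f g : 0 < g -> g < 1 ->
  ec f = - (1/2) * (ec (f + g) - ec f) + 1/2 * (ct g * (es (f + g) - es f)).
Proof.
move=> g0 g1.
have sg : sin (PI * g) != 0.
  have [h|h] := leP g (1/2).
    by rewrite gt_eqF //; apply: (lt_le_trans g0); apply: sin_PI_ge2; lra.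
  by rewrite gt_eqF //; apply: (@lt_le_trans _ _ (1 - g)); [|apply: sin_PI_ge2]; lra.
have e2 : ec g = cos (PI * g) ^+ 2 - sin (PI * g) ^+ 2.
  rewrite /ec (_ : 2 * PI * g = PI * g + PI * g); last by ring.
  by rewrite [LHS]cos_plus !(RmultE, RminusE) !expr2.
have e3 : es g = 2 * sin (PI * g) * cos (PI * g).
  rewrite /es (_ : 2 * PI * g = PI * g + PI * g); last by ring.
  by rewrite [LHS]sin_plus !(RmultE, RplusE); ring.
have e1 : cos (PI * g) ^+ 2 + sin (PI * g) ^+ 2 = 1.
  by have := sin2_cos2 (PI * g)%R; rewrite /Rsqr !(RmultE, RplusE) -!expr2 addrC.
rewrite ecD esD e2 e3 /ct.
set c := cos _ in e1 *; set s := sin _ in e1 sg *.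
have c2 : c ^+ 2 = 1 - s ^+ 2 by rewrite -e1; ring.
have -> : c / s * (es f * (c ^+ 2 - s ^+ 2) + ec f * (2 * s * c) - es f) =
    2 * c ^+ 2 * ec f - 2 * (s * c) * es f.
  by rewrite {1}c2; field.
by rewrite c2; field.
Qed.

(** Partial summation: the two boundary terms cost [2 * K], and monotonicity lets the differences of
    [c] telescope to another [2 * K]. *)
Lemma abel_bound (c s : nat -> R) L K : 0 <= K ->
  (forall n, (n < L)%N -> `|c n| <= K) -> (forall n, (n.+1 < L)%N -> c n.+1 <= c n) ->
  (forall n, `|s n| <= 1) ->
  `|\sum_(n < L) c n * (s n.+1 - s n)| <= 4 * K.
Proof.
move=> K0; case: L => [|L] cK cd s1.
  by rewrite big_ord0 normr0 mulr_ge0.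
have ids : \sum_(n < L.+1) c n * (s n.+1 - s n) =
    c L * s L.+1 - c 0%N * s 0%N + \sum_(n < L) (c n - c n.+1) * s n.+1.
  elim: L {cK cd} => [|L IH]; first by rewrite big_ord_recr !big_ord0 /=; ring.
  by rewrite big_ord_recr /= IH [in RHS]big_ord_recr /=; ring.
have tel : \sum_(n < L) `|(c n - c n.+1) * s n.+1| <= c 0%N - c L.
  have -> : c 0%N - c L = \sum_(n < L) (c n - c n.+1).
    elim: L {cK cd ids} => [|L IH]; first by rewrite big_ord0 subrr.
    by rewrite big_ord_recr /= -IH; ring.
  apply: ler_sum => n _; have nL := ltn_ord n.
  have d0 : 0 <= c n - c n.+1 by rewrite subr_ge0; apply: cd.
  by rewrite normrM ger0_norm // ler_piMr.
have b0 := cK 0%N isT; have bL := cK L (ltnSn _).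
have e1 : `|c L * s L.+1| <= K by rewrite normrM -[leRHS]mulr1 ler_pM.
have e2 : `|c 0%N * s 0%N| <= K by rewrite normrM -[leRHS]mulr1 ler_pM.
rewrite ids; apply: le_trans (ler_normD _ _) _.
have h1 := ler_normB (c L * s L.+1) (c 0%N * s 0%N).
have h2 := le_trans (ler_norm_sum _ _ _) tel.
move: b0 bL; rewrite !ler_norml => /andP[_ b0] /andP[bL _]; lra.
Qed.

(* Kusmin-Landau inequality, for finite differences instead of derivatives *)
Lemma kusmin_landau (f : nat -> R) (z : int) L t : 0 < t ->
  (forall n, (n < L)%N -> z%:~R + t <= f n.+1 - f n /\ f n.+1 - f n <= z%:~R + 1 - t) ->
  (forall n, (n.+1 < L)%N -> f n.+1 - f n <= f n.+2 - f n.+1) ->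
  `|\sum_(n < L) ec (f n)| <= 3 / t.
Proof.
move=> t0 fb fm.
case: (posnP L) => [->|L0]; first by rewrite big_ord0 normr0 divr_ge0 ?ltW.
have t1 : t <= 1/2 by have [] := fb 0%N L0; lra.
(* Subtracting the integer [z * n] changes no value of [ec] and moves the slopes into
   [[t, 1 - t]]. *)
pose g n := f n - (z * n%:Z)%:~R.
have gd n : g n.+1 - g n = f n.+1 - f n - z%:~R.
  by rewrite /g !intrM -!pmulrn -natr1; ring.
have eg n : ec (f n) = ec (g n) by rewrite -(ecDz (g n) (z * n%:Z)) subrK.
under eq_bigr => n _ do rewrite eg.
have gb n : (n < L)%N -> t <= g n.+1 - g n /\ g n.+1 - g n <= 1 - t.
  by move=> /fb; rewrite gd; lra.
have stp (n : 'I_L) : ec (g n) = - (1/2) * (ec (g n.+1) - ec (g n)) +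
      1/2 * (ct (g n.+1 - g n) * (es (g n.+1) - es (g n))).
  have [b1 b2] := gb n (ltn_ord n).
  by rewrite {1}(@ec_step (g n) (g n.+1 - g n)) ?(addrC (g n)) ?subrK //; lra.
under eq_bigr => n _ do rewrite stp.
rewrite big_split /= -!mulr_sumr.
have -> : \sum_(i < L) (ec (g i.+1) - ec (g i)) = ec (g L) - ec (g 0%N).
  by rewrite -(big_mkord xpredT (fun i => ec (g i.+1) - ec (g i))) telescope_sumr.
have ab : `|\sum_(i < L) ct (g i.+1 - g i) * (es (g i.+1) - es (g i))| <= 4 * t^-1.
  apply: (@abel_bound (fun i => ct (g i.+1 - g i)) (fun i => es (g i))).
  - by rewrite invr_ge0 ltW.
  - by move=> n nL; have [] := gb n nL; apply: normr_ct.
  - move=> n nL; have [b1 _] := gb n (ltnW nL); have [_ b2] := gb n.+1 nL.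
    by apply: (@ct_anti t) => //; rewrite !gd lerD2r; apply: fm.
  - by move=> n; apply: normr_es.
have c1 := normr_ec (g L); have c2 := normr_ec (g 0%N).
(* The pieces add up to [1 + 2/t]; [t <= 1/2] absorbs the 1. *)
have ti : 2 <= t^-1 by rewrite -[2]invrK lef_pV2 ?posrE ?invr_gt0 //; lra.
move: ab c1 c2; rewrite !ler_norml => /andP[? ?] /andP[? ?] /andP[? ?].
by apply/andP; split; lra.
Qed.

(** The summation conditions that occur (a range for the slope, a range for a product) are convex in
    the index, while the difference tests want consecutive integers. The empty case is [b = 0]. *)
Lemma convex_pred_window (p : pred nat) L :
  (forall i j k, (i <= j <= k)%N -> (k < L)%N -> p i -> p k -> p j) ->
  exists a b, (a + b <= L)%N /\ forall n, (n < L)%N -> p n = (a <= n < a + b)%N.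
Proof.
elim: L => [|L IH] cvx; first by exists 0%N, 0%N.
have [|a [b [abL pE]]] := IH.
  by move=> i j k ij kL; apply: cvx ij (ltnW kL).
case pL: (p L); last first.
  exists a, b; split; first by apply: leqW.
  move=> n; rewrite ltnS leq_eqVlt => /orP[/eqP->|]; last exact: pE.
  by rewrite pL; lia.
case: (posnP b) => [b0|b0].
  exists L, 1%N; split; first lia.
  move=> n; rewrite ltnS leq_eqVlt => /orP[/eqP->|nL]; first by rewrite pL; lia.
  by rewrite pE //; lia.
have abE : (a + b = L)%N.
  apply/eqP; rewrite eqn_leq abL leqNgt; apply/negP => h.
  have := pE _ h; rewrite (cvx a (a + b)%N L) ?pL ?pE //; lia.
exists a, b.+1; split; first lia.
move=> n; rewrite ltnS leq_eqVlt => /orP[/eqP->|nL]; first by rewrite pL; lia.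
by rewrite pE //; lia.
Qed.

Lemma convex_sum_window (p : pred nat) L :
  (forall i j k, (i <= j <= k)%N -> (k < L)%N -> p i -> p k -> p j) ->
  exists a b, [/\ (a + b <= L)%N, forall n, (n < b)%N -> p (a + n)%N &
    forall F : nat -> R, \sum_(n < L | p n) F n = \sum_(n < b) F (a + n)%N].
Proof.
move=> /convex_pred_window[a [b [abL pE]]]; exists a, b; split=> // [n nb|F].
  by rewrite pE; lia.
rewrite (eq_bigl (fun n : 'I_L => (a <= n)%N && (n < a + b)%N)); last first.
  by move=> n; rewrite pE.
rewrite -(big_mkord (fun n => (a <= n)%N && (n < a + b)%N) F) -(big_nat_widen _ _ _ _ _ abL).
rewrite -(@big_nat_widenl _ _ _ a 0 (a + b)%N xpredT) // -{1}[a]add0n big_addn addKn.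
by rewrite big_mkord; under eq_bigr => n _ do rewrite addnC.
Qed.

Lemma ler_norm_sum_const (I : finType) (P : pred I) (F : I -> R) K :
  (forall i, P i -> `|F i| <= K) -> `|\sum_(i | P i) F i| <= #|P|%:R * K.
Proof.
move=> FK; apply: le_trans (ler_norm_sum _ _ _) _; apply: le_trans (ler_sum _ FK) _.
by rewrite sumr_const mulr_natl.
Qed.

Ltac nlia := repeat match goal with
  | H : is_true (leq _ _) |- _ => revert H
  | H : is_true (leq _ _ && leq _ _) |- _ => revert H
  | H : @eq nat _ _ |- _ => revert H
  end; clear; intros; lia.

Ltac split_andb := repeat match goal with
  | H : is_true (_ && _) |- _ => case/andP: H => ? ?
  | |- is_true (_ && _) => apply/andP; split
  end.
Ltac blra := rewrite -?leNgt -?leNgt; apply/idP/idP => ?; split_andb; lra.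

Section SecondDifference.
Variables (f : nat -> R) (L : nat) (s A : R).
Hypothesis s0 : 0 < s.
Hypothesis s1 : s < 1/2.
Let g n : R := f n.+1 - f n.
Hypothesis g_step : forall n, (n < L)%N -> s ^+ 2 <= g n.+1 - g n <= A * s ^+ 2.

Let g_ge a n : (a + n < L)%N -> g a + s ^+ 2 * n%:R <= g (a + n).
Proof.
elim: n => [|n IH] h; first by rewrite addn0 mulr0 addr0.
have /IH h1 : (a + n < L)%N by lia.
have /g_step /andP[h2 _] : (a + n < L)%N by lia.
by rewrite addnS -natr1; lra.
Qed.

Let g_le n : (n < L)%N -> g n <= g 0 + A * s ^+ 2 * n%:R.
Proof.
elim: n => [|n IH] h; first by rewrite mulr0 addr0.
have /IH h1 : (n < L)%N by lia.
have /g_step /andP[_ h2] : (n < L)%N by lia.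
by rewrite -natr1; lra.
Qed.

Let g_mono i j : (i <= j)%N -> (j < L)%N -> g i <= g j.
Proof.
move=> ij jL; have := @g_ge i (j - i); rewrite subnKC // => /(_ jL).
by apply: le_trans; rewrite lerDl mulr_ge0 ?sqr_ge0 ?ler0n.
Qed.

Let window (u v : R) := exists a b, [/\ (a + b <= L)%N,
    forall n, (n < b)%N -> u <= g (a + n) < v &
    forall F : nat -> R, \sum_(n < L | u <= g n < v) F n = \sum_(n < b) F (a + n)%N].

Let windowP (u v : R) : window u v.
Proof.
apply: (@convex_sum_window (fun n => u <= g n < v)) => i j k /andP[ij jk] kL.
move=> /andP[ui _] /andP[_ kv]; apply/andP; split.
  by apply: (le_trans ui); apply: g_mono => //; apply: leq_ltn_trans kL.
by apply: le_lt_trans kv; apply: g_mono.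
Qed.

(** The slope grows by at least [s ^+ 2] per step, so it spends at most [1 + 1/s] steps in an
    interval of length [s]; no cancellation is used. *)
Let edge_bound (u : R) : `|\sum_(n < L | u <= g n < u + s) ec (f n)| <= 1 + 1 / s.
Proof.
have [a [b [abL gW sE]]] := windowP u (u + s); rewrite (sE (fun n => ec (f n))) {sE}.
apply: le_trans (ler_norm_sum_const (fun i _ => normr_ec _)) _.
rewrite mulr1 cardE size_enum_ord /=.
case: b abL gW => [|b] abL gW; first by rewrite addr_ge0 // divr_ge0 // ltW.
have /andP[h1 _] := gW 0%N isT; rewrite addn0 in h1.
have /andP[_ h2] := gW b (ltnSn _).
have := @g_ge a b; rewrite -natr1 => /(_ _)-h3.
have {}h3 : g a + s ^+ 2 * b%:R <= g (a + b) by apply: h3; lia.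
rewrite addrC lerD2l ler_pdivlMr // mulrC.
rewrite -(ler_pM2l s0) mulrA -expr2 mulr1; lra.
Qed.

Let mid_bound (z : int) : `|\sum_(n < L | z%:~R + s <= g n < z%:~R + 1 - s) ec (f n)| <= 3 / s.
Proof.
have [a [b [abL gW sE]]] := windowP (z%:~R + s) (z%:~R + 1 - s); rewrite (sE (fun n => ec (f n))) {sE}.
apply: (@kusmin_landau (fun n => f (a + n)%N) z) => // n nb.
  by rewrite addnS; have /andP[h1 /ltW h2] := gW n nb.
by have := @g_mono (a + n) (a + n).+1; rewrite /g !addnS; apply; lia.
Qed.

Let unit_bound (z : int) : `|\sum_(n < L | z%:~R <= g n < z%:~R + 1) ec (f n)| <= 7 / s.
Proof.
have p0 := s0; have p1 := s1.
rewrite (bigID (fun n : 'I_L => g n < z%:~R + s)) /=.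
rewrite (eq_bigl (fun n : 'I_L => z%:~R <= g n < z%:~R + s)); last by move=> n; blra.
rewrite [X in _ + X](bigID (fun n : 'I_L => g n < z%:~R + 1 - s)) /=.
rewrite [X in _ + (X + _)](eq_bigl (fun n : 'I_L => z%:~R + s <= g n < z%:~R + 1 - s)); last by move=> n; blra.
rewrite [X in _ + (_ + X)](eq_bigl (fun n : 'I_L => z%:~R + 1 - s <= g n < z%:~R + 1 - s + s)); last by move=> n; blra.
have h1 := edge_bound z%:~R; have h2 := mid_bound z; have h3 := edge_bound (z%:~R + 1 - s).
apply: le_trans (ler_normD _ _) _; apply: le_trans (lerD h1 (ler_normD _ _)) _.
apply: le_trans (lerD (lexx _) (lerD h2 h3)) _.
have : 2 <= 1 / s by rewrite ler_pdivlMr //; lra.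
rewrite !mul1r; lra.
Qed.

(** The slopes increase and meet at most [y + 2] unit intervals, [y = A * s ^+ 2 * L], each costing
    [7 / s]. Inside a unit interval, distance [s] from the integers is where the trivial count and
    Kusmin-Landau cost the same. *)
Lemma second_difference_small : 1 <= A -> `|\sum_(n < L) ec (f n)| <= 14 * (A * L%:R * s + 1 / s).
Proof.
have p0 := s0; have p1 := s1; move=> A1; case: (posnP L) => [->|L0].
  by rewrite big_ord0 normr0 mulr0 mul0r add0r mulr_ge0 ?divr_ge0 ?ltW.
pose z := Num.floor (g 0).
have /andP[z1 z2] := floor_itv (g 0).
pose y := A * s ^+ 2 * L%:R.
have y0 : 0 <= y by rewrite !mulr_ge0 ?sqr_ge0 //; lra.
have /andP[y1 y2] := truncn_itv y0.
pose K := (Num.trunc y).+1.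
have gz n : (n < L)%N -> z%:~R <= g n.
  by move=> nL; apply: (le_trans z1); apply: g_mono.
have gK n : (n < L)%N -> g n - z%:~R < K.+1%:R.
  move=> nL; have := g_le nL.
  have : A * s ^+ 2 * n%:R <= y by rewrite ler_pM2l ?ler_nat 1?ltnW // mulr_gt0 ?exprn_gt0 //; lra.
  by move: z2 y2; rewrite /K intrD -(natr1 (Num.trunc y).+1) /z; lra.
have cls (n : 'I_L) (k : 'I_K.+1) :
    (inord (Num.trunc (g n - z%:~R)) == k) = (z%:~R + k%:R <= g n < z%:~R + k%:R + 1).
  have h0 : 0 <= g n - z%:~R by rewrite subr_ge0 gz.
  have tK : (Num.trunc (g n - z%:~R) < K.+1)%N by rewrite truncn_lt_nat // gK.
  have /andP[t1 t2] := truncn_itv h0.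
  apply/eqP/idP => [<-|/andP[h1 h2]].
    by rewrite inordK //; move: t1 t2; rewrite -natr1; lra.
  apply/val_inj; rewrite /= inordK //; apply/eqP; rewrite eqn_leq.
  rewrite -ltnS truncn_lt_nat // truncn_ge_nat // -natr1; lra.
rewrite (partition_big (fun n : 'I_L => inord (Num.trunc (g n - z%:~R)) : 'I_K.+1) xpredT) //=.
apply: le_trans (ler_norm_sum_const (K := 7 / s) _) _ => [k _|].
  rewrite (eq_bigl _ _ (fun n => cls n k)).
  by have := unit_bound (z + k%:Z); rewrite intrD.
rewrite cardE size_enum_ord /=.
have si : 0 < s^-1 by rewrite invr_gt0.
apply: (@le_trans _ _ ((y + 2) * (7 / s))).
  by rewrite ler_pM2r ?mulr_gt0 // /K -!natr1; lra.
have ->: (y + 2) * (7 / s) = 7 * (A * L%:R * s) + 14 * (1 / s).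
  by rewrite /y; field; rewrite gt_eqF.
have : 0 <= A * L%:R * s by rewrite !mulr_ge0 ?(ltW p0) //; lra.
lra.
Qed.

End SecondDifference.

(* van der Corput's second derivative test *)
Lemma second_difference_test (f : nat -> R) L s A : 0 < s -> 1 <= A ->
  (forall n, (n < L)%N -> s ^+ 2 <= f n.+2 - f n.+1 - (f n.+1 - f n) <= A * s ^+ 2) ->
  `|\sum_(n < L) ec (f n)| <= 14 * (A * L%:R * s + 1 / s).
Proof.
(* For [s >= 1/2] the trivial bound [L] is already below the claim. *)
move=> s0 A1 fs; have [s1|s1] := ltP s (1/2); first exact: second_difference_small.
apply: le_trans (ler_norm_sum_const (fun i _ => normr_ec _)) _.
rewrite mulr1 cardE size_enum_ord /=.
have h1 : 0 <= 1 / s by rewrite divr_ge0 ?ltW.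
have h2 : L%:R * 1 <= L%:R * (2 * s) by apply: ler_wpM2l => //; lra.
have h3 : 1 * (L%:R * s) <= A * (L%:R * s) by apply: ler_wpM2r => //; rewrite mulr_ge0 // ltW.
by have := ler0n R L; move: h2 h3; rewrite mulr1 mul1r mulrCA -(mulrA A) => h2 h3 h4; lra.
Qed.

(** * Fourier approximation of the sawtooth *)

Definition saw (H : nat) (t : R) : R := \sum_(h < H) es (t * h.+1%:R) / (PI * h.+1%:R).

Lemma sawE H t : sawtooth_sum H t = saw H t.
Proof.
elim: H => [|H IH]; first by rewrite /saw big_ord0.
by rewrite /= IH /saw big_ord_recr /= /es !RE /= natr1.
Qed.

(** The average over [K < H] of Fejer kernels of length [K.+1], normalised to 1 at the integers. A
    single kernel has zeros and decays like [1/(H t)^2]; the average over lengths dominates a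
    multiple of [min(1, 1/(H t))], which is the size of the truncation error. *)
Definition fejer (H : nat) (t : R) : R := H%:R^-1 * \sum_(K < H) K.+1%:R ^- 2 *
  ((\sum_(k < K.+1) ec (t * k%:R)) ^+ 2 + (\sum_(k < K.+1) es (t * k%:R)) ^+ 2).

Lemma fejer_term_ge0 (t : R) K : 0 <= K.+1%:R ^- 2 *
  ((\sum_(k < K.+1) ec (t * k%:R)) ^+ 2 + (\sum_(k < K.+1) es (t * k%:R)) ^+ 2).
Proof. by rewrite mulr_ge0 ?invr_ge0 ?exprn_ge0 // addr_ge0 // sqr_ge0. Qed.

Lemma ec_ge_half (y : R) : 0 <= y -> y <= 1 / 6 -> 1 / 2 <= ec y.
Proof.
move=> y0 y1; have p3 := PI_gt3.
have h := @cos_ge_half (2 * PI * y) _ _.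
rewrite !RE /= in h; rewrite /ec; apply/RleP/h; apply/RleP; rewrite ?RE /=.
  by apply: mulr_ge0 => //; apply: mulr_ge0 => //; lra.
nra.
Qed.

(** For [K <= y] all angles are at most 1/6, so all cosines are at least 1/2 and the kernel is at
    least 1/4. At least [y] indices qualify, since 0 is one of them. *)
Lemma fejer_ge (H : nat) (u y : R) : (0 < H)%N -> 0 <= u -> 0 <= y -> y <= H%:R -> y * u <= 1 / 6 ->
  y / (4 * H%:R) <= fejer H u.
Proof.
move=> H0 u0 y0 yH yu.
have HR : 0 < H%:R :> R by rewrite ltr0n.
rewrite /fejer; have -> : y / (4 * H%:R) = H%:R^-1 * (y / 4) by field; rewrite gt_eqF.
rewrite ler_pM2l ?invr_gt0 //.
apply: (@le_trans _ _ (\sum_(K < H | K%:R <= y) (1 / 4))); last first.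
  rewrite big_mkcond /=; apply: ler_sum => K _; case: ifP => Ky; last exact: fejer_term_ge0.
  have KR : 0 < K.+1%:R :> R by rewrite ltr0n.
  have cb : K.+1%:R * (1 / 2) <= \sum_(k < K.+1) ec (u * k%:R).
    rewrite -[K.+1 in X in X * _]card_ord mulr_natl -sumr_const; apply: ler_sum => k _.
    apply: ec_ge_half; first by rewrite mulr_ge0.
    apply: le_trans yu; rewrite mulrC; apply: ler_wpM2r => //.
    by apply: le_trans Ky; rewrite ler_nat -ltnS.
  rewrite [leRHS]mulrC ler_pdivlMr ?exprn_gt0 //.
  have h : (K.+1%:R * (1 / 2)) ^+ 2 <= (\sum_(k < K.+1) ec (u * k%:R)) ^+ 2.
    have c0 : 0 <= K.+1%:R * (1 / 2) :> R by apply: mulr_ge0 => //; lra.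
    by rewrite lerXn2r ?nnegrE // (le_trans c0).
  have := sqr_ge0 (\sum_(k < K.+1) es (u * k%:R)); move: h; rewrite exprMn.
  lra.
have cnt : y <= \sum_(K < H | K%:R <= y) 1.
  have /andP[T1 T2] := truncn_itv y0; set T := Num.trunc y in T1 T2.
  apply: (@le_trans _ _ (minn H T.+1)%:R).
    by case: (leqP H T.+1) => // _; apply: ltW.
  rewrite -[minn H T.+1 in leLHS]card_ord -sumr_const.
  rewrite (big_ord_widen H (fun=> (1 : R)) (geq_minl H T.+1)).
  rewrite big_mkcond [leRHS]big_mkcond /=; apply: ler_sum => K _.
  case: ifP => [|_]; last by case: ifP.
  rewrite leq_min ltnS => /andP[_ KT]; rewrite ifT //.
  by apply: le_trans T1; rewrite ler_nat.
rewrite (eq_bigr (fun=> 1 * (1 / 4))) => [|? _]; last by rewrite [RHS]mul1r.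
rewrite -mulr_suml; lra.
Qed.

(** Two regimes of [fejer_ge]: [y = H] when [H t <= 1/6], where the error is bounded by a constant,
    and [y = 1/(6t)] beyond, to be compared with [sawtooth_bound]. *)
Lemma saw_fejer_half H (t : R) : (0 < H)%N -> 0 < t -> t <= 1 / 2 -> `|t - 1 / 2 + saw H t| <= 8 * fejer H t.
Proof.
move=> H0 t0 t1; have HR : 0 < H%:R :> R by rewrite ltr0n.
have p3 := PI_gt3; have sp := sin_PI_ge (ltW t0) t1.
have h1 : `|t - 1 / 2 + saw H t| <= 2 / ((2 * H%:R + 1) * PI * sin (PI * t)).
  have := @sawtooth_bound H t; rewrite sawE !RE /= => h; apply/RleP/h; first exact/RltP.
  by apply/RleP; rewrite ?RE /=.
have h2 : `|saw H t| <= 2 * H%:R * t.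
  have := @sawtooth_sum_le H t; rewrite sawE !RE /= => h; apply/RleP/h; apply/RleP; rewrite ?RE /=; lra.
have [Ht|Ht] := leP (H%:R * t) (1 / 6).
  have f1 := fejer_ge H0 (ltW t0) (ltW HR) (lexx _) Ht.
  have e : H%:R / (4 * H%:R) = 1 / 4 :> R by field; rewrite gt_eqF.
  rewrite e in f1; apply: le_trans (ler_normD _ _) _.
  have : `|t - 1 / 2| <= 1 / 2 by rewrite ler_norml; apply/andP; split; lra.
  lra.
have f1 : (1 / (6 * t)) / (4 * H%:R) <= fejer H t.
  apply: fejer_ge => //; first exact: ltW.
  - by apply: divr_ge0 => //; apply: mulr_ge0 => //; apply: ltW.
  - by rewrite ler_pdivrMr ?mulr_gt0 //; lra.
  - by rewrite (_ : 1 / (6 * t) * t = 1 / 6) //; field; rewrite gt_eqF.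
apply: (le_trans h1); apply: (@le_trans _ _ (8 * (1 / (6 * t) / (4 * H%:R)))); last by rewrite ler_pM2l.
have -> : 8 * (1 / (6 * t) / (4 * H%:R)) = 2 / (6 * H%:R * t) by field; rewrite !gt_eqF.
rewrite ler_pM2l // lef_pV2 ?posrE.
- have a1 : H%:R * t <= H%:R * sin (PI * t) by rewrite ler_pM2l.
  have a2 : 0 <= H%:R * sin (PI * t) by apply: mulr_ge0; lra.
  have a3 : 3 * (H%:R * sin (PI * t)) <= PI * (H%:R * sin (PI * t)) by apply: ler_wpM2r => //; apply: ltW.
  have a4 : 0 <= PI * sin (PI * t) by apply: mulr_ge0; lra.
  have -> : (2 * H%:R + 1) * PI * sin (PI * t) = 2 * (PI * (H%:R * sin (PI * t))) + PI * sin (PI * t) by ring.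
  lra.
- apply: mulr_gt0; last by lra.
  by apply: mulr_gt0; lra.
- by apply: mulr_gt0 => //; apply: mulr_gt0.
Qed.

Lemma ec_reflect (t : R) (k : nat) : ec ((1 - t) * k%:R) = ec (t * k%:R).
Proof. by rewrite mulrBl mul1r addrC (ecDz _ k%:Z) ecN. Qed.

Lemma es_reflect (t : R) (k : nat) : es ((1 - t) * k%:R) = - es (t * k%:R).
Proof. by rewrite mulrBl mul1r addrC (esDz _ k%:Z) esN. Qed.

Lemma fejer_reflect H (t : R) : fejer H (1 - t) = fejer H t.
Proof.
rewrite /fejer; congr (_ * _); apply: eq_bigr => K _; congr (_ * (_ ^+ 2 + _)).
  by apply: eq_bigr => k _; rewrite ec_reflect.
by under eq_bigr => k _ do rewrite es_reflect; rewrite sumrN sqrrN.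
Qed.

Lemma saw_reflect H (t : R) : saw H (1 - t) = - saw H t.
Proof.
by rewrite /saw -sumrN; apply: eq_bigr => h _; rewrite es_reflect mulNr.
Qed.

Lemma saw_fejer01 H (t : R) : (0 < H)%N -> 0 <= t -> t < 1 -> `|t - 1 / 2 + saw H t| <= 8 * fejer H t.
Proof.
move=> H0 t0 t1; have HR : 0 < H%:R :> R by rewrite ltr0n.
(* At an integer the series is 0 and misses the value by 1/2, but there the majorant is at least
   1/4. *)
have [tz|tn] := eqVneq t 0.
  have f1 := @fejer_ge H t H%:R H0 t0 (ltW HR) (lexx _).
  have {f1} : H%:R / (4 * H%:R) <= fejer H t by apply: f1; rewrite tz mulr0; lra.
  have -> : H%:R / (4 * H%:R) = 1 / 4 :> R by field; rewrite gt_eqF.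
  rewrite {2 3}tz /saw big1 => [|h _]; last by rewrite mul0r /es mulr0 (sin_0 : sin 0 = 0) mul0r.
  rewrite addr0 add0r normrN ger0_norm //; lra.
have {}t0 : 0 < t by rewrite lt_def tn.
have [t2|t2] := leP t (1 / 2); first exact: saw_fejer_half.
rewrite -fejer_reflect (_ : t - 1 / 2 + saw H t = - ((1 - t) - 1 / 2 + saw H (1 - t))).
  by rewrite normrN; apply: saw_fejer_half => //; lra.
by rewrite saw_reflect; field.
Qed.

Definition psi (y : R) : R := y - (Num.floor y)%:~R - 1 / 2.

Lemma shift_int (y : R) (k : nat) : y * k%:R = (y - (Num.floor y)%:~R) * k%:R + (Num.floor y * k%:Z)%:~R.
Proof. by rewrite intrM; ring. Qed.

Lemma psi_fejer H (y : R) : (0 < H)%N -> `|psi y + saw H y| <= 8 * fejer H y.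
Proof.
move=> H0; have /andP[y0 y1] := floor_itv y; set t := y - (Num.floor y)%:~R.
have ec_t k : ec (y * k%:R) = ec (t * k%:R) by rewrite shift_int ecDz.
have es_t k : es (y * k%:R) = es (t * k%:R) by rewrite shift_int esDz.
have -> : saw H y = saw H t by apply: eq_bigr => h _; rewrite es_t.
have -> : fejer H y = fejer H t.
  rewrite /fejer; congr (_ * _); apply: eq_bigr => K _; congr (_ * (_ ^+ 2 + _ ^+ 2)).
    by apply: eq_bigr => k _; rewrite ec_t.
  by apply: eq_bigr => k _; rewrite es_t.
apply: saw_fejer01 => //; first by rewrite subr_ge0.
by move: y1; rewrite intrD /t; lra.
Qed.

(** Opening the squares produces the frequencies [k - l]. The diagonal costs [#|P| / K.+1] and the
    other pairs at most [E] in total; averaging over [K] turns the diagonal into [#|P| * Hs / H]. *)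
Lemma fejer_sum_le (I : finType) (P : pred I) (y : I -> R) (H : nat) (E Hs : R) : (0 < H)%N -> 0 <= E ->
  (forall l, (0 < l < H)%N -> `|\sum_(i | P i) ec (y i * l%:R)| <= E) ->
  \sum_(K < H) K.+1%:R^-1 <= Hs ->
  \sum_(i | P i) fejer H (y i) <= #|P|%:R * Hs / H%:R + E.
Proof.
move=> H0 E0 yE HsE; have HR : 0 < H%:R :> R by rewrite ltr0n.
rewrite /fejer -mulr_sumr exchange_big /=.
have -> : #|P|%:R * Hs / H%:R + E = H%:R^-1 * (#|P|%:R * Hs + H%:R * E) by field; rewrite gt_eqF.
apply: ler_wpM2l; first by rewrite invr_ge0.
apply: (@le_trans _ _ (\sum_(K < H) (#|P|%:R * K.+1%:R^-1 + E))); last first.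
  by rewrite big_split /= -mulr_sumr sumr_const card_ord -(mulr_natl E H) lerD2r; apply: ler_wpM2l.
apply: ler_sum => K _.
have KR : 0 < K.+1%:R :> R by rewrite ltr0n.
rewrite -mulr_sumr mulrC ler_pdivrMr ?exprn_gt0 //.
have -> : (#|P|%:R * K.+1%:R^-1 + E) * K.+1%:R ^+ 2 = K.+1%:R * #|P|%:R + K.+1%:R * (K.+1%:R * E) :> R.
  by move: (K.+1%:R : R) KR => r r0; field; rewrite gt_eqF.
have ex i : (\sum_(k < K.+1) ec (y i * k%:R)) ^+ 2 + (\sum_(k < K.+1) es (y i * k%:R)) ^+ 2 =
    \sum_(k < K.+1) \sum_(l < K.+1) ec (y i * k%:R - y i * l%:R).
  rewrite !expr2 !big_distrlr /= -big_split /=; apply: eq_bigr => k _.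
  by rewrite -big_split /=; apply: eq_bigr => l _; rewrite ecB.
under eq_bigr => i _ do rewrite ex.
rewrite exchange_big /= -mulrDr -[K.+1 in X in X * (_ + _)]card_ord mulr_natl -sumr_const.
apply: ler_sum => k _; rewrite exchange_big /= (bigD1 k) //=; apply: lerD.
  under eq_bigr => i _ do rewrite subrr ec0.
  by rewrite sumr_const.
apply: (@le_trans _ _ (\sum_(l < K.+1 | l != k) E)); last first.
  rewrite sumr_const -[leLHS]mulr_natl; apply: ler_wpM2r => //.
  by rewrite ler_nat -[leqRHS]card_ord; apply: max_card.
apply: ler_sum => l lk; apply: le_trans (ler_norm _) _.
have kH : (k < H)%N by apply: leq_trans (ltn_ord k) (ltn_ord K).
have lH : (l < H)%N by apply: leq_trans (ltn_ord l) (ltn_ord K).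
have [kl|kl|kl] := ltngtP l k.
- have := yE (k - l)%N; rewrite subn_gt0 kl (leq_ltn_trans (leq_subr _ _) kH) => /(_ isT).
  congr (`|_| <= _); apply: eq_bigr => i _; by rewrite natrB 1?ltnW // mulrBr.
- have := yE (l - k)%N; rewrite subn_gt0 kl (leq_ltn_trans (leq_subr _ _) lH) => /(_ isT).
  congr (`|_| <= _); apply: eq_bigr => i _; by rewrite natrB 1?ltnW // mulrBr -ecN opprB.
- by case/eqP: lk; apply/val_inj.
Qed.

(** * Phases *)

Lemma second_difference_window (f : nat -> R) (p : pred nat) B (s A len : R) :
  0 < s -> 1 <= A -> 0 <= len ->
  (forall i j k, (i <= j <= k)%N -> (k < B)%N -> p i -> p k -> p j) ->
  (forall m, (m < B)%N -> p m -> s ^+ 2 <= f m.+2 - f m.+1 - (f m.+1 - f m) <= A * s ^+ 2) ->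
  (forall i k, (i <= k < B)%N -> p i -> p k -> (k - i).+1%:R <= len) ->
  `|\sum_(m < B | p m) ec (f m)| <= 14 * (A * len * s + 1 / s).
Proof.
move=> s0 A1 len0 cvx fs pl.
have [a [b [abB pab sE]]] := convex_sum_window cvx.
rewrite (sE (fun m => ec (f m))) {sE}.
apply: (@le_trans _ _ (14 * (A * b%:R * s + 1 / s))).
  apply: (@second_difference_test (fun n => f (a + n)%N)) => // n nb.
  by rewrite !addnS; apply: fs; [lia | exact: pab].
rewrite ler_pM2l // lerD2r ler_pM2r // ler_pM2l; last by lra.
case: b pab abB => [//|b] pab abB.
have := pl a (a + b)%N; rewrite addKn; apply; first lia.
- by have := pab 0%N isT; rewrite addn0.
- exact: pab.
Qed.

(** The second difference of [1/y] with step 1 is exactly [2 / cub y]; hence this product in the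
    place of the cube. *)
Definition cub (y : R) : R := y * (y + 1) * (y + 2).

Lemma second_difference_inv (y : R) : 0 < y ->
  (y + 2)^-1 - (y + 1)^-1 - ((y + 1)^-1 - y^-1) = 2 / cub y.
Proof.
move=> y0; rewrite /cub; field.
by rewrite !gt_eqF //; lra.
Qed.

Lemma cub_gt0 (y : R) : 0 < y -> 0 < cub y.
Proof. by move=> y0; rewrite /cub !mulr_gt0 //; lra. Qed.

Lemma cub_mono (y z : R) : 0 < y -> y <= z -> cub y <= cub z.
Proof. by move=> y0 yz; rewrite /cub !ler_pM ?mulr_ge0 //; lra. Qed.

(** Shifting by [t <= e * m] multiplies [cub] by at most [(1+e)^3], and [(1+e)^3 (1-7e) <= 1] for
    [0 <= e <= 1]. *)
Lemma inv_cub_shift (m t e : R) : 1 <= m -> 0 <= t -> t <= e * m -> e <= 1 ->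
  (cub m)^-1 * (1 - 7 * e) <= (cub (m + t))^-1 <= (cub m)^-1.
Proof.
move=> m1 t0 te e1.
have m0 : 0 < m by lra.
have mt0 : 0 < m + t by lra.
have c0 := cub_gt0 m0; have ct0 := cub_gt0 mt0.
have e0 : 0 <= e by rewrite -(pmulr_lge0 e m0); apply: le_trans te.
apply/andP; split; last by rewrite lef_pV2 //; apply: cub_mono => //; lra.
rewrite -[leRHS]mul1r ler_pdivlMr // -mulrA mulrC ler_pdivrMr // mul1r mulrC.
have h1 : cub (m + t) <= cub m * (1 + e) ^+ 3.
  have -> : cub m * (1 + e) ^+ 3 = (m * (1 + e)) * ((m + 1) * (1 + e)) * ((m + 2) * (1 + e)).
    by rewrite /cub; ring.
  have me : 0 <= m * e by rewrite mulr_ge0 // ltW.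
  by rewrite /cub !ler_pM ?mulr_ge0 //; lra.
have h2 : (1 + e) ^+ 3 * (1 - 7 * e) <= 1.
  have e2 : e ^+ 2 <= e by rewrite expr2; nra.
  have [h|h] := leP (1 - 7 * e) 0.
    by apply: (@le_trans _ _ 0) => //; rewrite mulr_ge0_le0 // exprn_ge0 //; lra.
  have h3 : (1 + e) ^+ 3 <= 1 + 7 * e.
    have -> : (1 + e) ^+ 3 = 1 + 3 * e + 3 * e ^+ 2 + e * e ^+ 2 by ring.
    have : e * e ^+ 2 <= 1 * e by rewrite ler_pM ?sqr_ge0.
    lra.
  apply: (@le_trans _ _ ((1 + 7 * e) * (1 - 7 * e))); first by rewrite ler_pM2r.
  nra.
have [h|h] := leP (1 - 7 * e) 0.
  by apply: (@le_trans _ _ 0); [apply: mulr_ge0_le0 => //; apply: ltW | exact: ltW].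
apply: (@le_trans _ _ (cub m * (1 + e) ^+ 3 * (1 - 7 * e))).
  by rewrite ler_pM2r.
by rewrite -mulrA ler_piMr // ltW.
Qed.

(** Frequency [h] of the sawtooth at [x / (m n + d)], where [d] is the shift delta. In [m] it is
    [(x h / n) / (m + d / n)], a shifted reciprocal. *)
Definition phase (x d : R) (h n m : nat) : R := x * h%:R / (m%:R * n%:R + d).

(* [M >= 224 H] makes the shift [d] negligible even when [h / n] and [h' / n'] are as close as they can be. *)
Lemma pair_second_difference (x d : R) (M N H h n h' n' m : nat) :
  0 < x -> 0 <= d -> d <= 1 -> (0 < N)%N -> (0 < H)%N -> (224 * H <= M)%N ->
  (N <= n < 2 * N)%N -> (N <= n' < 2 * N)%N -> (h' < 2 * H)%N -> (h' * n < h * n')%N ->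
  (M <= m < 2 * M)%N ->
  x * (h%:R / n%:R - h'%:R / n'%:R) / M%:R ^+ 3 / 16 <=
    (phase x d h n m.+2 - phase x d h' n' m.+2) - (phase x d h n m.+1 - phase x d h' n' m.+1) -
    ((phase x d h n m.+1 - phase x d h' n' m.+1) - (phase x d h n m - phase x d h' n' m))
   <= 40 * (x * (h%:R / n%:R - h'%:R / n'%:R) / M%:R ^+ 3 / 16).
Proof.
move=> x0 d0 d1 N0 H0 HM /andP[nN n2] /andP[n'N n'2] h'H hh /andP[mM m2].
pose F m := phase x d h n m - phase x d h' n' m.
pose V : R := x * (h%:R / n%:R - h'%:R / n'%:R) / M%:R ^+ 3.
rewrite -/(F m.+2) -/(F m.+1) -/(F m) -/V.
have n0 : 0 < n%:R :> R by rewrite ltr0n; nlia.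
have n'0 : 0 < n'%:R :> R by rewrite ltr0n; nlia.
have m1 : 1 <= m%:R :> R by rewrite ler1n; nlia.
have m0 : 0 < m%:R :> R by lra.
have NR : 0 < N%:R :> R by rewrite ltr0n.
have MR : 0 < M%:R :> R by rewrite ltr0n; nlia.
pose y := m%:R + d / n%:R; pose y' := m%:R + d / n'%:R.
have y0 : 0 < y by rewrite /y ltr_pwDl // divr_ge0 // ltW.
have y'0 : 0 < y' by rewrite /y' ltr_pwDl // divr_ge0 // ltW.
pose a : R := h%:R / n%:R; pose a' : R := h'%:R / n'%:R.
have FE k : F (m + k)%N = x * a * (y + k%:R)^-1 - x * a' * (y' + k%:R)^-1.
  have p1 : 0 < y + k%:R by rewrite ltr_pwDl.
  have p2 : 0 < y' + k%:R by rewrite ltr_pwDl.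
  rewrite /F /phase natrD /a /a'.
  have -> : (m%:R + k%:R) * n%:R + d = n%:R * (y + k%:R) by rewrite /y; field; rewrite gt_eqF.
  have -> : (m%:R + k%:R) * n'%:R + d = n'%:R * (y' + k%:R) by rewrite /y'; field; rewrite gt_eqF.
  by field; rewrite !gt_eqF.
have -> : F m.+2 - F m.+1 - (F m.+1 - F m) = 2 * x * (a / cub y - a' / cub y').
  have e2 := FE 2; have e1 := FE 1%N; have e0 := FE 0%N.
  rewrite addn2 in e2; rewrite addn1 in e1; rewrite addn0 !addr0 in e0.
  rewrite e2 e1 e0.
  have s1 := second_difference_inv y0; have s2 := second_difference_inv y'0.
  transitivity (x * a * (2 / cub y) - x * a' * (2 / cub y')); last by ring.
  by rewrite -s1 -s2; ring.
pose D := a - a'.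
(* The integer [h n' - h' n] is at least 1 and both denominators are below [2 * N]. *)
have D1 : 1 / (4 * N%:R ^+ 2) <= D.
  have -> : D = (h%:R * n'%:R - h'%:R * n%:R) / (n%:R * n'%:R).
    by rewrite /D /a /a'; field; rewrite !gt_eqF.
  apply: ler_pM; rewrite ?ler01 ?invr_ge0 ?mulr_ge0 ?sqr_ge0 //.
    by rewrite lerBrDr -!natrM -(natrD _ 1) ler_nat; nlia.
  rewrite lef_pV2 ?posrE ?mulr_gt0 ?exprn_gt0 //.
  by rewrite -!natrM -natrX -natrM ler_nat; apply: leq_trans (leq_mul (ltnW n2) (ltnW n'2)) _; rewrite mulnACA mulnn.
have D0 : 0 < D by apply: lt_le_trans D1; rewrite divr_gt0 ?mulr_gt0 ?exprn_gt0.
(* Relative size of the shifts: [d / n] and [d / n'] are at most [e * m] throughout the range. *)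
pose e : R := 1 / (N%:R * M%:R).
have e0 : 0 < e by rewrite divr_gt0 // mulr_gt0.
have eM : e * 224 <= 1.
  rewrite /e mulrAC mul1r ler_pdivrMr ?mulr_gt0 // mul1r -natrM ler_nat.
  by apply: (@leq_trans M); [nlia | rewrite leq_pmull].
have t_le k : (N <= k)%N -> d / k%:R <= e * m%:R.
  move=> Nk; have k0 : 0 < k%:R :> R by rewrite ltr0n; nlia.
  rewrite ler_pdivrMr //; apply: (le_trans d1).
  rewrite /e mul1r -mulrA mulrC ler_pdivlMr ?mulr_gt0 // mul1r -!natrM ler_nat [(m * k)%N]mulnC leq_mul //.
have e1 : e <= 1 by lra.
have /andP[u1 u3] := @inv_cub_shift m%:R (d / n%:R) e m1 (divr_ge0 d0 (ltW n0)) (t_le n nN) e1.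
have /andP[u2 u4] := @inv_cub_shift m%:R (d / n'%:R) e m1 (divr_ge0 d0 (ltW n'0)) (t_le n' n'N) e1.
rewrite -/y -/y' in u1 u2 u3 u4.
pose p := (cub m%:R)^-1.
have p0 : 0 < p by rewrite invr_gt0 cub_gt0.
have a'0 : 0 <= a' by rewrite divr_ge0.
(* Origin of 224, as 28 times 2 times 4: the shift error [7 * a' * e] must not exceed a quarter of
   the least possible [D]. *)
have ae : 28 * a' * e <= D.
  apply: le_trans D1.
  have a'1 : a' <= 2 * H%:R / N%:R.
    apply: ler_pM; rewrite ?invr_ge0 ?ler0n //; last by rewrite lef_pV2 ?posrE // ler_nat.
    by rewrite -natrM ler_nat ltnW.
  apply: (@le_trans _ _ (28 * (2 * H%:R / N%:R) * e)).
    by rewrite ler_pM2r // ler_pM2l.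
  have -> : 28 * (2 * H%:R / N%:R) * e = (224 * H%:R / M%:R) * (1 / (4 * N%:R ^+ 2)).
    by rewrite /e; field; rewrite !gt_eqF.
  rewrite ler_piMl ?divr_ge0 ?mulr_ge0 ?sqr_ge0 //.
  by rewrite ler_pdivrMr // mul1r -natrM ler_nat.
have a0 : 0 <= a by rewrite divr_ge0.
have lo : D * p / 4 <= a / cub y - a' / cub y'.
  have h1 : D * (p * (1 - 7 * e)) <= D * (cub y)^-1.
    by rewrite ler_pM2l.
  have h2 : a' * (p * (1 - 7 * e)) <= a' * (cub y)^-1 by rewrite ler_wpM2l.
  have h3 : a' * (cub y')^-1 <= a' * p by rewrite ler_wpM2l.
  have h4 : 28 * a' * e * p <= D * p by rewrite ler_pM2r.
  have h6 : 0 < D * p by rewrite mulr_gt0.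
  have h5 : D * p * (7 * e) <= D * p * (1 / 32).
    rewrite ler_wpM2l //; last by lra.
    by rewrite mulr_ge0 // ltW.
  have -> : a / cub y - a' / cub y' = D / cub y + (a' / cub y - a' / cub y') by rewrite /D; ring.
  lra.
have hi : a / cub y - a' / cub y' <= 5 * D * p / 4.
  have h1 : D * (cub y)^-1 <= D * p.
    by rewrite ler_pM2l.
  have h2 : a' * (p * (1 - 7 * e)) <= a' * (cub y')^-1 by rewrite ler_wpM2l.
  have h3 : a' * (cub y)^-1 <= a' * p by rewrite ler_wpM2l.
  have h4 : 28 * a' * e * p <= D * p by rewrite ler_pM2r.
  have -> : a / cub y - a' / cub y' = D / cub y + (a' / cub y - a' / cub y') by rewrite /D; ring.
  lra.
have pM1 : p <= (M%:R ^+ 3)^-1.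
  rewrite lef_pV2 ?posrE ?exprn_gt0 // ?cub_gt0 //.
  have mM' : M%:R <= m%:R :> R by rewrite ler_nat.
  by rewrite /cub !exprS expr0 mulr1 mulrA !ler_pM ?mulr_ge0 //; lra.
have pM2 : (8 * M%:R ^+ 3)^-1 <= p.
  rewrite lef_pV2 ?posrE ?(cub_gt0 m0) // ?mulr_gt0 ?exprn_gt0 //.
  have -> : 8 * M%:R ^+ 3 = (2 * M%:R) ^+ 3 :> R by ring.
  have mM' : m%:R + 1 <= 2 * M%:R :> R by rewrite natr1 -natrM ler_nat.
  apply: (@le_trans _ _ ((m%:R + 1) ^+ 3)); last by rewrite lerXn2r ?nnegrE ?mulr_ge0 //; lra.
  by rewrite /cub; nra.
have xD : 0 < x * D by rewrite mulr_gt0.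
have VE : V = x * D * (M%:R ^+ 3)^-1 by [].
rewrite {}VE {V}.
apply/andP; split.
  apply: (@le_trans _ _ (x * D * p / 2)).
    have : x * D * (8 * M%:R ^+ 3)^-1 <= x * D * p by rewrite ler_pM2l.
    rewrite invfM; lra.
  have : x * (D * p / 4) <= x * (a / cub y - a' / cub y') by rewrite ler_pM2l.
  lra.
apply: (@le_trans _ _ (5 * (x * D * p) / 2)).
  have : x * (a / cub y - a' / cub y') <= x * (5 * D * p / 4) by rewrite ler_pM2l.
  lra.
have : x * D * p <= x * D * (M%:R ^+ 3)^-1 by rewrite ler_pM2l.
lra.
Qed.

Lemma le_of_sqr (a b : R) : 0 <= b -> a ^+ 2 <= b ^+ 2 -> a <= b.
Proof. by move=> b0 ab; rewrite leNgt; apply/negP => h; nra. Qed.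

Lemma cube_le (a b : R) : 0 <= a -> a <= b -> a ^+ 3 <= b ^+ 3.
Proof. by move=> a0 ab; rewrite lerXn2r ?nnegrE // (le_trans a0). Qed.

Lemma phase_diff_second (x d : R) (h n m : nat) : (0 < n)%N -> (0 < m)%N -> 0 <= d ->
  phase x d h n m.+2 - phase x d h n m.+1 - (phase x d h n m.+1 - phase x d h n m) =
  2 * x * (h%:R / n%:R) / cub (m%:R + d / n%:R).
Proof.
move=> n0 m0 d0; rewrite -(ltr0n R) in n0; rewrite -(ltr0n R) in m0.
have y0 : 0 < m%:R + d / n%:R by rewrite ltr_pwDl // divr_ge0 // ltW.
have E k : phase x d h n (m + k) = x * (h%:R / n%:R) * (m%:R + d / n%:R + k%:R)^-1.
  have p1 : 0 < m%:R + d / n%:R + k%:R by rewrite ltr_pwDl.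
  rewrite /phase natrD.
  have -> : (m%:R + k%:R) * n%:R + d = n%:R * (m%:R + d / n%:R + k%:R).
    by field; rewrite gt_eqF.
  by move: p1; set z := (m%:R + _ + _) => p1; field; rewrite !gt_eqF.
have e2 := E 2; have e1 := E 1%N; have e0 := E 0%N.
rewrite addn2 in e2; rewrite addn1 in e1; rewrite addn0 !addr0 in e0.
rewrite e2 e1 e0.
have s1 := second_difference_inv y0.
transitivity (x * (h%:R / n%:R) * (2 / cub (m%:R + d / n%:R))); last by ring.
by rewrite -s1; ring.
Qed.

Definition dyad (M m : nat) := (M <= m < 2 * M)%N.
Definition cut (D D' m : nat) := (D < m <= D')%N.

(** The second difference lies between [V/16] and [40 V/16], so the test runs with [s = sqrt V / 4]
    and [A = 40]. The bound [s1] below [sqrt V] is uniform over all pairs, as the cross difference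
    is at least 1; the bound [s2] above it records how close the two slopes are. *)
Lemma pair_sum_pos (x d s1 s2 : R) (M N H h n h' n' B : nat) (p : pred nat) :
  0 < x -> 0 <= d -> d <= 1 -> (0 < N)%N -> (0 < H)%N -> (224 * H <= M)%N ->
  dyad N n -> dyad N n' -> (h' < 2 * H)%N -> (h' * n < h * n')%N ->
  (forall i j k, (i <= j <= k)%N -> (k < B)%N -> p i -> p k -> p j) ->
  (forall m, p m -> dyad M m) ->
  0 < s1 -> 0 <= s2 -> s1 ^+ 2 <= x / (4 * N%:R ^+ 2 * M%:R ^+ 3) ->
  x * ((h * n' - h' * n)%N%:R) / (N%:R ^+ 2 * M%:R ^+ 3) <= s2 ^+ 2 ->
  `|\sum_(m < B | p m) ec (phase x d h n m - phase x d h' n' m)| <= 140 * (M%:R * s2 + 1 / s1).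
Proof.
move=> x0 d0 d1 N0 H0 HM nN n'N h'H hh cvx pM s10 s20 s1V Vs2.
have n0 : 0 < n%:R :> R by rewrite ltr0n; move/andP: nN => [? _]; apply: leq_trans N0 _.
have n'0 : 0 < n'%:R :> R by rewrite ltr0n; move/andP: n'N => [? _]; apply: leq_trans N0 _.
have M0 : (0 < M)%N by apply: leq_trans HM; rewrite muln_gt0.
have NR : 0 < N%:R :> R by rewrite ltr0n.
have MR : 0 < M%:R :> R by rewrite ltr0n.
pose V : R := x * (h%:R / n%:R - h'%:R / n'%:R) / M%:R ^+ 3.
have l1 : 1 <= (h * n' - h' * n)%N%:R :> R by rewrite ler1n subn_gt0.
have VE : V = x * (h * n' - h' * n)%N%:R / (n%:R * n'%:R * M%:R ^+ 3).
  by rewrite /V natrB 1?ltnW // !natrM; field; rewrite !gt_eqF.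
have Vlo : s1 ^+ 2 <= V.
  apply: (le_trans s1V); rewrite VE; apply: ler_pM.
  - exact: ltW.
  - by rewrite invr_ge0 !mulr_ge0 ?exprn_ge0.
  - by rewrite ler_peMr // ltW.
  rewrite lef_pV2 ?posrE ?mulr_gt0 ?exprn_gt0 // ler_pM2r ?exprn_gt0 //.
  rewrite -!natrM -natrX -natrM ler_nat.
  move: nN n'N => /andP[_ n2] /andP[_ n'2].
  by apply: leq_trans (leq_mul (ltnW n2) (ltnW n'2)) _; rewrite mulnACA mulnn.
have Vhi : V <= s2 ^+ 2.
  apply: le_trans Vs2; rewrite VE; apply: ler_pM.
  - by rewrite mulr_ge0 // ltW.
  - by rewrite invr_ge0 !mulr_ge0 ?exprn_ge0.
  - by [].
  rewrite lef_pV2 ?posrE ?mulr_gt0 ?exprn_gt0 // ler_pM2r ?exprn_gt0 //.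
  move: nN n'N => /andP[n2 _] /andP[n'2 _].
  by rewrite -!natrM -natrX ler_nat -mulnn leq_mul.
have V0 : 0 < V by apply: lt_le_trans Vlo; rewrite exprn_gt0.
pose r := Num.sqrt V.
have r2 : r ^+ 2 = V by rewrite sqr_sqrtr // ltW.
have r0 : 0 < r by rewrite sqrtr_gt0.
have rs2 : r <= s2 by apply: le_of_sqr; rewrite ?r2.
have rs1 : s1 <= r by apply: le_of_sqr; rewrite ?r2 // ltW.
have -> : 140 * (M%:R * s2 + 1 / s1) = 140 * (M%:R * s2) + 140 * s1^-1 by ring.
apply: (@le_trans _ _ (14 * (40 * M%:R * (r / 4) + 1 / (r / 4)))).
  apply: (@second_difference_window (fun m => phase x d h n m - phase x d h' n' m)) => //.
  - by rewrite divr_gt0.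
  - lra.
  - move=> m mB /pM mM.
    have := @pair_second_difference x d M N H h n h' n' m x0 d0 d1 N0 H0 HM nN n'N h'H hh mM.
    by rewrite -/V (_ : (r / 4) ^+ 2 = V / 16) // -r2; field.
  - move=> i k /andP[ik _] /pM /andP[i1 i2] /pM /andP[k1 k2]; rewrite ler_nat; nlia.
have -> : 1 / (r / 4) = 4 * r^-1 by field; rewrite gt_eqF.
have h1 : M%:R * r <= M%:R * s2 by rewrite ler_pM2l.
have h2 : r^-1 <= s1^-1 by rewrite lef_pV2.
have h3 : 0 < r^-1 by rewrite invr_gt0.
lra.
Qed.

(** In [nat] one of the two truncated differences is 0, so their sum is an absolute value. Evenness
    of [ec] allows the pairs to be exchanged. *)
Lemma pair_sum_bound (x d s1 s2 : R) (M N H h n h' n' B : nat) (p : pred nat) :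
  0 < x -> 0 <= d -> d <= 1 -> (0 < N)%N -> (0 < H)%N -> (224 * H <= M)%N ->
  dyad N n -> dyad N n' -> dyad H h -> dyad H h' -> (h' * n != h * n')%N ->
  (forall i j k, (i <= j <= k)%N -> (k < B)%N -> p i -> p k -> p j) ->
  (forall m, p m -> dyad M m) ->
  0 < s1 -> 0 <= s2 -> s1 ^+ 2 <= x / (4 * N%:R ^+ 2 * M%:R ^+ 3) ->
  x * ((h * n' - h' * n) + (h' * n - h * n'))%N%:R / (N%:R ^+ 2 * M%:R ^+ 3) <= s2 ^+ 2 ->
  `|\sum_(m < B | p m) ec (phase x d h n m - phase x d h' n' m)| <= 140 * (M%:R * s2 + 1 / s1).
Proof.
move=> x0 d0 d1 N0 H0 HM nN n'N /andP[_ hH] /andP[_ h'H] + cvx pM s10 s20 s1V Vs2.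
rewrite neq_ltn => /orP[hh|hh].
  apply: (@pair_sum_pos x d s1 s2 M N H) => //.
  by move: Vs2; rewrite (eqP (_ : (h' * n - h * n')%N == 0)%N) ?addn0 // subn_eq0 ltnW.
under eq_bigr => m _ do rewrite -ecN opprB.
apply: (@pair_sum_pos x d s1 s2 M N H) => //.
by move: Vs2; rewrite (eqP (_ : (h * n' - h' * n)%N == 0)%N) ?add0n // subn_eq0 ltnW.
Qed.

Lemma es_ec t : es t = ec (t - 1 / 4).
Proof.
rewrite ecB /ec /es.
have -> : 2 * PI * (1 / 4) = PI / 2 by field.
have := cos_PI2; have := sin_PI2; rewrite !RE /= => -> ->; ring.
Qed.

(** The constant [c] drops out of second differences: 1/4 gives sines, 0 gives cosines. For [m]
    about [D / q] the second difference has size [(w q)^2]; the test is run with [s = w q / 16],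
    [A = 512] and at most [3 D / q] terms. *)
Lemma single_sum_bound_shift (x d w c : R) (D D' V h q B : nat) :
  0 < x -> 0 <= d -> d <= 1 -> (0 < D)%N -> (D' <= 2 * D)%N -> (0 < q)%N -> (0 < h)%N ->
  0 < w -> w ^+ 2 = x * h%:R / D%:R ^+ 3 ->
  `|\sum_(m < B | (V < m)%N && cut D D' (m * q)) ec (phase x d h q m - c)| <=
    1344 * (D%:R * w + 1 / (q%:R * w)).
Proof.
move=> x0 d0 d1 D0 D'D q0 h0 w0 w2.
have DR : 0 < D%:R :> R by rewrite ltr0n.
have qR : 0 < q%:R :> R by rewrite ltr0n.
have hR : 0 < h%:R :> R by rewrite ltr0n.
have -> : 1344 * (D%:R * w + 1 / (q%:R * w)) = 14 * (512 * (3 * D%:R / q%:R) * (w * q%:R / 16) + 96 * (1 / (q%:R * w))).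
  by field; rewrite !gt_eqF.
apply: (@le_trans _ _ (14 * (512 * (3 * D%:R / q%:R) * (w * q%:R / 16) + 1 / (w * q%:R / 16)))); last first.
  rewrite ler_pM2l // lerD2l.
  have -> : 1 / (w * q%:R / 16) = 16 * (1 / (q%:R * w)) by field; rewrite !gt_eqF.
  by rewrite ler_pM2r ?divr_gt0 ?mulr_gt0 // ler_nat.
apply: (@second_difference_window (fun m => phase x d h q m - c)
   (fun m => (V < m)%N && cut D D' (m * q))).
- by rewrite divr_gt0 // mulr_gt0.
- lra.
- by rewrite divr_ge0 ?mulr_ge0.
- move=> i j k /andP[ij jk] _ /andP[Vi /andP[Di _]] /andP[_ /andP[_ kD]].
  rewrite (leq_trans Vi ij) /cut (leq_trans Di) ?leq_mul2r ?ij ?orbT //=.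
  by apply: leq_trans kD; rewrite leq_mul2r jk orbT.
- move=> m _ /andP[_ /andP[Dm mD]].
  have m0 : (0 < m)%N by case: m Dm {mD}.
  have -> : phase x d h q m.+2 - c - (phase x d h q m.+1 - c) -
     (phase x d h q m.+1 - c - (phase x d h q m - c)) =
     2 * x * (h%:R / q%:R) / cub (m%:R + d / q%:R) by rewrite -phase_diff_second //; ring.
  have mR : 1 <= m%:R :> R by rewrite ler1n.
  have dq : 0 <= d / q%:R by rewrite divr_ge0 // ltW.
  have dq1 : d / q%:R <= 1 by rewrite ler_pdivrMr // mul1r (le_trans d1) // ler1n.
  have c0 : 0 < cub (m%:R + d / q%:R) by apply: cub_gt0; lra.
  have mq1 : D%:R / q%:R <= m%:R :> R by rewrite ler_pdivrMr // -natrM ler_nat ltnW.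
  have mq2 : m%:R <= 2 * D%:R / q%:R :> R.
    by rewrite ler_pdivlMr // -!natrM ler_nat; apply: leq_trans mD _.
  have xh : 0 < 2 * x * (h%:R / q%:R) by rewrite !mulr_gt0 // invr_gt0.
  have E : (w * q%:R / 16) ^+ 2 = 2 * x * (h%:R / q%:R) / (512 * (D%:R / q%:R) ^+ 3).
    rewrite (_ : (w * q%:R / 16) ^+ 2 = w ^+ 2 * q%:R ^+ 2 / 256); last by field.
    by rewrite w2; field; rewrite !gt_eqF.
  have DqR : 0 < D%:R / q%:R :> R by rewrite divr_gt0.
  have c2 : 0 < (D%:R / q%:R) ^+ 3 :> R by apply: exprn_gt0.
  have c1 : 0 < 512 * (D%:R / q%:R) ^+ 3 :> R by apply: mulr_gt0.
  rewrite E; apply/andP; split.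
    rewrite (ler_pM2l xh) (lef_pV2 c1 c0).
    have -> : 512 * (D%:R / q%:R) ^+ 3 = (4 * (2 * D%:R / q%:R)) ^+ 3 :> R by field; rewrite gt_eqF.
    apply: (@le_trans _ _ ((4 * m%:R) ^+ 3)); last first.
      by apply: cube_le; rewrite ?mulr_ge0 // ler_pM2l.
    by rewrite /cub !exprS expr0 mulr1 mulrA !ler_pM ?mulr_ge0 //; lra.
  have -> : 512 * (2 * x * (h%:R / q%:R) / (512 * (D%:R / q%:R) ^+ 3)) =
     2 * x * (h%:R / q%:R) / (D%:R / q%:R) ^+ 3 by field; rewrite !gt_eqF.
  rewrite (ler_pM2l xh) (lef_pV2 c0 c2).
  apply: (@le_trans _ _ (m%:R ^+ 3)).
    by apply: cube_le => //; apply: ltW.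
  by rewrite /cub !exprS expr0 mulr1 mulrA !ler_pM ?mulr_ge0 //; lra.
move=> i k /andP[ik _] /andP[_ /andP[Di iD]] /andP[_ /andP[_ kD]].
rewrite ler_pdivlMr // -!natrM ler_nat.
(* A nonempty range forces this, so the extra 1 in the number of terms is at most [2 D / q]. *)
have qi : (q <= 2 * D)%N.
  apply: leq_trans D'D; apply: leq_trans iD; rewrite leq_pmull //.
  by case: i Di {ik}.
rewrite mulSn mulnBl.
nlia.
Qed.

Lemma single_sum_bound (x d w : R) (D D' V h q B : nat) :
  0 < x -> 0 <= d -> d <= 1 -> (0 < D)%N -> (D' <= 2 * D)%N -> (0 < q)%N -> (0 < h)%N ->
  0 < w -> w ^+ 2 = x * h%:R / D%:R ^+ 3 ->
  `|\sum_(m < B | (V < m)%N && cut D D' (m * q)) es (phase x d h q m)| <=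
    1344 * (D%:R * w + 1 / (q%:R * w)).
Proof.
move=> x0 d0 d1 D0 D'D q0 h0 w0 w2; under eq_bigr => m _ do rewrite es_ec.
exact: single_sum_bound_shift.
Qed.

(** * Bilinear sums *)

Lemma cauchy_schwarz (I : finType) (P : pred I) (a b : I -> R) :
  (\sum_(i | P i) a i * b i) ^+ 2 <= (\sum_(i | P i) a i ^+ 2) * (\sum_(i | P i) b i ^+ 2).
Proof.
rewrite -subr_ge0.
have e1 : (\sum_(i | P i) a i ^+ 2) * (\sum_(i | P i) b i ^+ 2) =
    \sum_(i | P i) \sum_(j | P j) a i ^+ 2 * b j ^+ 2 by rewrite big_distrlr.
have e2 : (\sum_(i | P i) a i ^+ 2) * (\sum_(i | P i) b i ^+ 2) =
    \sum_(i | P i) \sum_(j | P j) b i ^+ 2 * a j ^+ 2 by rewrite mulrC big_distrlr.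
have e3 : (\sum_(i | P i) a i * b i) ^+ 2 = \sum_(i | P i) \sum_(j | P j) (a i * b i) * (a j * b j).
  by rewrite expr2 big_distrlr.
(* Lagrange's identity: the defect in the inequality is half of this sum of squares. *)
have : 0 <= \sum_(i | P i) \sum_(j | P j) (a i * b j - b i * a j) ^+ 2.
  by apply: sumr_ge0 => i _; apply: sumr_ge0 => j _; apply: sqr_ge0.
have -> : \sum_(i | P i) \sum_(j | P j) (a i * b j - b i * a j) ^+ 2 =
  \sum_(i | P i) \sum_(j | P j) a i ^+ 2 * b j ^+ 2 +
  \sum_(i | P i) \sum_(j | P j) b i ^+ 2 * a j ^+ 2 -
  2 * \sum_(i | P i) \sum_(j | P j) (a i * b i) * (a j * b j).
  rewrite mulr_sumr -big_split /= -sumrB; apply: eq_bigr => i _.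
  rewrite mulr_sumr -big_split /= -sumrB; apply: eq_bigr => j _; ring.
rewrite -e1 -e2 -e3; lra.
Qed.

Lemma sqr_sum_le (I : finType) (P : pred I) (b : I -> R) :
  (\sum_(i | P i) b i) ^+ 2 <= #|P|%:R * \sum_(i | P i) b i ^+ 2.
Proof.
have := cauchy_schwarz P (fun=> 1) b.
by under eq_bigr do rewrite mul1r; under [X in X * _]eq_bigr do rewrite expr1n; rewrite sumr_const.
Qed.

(* Splitting the index set by [j] before Cauchy-Schwarz keeps only pairs lying in the same class. *)
Lemma bilinear_cauchy (J I : finType) (PJ : pred J) (PI : J -> pred I) (Q : nat) (j : I -> 'I_Q)
    (al : J -> R) (c : I -> R) (th : I -> J -> R) (A : R) :
  (forall m, PJ m -> `|al m| <= A) ->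
  (\sum_(m | PJ m) al m * \sum_(p | PI m p) c p * es (th p m)) ^+ 2 <=
  A ^+ 2 * #|PJ|%:R * Q%:R *
   \sum_p \sum_(p' | j p' == j p) `|c p| * `|c p'| *
     `|\sum_(m | PJ m && (PI m p && PI m p')) ec (th p m - th p' m)|.
Proof.
move=> alA.
pose c' m p := if PI m p then c p else 0.
pose T m := \sum_p c' m p * es (th p m).
have TE m : \sum_(p | PI m p) c p * es (th p m) = T m.
  by rewrite big_mkcond; apply: eq_bigr => p _; rewrite /c'; case: ifP; rewrite ?mul0r.
under eq_bigr do rewrite TE.
apply: le_trans (cauchy_schwarz _ _ _) _.
have h1 : \sum_(m | PJ m) al m ^+ 2 <= A ^+ 2 * #|PJ|%:R.
  rewrite mulr_natr -sumr_const; apply: ler_sum => m /alA h.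
  by rewrite -real_normK ?num_real // lerXn2r ?nnegrE // (le_trans _ h).
have T0 : 0 <= \sum_(m | PJ m) T m ^+ 2 by apply: sumr_ge0 => m _; apply: sqr_ge0.
apply: (@le_trans _ _ (A ^+ 2 * #|PJ|%:R * \sum_(m | PJ m) T m ^+ 2)).
  by apply: ler_wpM2r.
rewrite -[leRHS]mulrA; apply: ler_wpM2l; first by rewrite mulr_ge0 ?sqr_ge0.
have key m : T m ^+ 2 <= Q%:R * \sum_p \sum_(p' | j p' == j p) c' m p * c' m p' * ec (th p m - th p' m).
  rewrite /T (partition_big j xpredT) //=.
  apply: le_trans (sqr_sum_le _ _) _; rewrite cardE size_enum_ord.
  apply: ler_wpM2l => //.
  rewrite [leRHS](partition_big j xpredT) //=; apply: ler_sum => i _.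
  (* The square of the companion cosine sum is added, so that products of sines are completed to
     [ec] of a difference. *)
  apply: (@le_trans _ _ ((\sum_(p | j p == i) c' m p * es (th p m)) ^+ 2 +
                         (\sum_(p | j p == i) c' m p * ec (th p m)) ^+ 2)).
    by rewrite lerDl sqr_ge0.
  rewrite !expr2 !big_distrlr /= -big_split /=.
  apply: ler_sum => p /eqP jp; rewrite -big_split /= jp.
  apply: ler_sum => p' _; rewrite ecB le_eqVlt; apply/orP; left; apply/eqP; ring.
apply: le_trans (ler_sum _ (fun m _ => key m)) _.
rewrite -mulr_sumr; apply: ler_wpM2l => //.
rewrite exchange_big; apply: ler_sum => p _.
rewrite exchange_big; apply: ler_sum => p' _.
rewrite -normrM -normrM; apply: le_trans (ler_norm _) _.
rewrite le_eqVlt; apply/orP; left; apply/eqP; congr (`|_|).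
rewrite mulr_sumr [RHS]big_mkcondr; apply: eq_bigr => m _.
by rewrite /c'; case: (PI m p); case: (PI m p'); rewrite /= ?mul0r ?mulr0 ?mul0r.
Qed.

Lemma card_pairs_prod (a b w : nat) : (0 < w)%N ->
  (#|[set q : 'I_a * 'I_b | (q.1 * q.2)%N == w]| <= size (divisors w))%N.
Proof.
move=> w0; rewrite cardE -(size_map (fun q : 'I_a * 'I_b => nat_of_ord q.1)).
apply: uniq_leq_size.
  rewrite map_inj_in_uniq ?enum_uniq // => -[p1 p2] [q1 q2].
  rewrite !mem_enum !inE /= => /eqP h1 /eqP h2 h3.
  have p0 : (0 < p1)%N by case: (posnP p1) h1 => // ->; rewrite mul0n => h; rewrite -h in w0.
  have e1 : p1 = q1 by apply/val_inj.
  congr pair => //; apply/val_inj => /=; apply/eqP; rewrite -(eqn_pmul2l p0) h1 h3 h2 //.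
move=> v /mapP[[p1 p2]]; rewrite mem_enum inE /= => /eqP h ->.
by rewrite -dvdn_divisors // -h dvdn_mulr.
Qed.

Lemma card_pairs_window (a b lo len t : nat) :
  (forall w, (0 < w < a * b)%N -> (size (divisors w) <= t)%N) ->
  (#|[set q : 'I_a * 'I_b | [&& 0 < q.1 * q.2, lo <= q.1 * q.2 & q.1 * q.2 < lo + len]%N]| <= len * t)%N.
Proof.
move=> dt; elim: len => [|len IH].
  by rewrite mul0n leqn0 cards_eq0; apply/eqP/setP => q; rewrite !inE; lia.
pose S := [set q : 'I_a * 'I_b | (0 < q.1 * q.2)%N && ((q.1 * q.2)%N == (lo + len)%N)].
apply: (@leq_trans (#|[set q : 'I_a * 'I_b | [&& 0 < q.1 * q.2, lo <= q.1 * q.2 & q.1 * q.2 < lo + len]%N]| + #|S|)%N).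
  rewrite -cardsUI; apply: leq_trans (leq_addr _ _); apply: subset_leq_card.
  by apply/subsetP => q; rewrite !inE; lia.
rewrite mulSn addnC leq_add //.
case: (posnP (lo + len)%N) => w0.
  by rewrite (eqP (_ : #|S| == 0%N)) // cards_eq0; apply/eqP/setP => q; rewrite !inE w0; lia.
have [h|h] := ltnP (lo + len) (a * b).
  apply: leq_trans (dt (lo + len)%N _); last by rewrite w0.
  apply: leq_trans (card_pairs_prod a b w0); apply: subset_leq_card.
  by apply/subsetP => q; rewrite !inE => /andP[].
rewrite (eqP (_ : #|S| == 0%N)) // cards_eq0; apply/eqP/setP => -[q1 q2]; rewrite !inE /=.
have := ltn_ord q1; have := ltn_ord q2 => h1 h2.
by apply/negbTE; apply/negP => /andP[_ /eqP h3]; move: h; rewrite -h3 leqNgt => /negP; apply; apply: ltn_mul.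
Qed.

Lemma card_upper_half H : #|[pred i : 'I_(2 * H) | (H <= i)%N]| = H.
Proof.
rewrite -sum1_card -(big_mkord (fun i => H <= i)%N (fun=> 1%N)).
rewrite -(@big_nat_widenl _ _ _ H 0 (2 * H) xpredT) // sum_nat_const_nat; lia.
Qed.

Definition box (H N : nat) (p : 'I_(2 * H) * 'I_(2 * N)) : bool := (H <= p.1)%N && (N <= p.2)%N.

Lemma card_box H N : #|box (H := H) (N := N)| = (H * N)%N.
Proof.
have := cardX [pred i : 'I_(2 * H) | (H <= i)%N] [pred i : 'I_(2 * N) | (N <= i)%N].
by rewrite !card_upper_half => <-; apply: eq_card => -[i j]; rewrite !inE.
Qed.

(** Exchanging the second components turns a relation between [h n'] and [h' n] into one between the
    products of two independent pairs: fix one pair, count the other. *)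
Lemma card_cross (H N k : nat) (Rl : nat -> nat -> bool) :
  (forall v, (#|[set q : 'I_(2 * H) * 'I_(2 * N) | box q && Rl v (q.1 * q.2)%N]| <= k)%N) ->
  (#|[set u : ('I_(2 * H) * 'I_(2 * N)) * ('I_(2 * H) * 'I_(2 * N)) |
     [&& box u.1, box u.2 & Rl (u.1.1 * u.2.2)%N (u.2.1 * u.1.2)%N]]| <= H * N * k)%N.
Proof.
move=> Rk; pose T := ('I_(2 * H) * 'I_(2 * N))%type.
pose sw (u : T * T) : T * T := ((u.1.1, u.2.2), (u.2.1, u.1.2)).
have swK : involutive sw by move=> [[? ?] [? ?]].
rewrite -(card_imset _ (inv_inj swK)).
apply: (@leq_trans (\sum_(q : T | box q) \sum_(q' : T | box q' && Rl (q.1 * q.2)%N (q'.1 * q'.2)%N) 1)).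
  rewrite pair_big_dep /= sum1dep_card; apply/subset_leq_card/subsetP => u.
  move=> /imsetP[[[h n] [h' n']] uR ->]; move: uR; rewrite !inE /box /=.
  by move=> /and3P[/andP[-> ->] /andP[-> ->] ->].
apply: (@leq_trans (\sum_(q : T | box q) k)).
  by apply: leq_sum => q _; rewrite sum1dep_card.
by rewrite sum_nat_const card_box.
Qed.

Lemma card_equal_products (H N t : nat) : (0 < H)%N -> (0 < N)%N ->
  (forall w, (0 < w < 2 * H * (2 * N))%N -> (size (divisors w) <= t)%N) ->
  (#|[set u : ('I_(2 * H) * 'I_(2 * N)) * ('I_(2 * H) * 'I_(2 * N)) |
     [&& box u.1, box u.2 & (u.2.1 * u.1.2 == u.1.1 * u.2.2)%N]]| <= H * N * t)%N.
Proof.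
move=> H0 N0 dt; apply: (@card_cross H N t (fun v w => w == v)) => v.
rewrite -[t]mul1n; apply: leq_trans (card_pairs_window v 1 dt).
apply/subset_leq_card/subsetP => -[h n]; rewrite !inE /= => /andP[/andP[/= h1 h2] /eqP <-].
by rewrite muln_gt0 leqnn addn1 leqnn (leq_trans H0 h1) (leq_trans N0 h2).
Qed.

(** Products at distance 1 to [L] from [v] lie in the windows of length [L] just below and just
    above [v]. If [v < L], the lower window starts at 0 and still contains all that is below [v]. *)
Lemma card_near_products (H N t L : nat) : (0 < H)%N -> (0 < N)%N ->
  (forall w, (0 < w < 2 * H * (2 * N))%N -> (size (divisors w) <= t)%N) ->
  (#|[set u : ('I_(2 * H) * 'I_(2 * N)) * ('I_(2 * H) * 'I_(2 * N)) |
     [&& box u.1, box u.2 & (u.2.1 * u.1.2 != u.1.1 * u.2.2)%N &&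
      ((u.1.1 * u.2.2 - u.2.1 * u.1.2) + (u.2.1 * u.1.2 - u.1.1 * u.2.2) <= L)%N]]|
   <= H * N * (2 * L * t))%N.
Proof.
move=> H0 N0 dt.
apply: (@card_cross H N (2 * L * t) (fun v w => (w != v) && ((v - w) + (w - v) <= L)%N)) => v.
have -> : (2 * L * t = L * t + L * t)%N by lia.
apply: leq_trans (leq_add (card_pairs_window (v - L) L dt) (card_pairs_window v.+1 L dt)).
rewrite -cardsUI; apply: leq_trans (leq_addr _ _).
apply/subset_leq_card/subsetP => -[h n]; rewrite !inE /=.
move=> /andP[/andP[/= h1 h2]].
have : (0 < h * n)%N by rewrite muln_gt0 (leq_trans H0 h1) (leq_trans N0 h2).
move: (h * n)%N => w; lia.
Qed.

(** In one class [h N / (2 H n)] and [h' N / (2 H n')] differ by at most [1/Q], so the slopes differ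
    by at most [2 H / (N Q)]; multiply by [n n' <= 4 N^2]. *)
Lemma same_class_near (H N Q h n h' n' k : nat) : (0 < H)%N -> (0 < N)%N -> (0 < Q)%N ->
  (n < 2 * N)%N -> (n' < 2 * N)%N ->
  (k * (2 * H * n) <= h * N * Q)%N -> (h' * N * Q < k.+1 * (2 * H * n'))%N ->
  (h' * n - h * n' <= (8 * H * N) %/ Q)%N.
Proof.
move=> H0 N0 Q0 n2 n'2 h1 h2.
rewrite leq_divRL //; case: (posnP n) => [->|n0]; first by rewrite muln0.
have e1 : (k * (2 * H * n) * n' <= h * N * Q * n')%N by rewrite leq_mul2r h1 orbT.
have e2 : (h' * N * Q * n <= k.+1 * (2 * H * n') * n)%N by rewrite leq_mul2r (ltnW h2) orbT.
have e3 : ((h' * n - h * n') * Q * N <= 2 * H * (n * n'))%N.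
  rewrite !mulnBl leq_subLR.
  apply: (@leq_trans (h' * N * Q * n)); first by lia.
  apply: (leq_trans e2); apply: (@leq_trans (k * (2 * H * n) * n' + 2 * H * (n * n')))%N; first by lia.
  by rewrite leq_add2r; apply: (leq_trans e1); lia.
rewrite -(leq_pmul2r N0); apply: (leq_trans e3).
have : (n * n' <= 2 * N * (2 * N))%N by apply: leq_mul; apply: ltnW.
move=> e4; apply: (@leq_trans (2 * H * (2 * N * (2 * N))))%N; first by rewrite leq_mul2l e4 orbT.
by lia.
Qed.

(** For a pair in the box, [h N / (2 H n)] lies in [0, 1); this interval is cut into [Q.+1] equal
    parts. The successor makes the type of classes inhabited. *)
Definition slope_class (H N Q : nat) (p : 'I_(2 * H) * 'I_(2 * N)) : 'I_Q.+1 :=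
  inord ((p.1 * N * Q.+1) %/ (2 * H * p.2)).

Lemma slope_classP (H N Q : nat) (p p' : 'I_(2 * H) * 'I_(2 * N)) : (0 < H)%N -> (0 < N)%N ->
  box p -> box p' -> slope_class Q p' = slope_class Q p ->
  ((p.1 * p'.2 - p'.1 * p.2) + (p'.1 * p.2 - p.1 * p'.2) <= (8 * H * N) %/ Q.+1)%N.
Proof.
case: p p' => [h n] [h' n'] H0 N0 /andP[/= h1 n1] /andP[/= h'1 n'1].
have cls (i : 'I_(2 * H)) (l : 'I_(2 * N)) : (N <= l)%N ->
   ((i * N * Q.+1) %/ (2 * H * l) < Q.+1)%N.
  move=> Nl; have l0 : (0 < l)%N by apply: leq_trans Nl.
  rewrite ltn_divLR ?muln_gt0 ?H0 ?l0 // mulnC ltn_pmul2l //.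
  apply: (@leq_trans (2 * H * N)%N); last by rewrite leq_mul2l Nl orbT.
  by rewrite ltn_pmul2r // ltn_ord.
move=> /(congr1 val); rewrite /slope_class /= !inordK ?cls //.
have n0 : (0 < n)%N by apply: leq_trans n1.
have n'0 : (0 < n')%N by apply: leq_trans n'1.
set k := (_ %/ (2 * H * n'))%N => kE.
have a1 := leq_trunc_div (h * N * Q.+1) (2 * H * n); rewrite -kE in a1.
have a2 := @ltn_ceil (h * N * Q.+1) (2 * H * n); rewrite -kE muln_gt0 muln_gt0 H0 n0 in a2.
have a3 := leq_trunc_div (h' * N * Q.+1) (2 * H * n'); rewrite -/k in a3.
have a4 := @ltn_ceil (h' * N * Q.+1) (2 * H * n'); rewrite -/k muln_gt0 muln_gt0 H0 n'0 in a4.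
have b1 := @same_class_near H N Q.+1 h n h' n' k H0 N0 isT (ltn_ord n) (ltn_ord n') a1 (a4 isT).
have b2 := @same_class_near H N Q.+1 h' n' h n k H0 N0 isT (ltn_ord n') (ltn_ord n) a3 (a2 isT).
case: (leqP (h * n') (h' * n)) => e.
  by move: b1; rewrite (eqP (_ : (h * n' - h' * n)%N == 0)%N) // subn_eq0.
by move: b2; rewrite (eqP (_ : (h' * n - h * n')%N == 0)%N) ?addn0 // subn_eq0 ltnW.
Qed.

Lemma sum_mem_card (T : finType) (S : {set T}) : \sum_(u : T) (u \in S)%:R = #|S|%:R :> R.
Proof.
rewrite -sum1_card natr_sum [RHS]big_mkcond /=.
by apply: eq_bigr => u _; case: (u \in S).
Qed.

Lemma cut_convex D D' n i j k : (i <= j <= k)%N -> cut D D' (i * n) -> cut D D' (k * n) -> cut D D' (j * n).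
Proof.
move=> /andP[ij jk] /andP[Di _] /andP[_ kD]; rewrite /cut.
rewrite (leq_trans Di) ?leq_mul2r ?ij ?orbT //=.
by apply: leq_trans kD; rewrite leq_mul2r jk orbT.
Qed.

(** The condition [cut D D' (m * n)] couples the two variables. It is carried through Cauchy-Schwarz
    and ends up as a convex condition on [m] in the inner sum, harmless for the second difference
    test. *)
Lemma type_two (x d A1 A2 s1 s2 : R) (M N H Q t D D' : nat) (al be g : nat -> R) :
  0 < x -> 0 <= d -> d <= 1 -> (0 < N)%N -> (0 < H)%N -> (224 * H <= M)%N ->
  (forall w, (0 < w < 2 * H * (2 * N))%N -> (size (divisors w) <= t)%N) ->
  (forall m, dyad M m -> `|al m| <= A1) ->
  (forall h n, dyad H h -> dyad N n -> `|g h * be n| <= A2) ->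
  0 < s1 -> 0 <= s2 -> s1 ^+ 2 <= x / (4 * N%:R ^+ 2 * M%:R ^+ 3) ->
  x * ((8 * H * N) %/ Q.+1)%N%:R / (N%:R ^+ 2 * M%:R ^+ 3) <= s2 ^+ 2 ->
  (\sum_(m < 2 * M | (M <= m)%N) al m *
     \sum_(p : 'I_(2 * H) * 'I_(2 * N) | box p && cut D D' (m * p.2))
        (g p.1 * be p.2) * es (phase x d p.1 p.2 m)) ^+ 2 <=
  A1 ^+ 2 * M%:R * Q.+1%:R * (A2 ^+ 2 * ((H * N * t)%N%:R * M%:R +
     (H * N * (2 * ((8 * H * N) %/ Q.+1) * t))%N%:R * (140 * (M%:R * s2 + 1 / s1)))).
Proof.
move=> x0 d0 d1 N0 H0 HM dt alA gA s10 s20 s1V s2V.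
set L := ((8 * H * N) %/ Q.+1)%N in s2V *.
pose K := 140 * (M%:R * s2 + 1 / s1).
have K0 : 0 <= K.
  apply: mulr_ge0 => //; apply: addr_ge0; first exact: mulr_ge0.
  by apply: divr_ge0 => //; apply: ltW.
have := @bilinear_cauchy _ _ (fun m : 'I_(2 * M) => (M <= m)%N)
  (fun m p => box p && cut D D' (m * p.2)) Q.+1 (slope_class Q (N := N) (H := H))
  (fun m => al m) (fun p => g p.1 * be p.2) (fun p m => phase x d p.1 p.2 m) A1.
move=> bc; apply: le_trans (bc _) _ => [m mM|].
  by apply: alA; rewrite /dyad mM ltn_ord.
rewrite card_upper_half; apply: ler_wpM2l.
  by apply: mulr_ge0 => //; apply: mulr_ge0 => //; apply: sqr_ge0.
pose S0 := [set u : ('I_(2 * H) * 'I_(2 * N)) * ('I_(2 * H) * 'I_(2 * N)) |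
     [&& box u.1, box u.2 & (u.2.1 * u.1.2 == u.1.1 * u.2.2)%N]].
pose S1 := [set u : ('I_(2 * H) * 'I_(2 * N)) * ('I_(2 * H) * 'I_(2 * N)) |
     [&& box u.1, box u.2 & (u.2.1 * u.1.2 != u.1.1 * u.2.2)%N &&
      ((u.1.1 * u.2.2 - u.2.1 * u.1.2) + (u.2.1 * u.1.2 - u.1.1 * u.2.2) <= L)%N]].
have A20 : 0 <= A2 ^+ 2 by apply: sqr_ge0.
(* The restriction to one class is traded for indicators of two sets of pairs: equal cross products
   get the trivial bound [M], near ones the bound [K]. *)
apply: (@le_trans _ _ (\sum_p \sum_p' A2 ^+ 2 * (M%:R * ((p, p') \in S0)%:R + K * ((p, p') \in S1)%:R))).
  apply: ler_sum => p _; rewrite big_mkcond /=; apply: ler_sum => p' _.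
  have rhs0 : 0 <= A2 ^+ 2 * (M%:R * ((p, p') \in S0)%:R + K * ((p, p') \in S1)%:R).
    by rewrite mulr_ge0 // addr_ge0 // mulr_ge0.
  case: ifP => // /eqP jj.
  case bp: (box p); last by rewrite [X in _ * `|X|]big1 ?normr0 ?mulr0 // => m; rewrite andbF.
  case bp': (box p'); last by rewrite [X in _ * `|X|]big1 ?normr0 ?mulr0 // => m; rewrite !andbF.
  rewrite /=; have /andP[b1 b2] := bp; have /andP[b3 b4] := bp'.
  have dp1 : dyad H p.1 by rewrite /dyad b1 ltn_ord.
  have dp2 : dyad N p.2 by rewrite /dyad b2 ltn_ord.
  have dp'1 : dyad H p'.1 by rewrite /dyad b3 ltn_ord.
  have dp'2 : dyad N p'.2 by rewrite /dyad b4 ltn_ord.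
  have near := slope_classP H0 N0 bp bp' jj.
  apply: ler_pM => //; first by rewrite mulr_ge0.
    by rewrite expr2; apply: ler_pM => //; apply: gA.
  rewrite !inE bp bp' /= near andbT.
  have [e|e] := eqVneq (p'.1 * p.2)%N (p.1 * p'.2)%N; rewrite /= mulr1 mulr0 ?addr0 ?add0r.
    apply: le_trans (ler_norm_sum_const (K := 1) _) _ => [i _|]; first exact: normr_ec.
    rewrite mulr1 ler_nat; apply: leq_trans (_ : #|[pred i : 'I_(2 * M) | (M <= i)%N]| <= M)%N; last by rewrite card_upper_half.
    by apply/subset_leq_card/subsetP => m; rewrite !unfold_in => /andP[].
  pose pm m := [&& dyad M m, cut D D' (m * p.2) & cut D D' (m * p'.2)].
  rewrite (eq_bigl (fun m : 'I_(2 * M) => pm m)); last first.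
    by move=> m; rewrite /pm /dyad ltn_ord andbT.
  apply: (@pair_sum_bound x d s1 s2 M N H) => //.
  - move=> i j k ijk _ /and3P[/andP[i1 i2] ci ci'] /and3P[/andP[k1 k2] ck ck'].
    apply/and3P; split; [|exact: cut_convex ijk ci ck | exact: cut_convex ijk ci' ck'].
    by rewrite /dyad; case/andP: ijk => ij jk; rewrite (leq_trans i1 ij) (leq_ltn_trans jk k2).
  - by move=> m /andP[].
  - apply: le_trans s2V; rewrite ler_wpM2r ?invr_ge0 ?mulr_ge0 ?exprn_ge0 //.
    by rewrite ler_pM2l // ler_nat.
rewrite pair_big /= -mulr_sumr; apply: ler_wpM2l => //.
rewrite big_split /= -!mulr_sumr.
have -> : \sum_(i : ('I_(2 * H) * 'I_(2 * N)) * ('I_(2 * H) * 'I_(2 * N))) ((i.1, i.2) \in S0)%:R = #|S0|%:R :> R.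
  by rewrite -sum_mem_card; apply: eq_bigr => -[].
have -> : \sum_(i : ('I_(2 * H) * 'I_(2 * N)) * ('I_(2 * H) * 'I_(2 * N))) ((i.1, i.2) \in S1)%:R = #|S1|%:R :> R.
  by rewrite -sum_mem_card; apply: eq_bigr => -[].
rewrite mulrC; apply: lerD; last rewrite mulrC; apply: ler_wpM2r => //; rewrite ler_nat.
  exact: card_equal_products.
exact: card_near_products.
Qed.

(** * Type II and type I bounds with explicit sizes *)

Definition bil (x d : R) (D D' H : nat) (g : nat -> R) (M N : nat) (al be : nat -> R) : R :=
  \sum_(m < 2 * M | (M <= m)%N) al m *
     \sum_(p : 'I_(2 * H) * 'I_(2 * N) | box p && cut D D' (m * p.2))
        (g p.1 * be p.2) * es (phase x d p.1 p.2 m).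

Lemma bil_eq0 x d D D' H g M N al be : (D' <= 2 * D)%N ->
  ~~ ((M * N <= 2 * D) && (D < 4 * (M * N)))%N -> bil x d D D' H g M N al be = 0.
Proof.
move=> D'D neg; rewrite /bil big1 // => m mM; rewrite big1 ?mulr0 // => -[h n] /=.
move=> /andP[/andP[_ /= nN] /andP[c1 c2]]; case/negP: neg.
apply/andP; split; last first.
  apply: (leq_trans c1); apply: (@leq_trans (2 * M * (2 * N))%N); last by lia.
  by apply: leq_mul; apply: ltnW.
by apply: leq_trans D'D; apply: leq_trans c2; apply: leq_mul.
Qed.

(** From [z^9 <= D <= 4 M^2] and [H <= z]: [224 * H <= M] follows once [z^7 >= 4 * 224^2], and 6 is
    the least integer with that property. This is the origin of [6 <= z]. *)
Lemma type_two_numeric (z : R) (M N H D : nat) : 6 <= z -> (0 < N)%N -> (0 < H)%N ->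
  (N <= M)%N -> z ^+ 2 <= N%:R -> z ^+ 9 <= D%:R -> D%:R <= z ^+ 10 -> H%:R * z ^+ 9 <= D%:R ->
  (M * N <= 2 * D)%N -> (D < 4 * (M * N))%N ->
  [/\ (224 * H <= M)%N, N%:R <= 2 * z ^+ 5 & H%:R <= z].
Proof.
move=> z6 N0 H0 NM zN zD Dz HD MN DMN.
have z0 : 0 < z by lra.
have e1 : H%:R <= z.
  have z9 : 0 < z ^+ 9 by apply: exprn_gt0.
  by rewrite -(ler_pM2r z9) (le_trans HD) // -exprS.
have e2 : N%:R <= 2 * z ^+ 5.
  apply: le_of_sqr; first by apply: mulr_ge0 => //; apply: exprn_ge0; apply: ltW.
  have : (N * N)%N%:R <= (2 * D)%N%:R :> R by rewrite ler_nat; apply: leq_trans MN; rewrite leq_mul2r NM orbT.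
  rewrite !natrM expr2 exprMn -exprM.
  have : 0 <= z ^+ 10 by apply: exprn_ge0; apply: ltW.
  lra.
split=> //.
rewrite -(ler_nat R) natrM; apply: le_of_sqr => //.
have h1 : D%:R <= 4 * M%:R ^+ 2 :> R.
  rewrite -natrX -natrM ler_nat; apply: (leq_trans (ltnW DMN)).
  by rewrite leq_mul2l -mulnn leq_mul2l NM orbT.
have h2 : (224 * H%:R) ^+ 2 <= 224 ^+ 2 * z ^+ 2.
  rewrite exprMn; apply: ler_wpM2l; first exact: sqr_ge0.
  by rewrite lerXn2r ?nnegrE // ltW.
have h3 : 6 ^+ 7 <= z ^+ 7 by rewrite lerXn2r ?nnegrE // ltW.
have h4 : 6 ^+ 7 * z ^+ 2 <= z ^+ 9 by rewrite (exprD z 7 2); apply: ler_wpM2r; rewrite ?sqr_ge0.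
have h5 : 0 <= z ^+ 2 by apply: sqr_ge0.
lra.
Qed.

Lemma type_two_large (z d A1 A2 : R) (M N H t D D' : nat) (al be g : nat -> R) :
  6 <= z -> 0 <= d -> d <= 1 -> (0 < N)%N -> (0 < H)%N -> (0 < t)%N ->
  (N <= M)%N -> z ^+ 2 <= N%:R -> z ^+ 9 <= D%:R -> D%:R <= z ^+ 10 -> H%:R * z ^+ 9 <= D%:R ->
  (D' <= 2 * D)%N ->
  (forall w : nat, (0 < w)%N -> w%:R <= z ^+ 19 -> (size (divisors w) <= t)%N) ->
  0 <= A1 -> 0 <= A2 ->
  (forall m, `|al m| <= A1) -> (forall n, `|be n| <= A2) -> (forall h, `|g h| <= 1) ->
  `|bil (z ^+ 19) d D D' H g M N al be| <= 224 * (A1 * A2 * t%:R * H%:R * z ^+ 9).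
Proof.
move=> z6 d0 d1 N0 H0 t0 NM zN zD Dz HD D'D dt A10 A20 alA beA gA.
have z0 : 0 < z by lra.
have zX n : 0 < z ^+ n by apply: exprn_gt0.
have rhs0 : 0 <= 224 * (A1 * A2 * t%:R * H%:R * z ^+ 9).
  by do !apply: mulr_ge0 => //; apply: ltW.
have [/andP[MN DMN]|neg] := boolP ((M * N <= 2 * D) && (D < 4 * (M * N)))%N; last first.
  by rewrite bil_eq0 // normr0.
have [HM N5 Hz] := type_two_numeric z6 N0 H0 NM zN zD Dz HD MN DMN.
have M0 : (0 < M)%N by apply: leq_trans NM.
have NR : 0 < N%:R :> R by rewrite ltr0n.
have MR : 0 < M%:R :> R by rewrite ltr0n.
have HR : 0 < H%:R :> R by rewrite ltr0n.
have DR : 0 < D%:R :> R by apply: lt_le_trans zD.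
have tR : 1 <= t%:R :> R by rewrite ler1n.
have MNR : M%:R * N%:R <= 2 * D%:R :> R by rewrite -!natrM ler_nat.
pose q := H%:R * z ^+ 18 * N%:R / D%:R ^+ 2.
have q0 : 0 <= q.
  by apply: divr_ge0; [do !apply: mulr_ge0 => //; apply: ltW | apply: sqr_ge0].
(* Here [N >= z ^+ 2] is used: it provides at least one class even when [D] reaches [z ^+ 10].
   Consequently [Q.+1] lies between [q] and [2 * q]. *)
have q1 : 1 <= q.
  rewrite /q ler_pdivlMr ?exprn_gt0 // mul1r.
  apply: (@le_trans _ _ (1 * z ^+ 18 * z ^+ 2)).
    have -> : 1 * z ^+ 18 * z ^+ 2 = (z ^+ 10) ^+ 2 by ring.
    by rewrite lerXn2r ?nnegrE //; apply: ltW.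
  apply: ler_pM => //; first by rewrite mul1r ltW.
    by rewrite ltW.
  by apply: ler_wpM2r; [apply: ltW | rewrite ler1n].
pose Q := Num.trunc q.
have /andP[Q1 Q2] := truncn_itv q0; rewrite -/Q in Q1 Q2.
have Q3 : Q.+1%:R <= 2 * q by rewrite -natr1; lra.
pose L := ((8 * H * N) %/ Q.+1)%N.
have LQ : L%:R * Q.+1%:R <= 8 * H%:R * N%:R :> R by rewrite -!natrM ler_nat leq_trunc_div.
pose L' := 8 * D%:R ^+ 2 / z ^+ 18.
have LL' : L%:R <= L'.
  have : L%:R * q <= 8 * H%:R * N%:R.
    by apply: le_trans LQ; apply: ler_wpM2l => //; apply: ltW.
  have -> : 8 * H%:R * N%:R = L' * q by rewrite /L' /q; field; rewrite !gt_eqF.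
  by rewrite ler_pM2r //; apply: lt_le_trans q1.
pose w2 := z ^+ 19 * L' / (N%:R ^+ 2 * M%:R ^+ 3).
pose w1 := z ^+ 19 / (4 * N%:R ^+ 2 * M%:R ^+ 3).
have L'0 : 0 < L' by rewrite divr_gt0 // mulr_gt0 // exprn_gt0.
have w20 : 0 < w2 by apply: divr_gt0; apply: mulr_gt0 => //; apply: exprn_gt0.
have w10 : 0 < w1 by apply: divr_gt0 => //; apply: mulr_gt0; [apply: mulr_gt0|]; rewrite ?exprn_gt0.
pose s2 := Num.sqrt w2. pose s1 := Num.sqrt w1.
have s20 : 0 < s2 by rewrite sqrtr_gt0.
have s10 : 0 < s1 by rewrite sqrtr_gt0.
have s22 : s2 ^+ 2 = w2 by rewrite sqr_sqrtr // ltW.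
have s12 : s1 ^+ 2 = w1 by rewrite sqr_sqrtr // ltW.
have dt' w : (0 < w < 2 * H * (2 * N))%N -> (size (divisors w) <= t)%N.
  move=> /andP[w0 wHN]; apply: dt => //.
  apply: (@le_trans _ _ (2 * H * (2 * N))%N%:R); first by rewrite ler_nat ltnW.
  rewrite !natrM.
  have b1 : H%:R * N%:R <= z * (2 * z ^+ 5) by apply: ler_pM => //; apply: ltW.
  have b2 : 6 ^+ 13 <= z ^+ 13 by rewrite lerXn2r ?nnegrE // ltW.
  have b3 : 6 ^+ 13 * z ^+ 6 <= z ^+ 19 by rewrite (exprD z 13 6); apply: ler_wpM2r => //; apply: ltW.
  have b4 := zX 6%N; have b5 : z * (2 * z ^+ 5) = 2 * z ^+ 6 by ring.
  lra.
have s2V : z ^+ 19 * L%:R / (N%:R ^+ 2 * M%:R ^+ 3) <= s2 ^+ 2.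
  by rewrite s22; apply: ler_wpM2r; [rewrite invr_ge0 ltW // mulr_gt0 ?exprn_gt0 | rewrite ler_pM2l].
have main := @type_two (z ^+ 19) d A1 A2 s1 s2 M N H Q t D D' al be g (zX _) d0 d1 N0 H0 HM dt'
  (fun m _ => alA m) _ s10 (ltW s20) _ s2V.
have {main}main := main _ _; rewrite -/(bil _ _ _ _ _ _ _ _ _ _) in main.
apply: le_of_sqr => //; rewrite real_normK ?num_real //.
apply: le_trans (main _ _) _ => [h n _ _|| ].
- by rewrite normrM -[A2]mul1r; apply: ler_pM.
- by rewrite s12.
rewrite -/L.
(* Squared, the left side is [8 z D^2 (M N) N]; the critical case is [D = z^10] with [N] of order
   [z^5], where both sides have order [z^36]. *)
have i2 : M%:R * N%:R * (M%:R * N%:R) * s2 <= 6 * z ^+ 18.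
  apply: le_of_sqr; first by apply: mulr_ge0 => //; apply: ltW.
  rewrite exprMn s22.
  have -> : (M%:R * N%:R * (M%:R * N%:R)) ^+ 2 * w2 = 8 * z * D%:R ^+ 2 * (M%:R * N%:R) * N%:R.
    by rewrite /w2 /L'; field; rewrite !gt_eqF.
  apply: (@le_trans _ _ (8 * z * (z ^+ 10) ^+ 2 * (2 * z ^+ 10) * (2 * z ^+ 5))).
    apply: ler_pM => //; try by do !apply: mulr_ge0 => //; try apply: sqr_ge0; apply: ltW.
    apply: ler_pM => //; try by do !apply: mulr_ge0 => //; try apply: sqr_ge0; apply: ltW.
      by apply: ler_wpM2l; [apply: mulr_ge0 => //; apply: ltW | rewrite lerXn2r ?nnegrE //; apply: ltW].
    lra.
  have -> : 8 * z * (z ^+ 10) ^+ 2 * (2 * z ^+ 10) * (2 * z ^+ 5) = 32 * z ^+ 36 by ring.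
  have -> : (6 * z ^+ 18) ^+ 2 = 36 * z ^+ 36 by ring.
  by rewrite ler_pM2r // ler_nat.
(* Squared, this is [4 (M N)^5 N / z^19], of order [z^36] in the same critical case. *)
have i3 : M%:R * N%:R * N%:R / s1 <= 16 * z ^+ 18.
  apply: le_of_sqr; first by apply: mulr_ge0 => //; apply: ltW.
  rewrite exprMn exprVn s12.
  have -> : (M%:R * N%:R * N%:R) ^+ 2 / w1 = 4 * (M%:R * N%:R) ^+ 5 * N%:R / z ^+ 19.
    by rewrite /w1; field; rewrite !gt_eqF.
  rewrite ler_pdivrMr //.
  apply: (@le_trans _ _ (4 * (2 * z ^+ 10) ^+ 5 * (2 * z ^+ 5))).
    apply: ler_pM => //; first by apply: mulr_ge0 => //; apply: exprn_ge0; apply: mulr_ge0.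
    apply: ler_wpM2l => //; rewrite lerXn2r ?nnegrE //; try by apply: mulr_ge0 => //; apply: ltW.
    lra.
  have -> : 4 * (2 * z ^+ 10) ^+ 5 * (2 * z ^+ 5) = 256 * z ^+ 55 by ring.
  have -> : (16 * z ^+ 18) ^+ 2 * z ^+ 19 = 256 * z ^+ 55 by ring.
  by [].
have i1 : M%:R * (M%:R * N%:R) * (Q.+1%:R) <= 8 * H%:R * z ^+ 18.
  apply: (@le_trans _ _ (M%:R * (M%:R * N%:R) * (2 * q))); first by apply: ler_wpM2l => //; do !apply: mulr_ge0.
  have -> : M%:R * (M%:R * N%:R) * (2 * q) = (M%:R * N%:R / D%:R) ^+ 2 * (2 * H%:R * z ^+ 18).
    by rewrite /q; field; rewrite gt_eqF.
  have -> : 8 * H%:R * z ^+ 18 = 2 ^+ 2 * (2 * H%:R * z ^+ 18) by ring.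
  apply: ler_wpM2r; first by do !apply: mulr_ge0 => //; apply: ltW.
  rewrite lerXn2r ?nnegrE //; first by apply: divr_ge0 => //; apply: mulr_ge0.
  by rewrite ler_pdivrMr.
rewrite !natrM.
have -> : A1 ^+ 2 * M%:R * Q.+1%:R * (A2 ^+ 2 * (H%:R * N%:R * t%:R * M%:R +
      H%:R * N%:R * (2 * L%:R * t%:R) * (140 * (M%:R * s2 + 1 / s1)))) =
   A1 ^+ 2 * A2 ^+ 2 * t%:R * H%:R * (M%:R * (M%:R * N%:R) * Q.+1%:R +
      280 * (L%:R * Q.+1%:R) * (M%:R * M%:R * N%:R * s2 + M%:R * N%:R / s1)).
  by field; rewrite gt_eqF.
have j1 : 280 * (L%:R * Q.+1%:R) * (M%:R * M%:R * N%:R * s2 + M%:R * N%:R / s1) <=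
   280 * (8 * H%:R * N%:R) * (M%:R * M%:R * N%:R * s2 + M%:R * N%:R / s1).
  apply: ler_wpM2r.
    by apply: addr_ge0; do !apply: mulr_ge0 => //; rewrite ?invr_ge0; apply: ltW.
  by apply: ler_wpM2l.
have j2 : 280 * (8 * H%:R * N%:R) * (M%:R * M%:R * N%:R * s2 + M%:R * N%:R / s1) <=
   2240 * H%:R * (22 * z ^+ 18).
  have -> : 280 * (8 * H%:R * N%:R) * (M%:R * M%:R * N%:R * s2 + M%:R * N%:R / s1) =
     2240 * H%:R * (M%:R * N%:R * (M%:R * N%:R) * s2 + M%:R * N%:R * N%:R / s1).
    by field; rewrite gt_eqF.
  apply: ler_wpM2l; first by apply: mulr_ge0.
  lra.
(* The total is [8 + 2240 * 22 = 49288], below [224 ^ 2 = 50176]. *)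
apply: (@le_trans _ _ (A1 ^+ 2 * A2 ^+ 2 * t%:R * H%:R * (224 ^+ 2 * (H%:R * z ^+ 18)))).
  apply: ler_wpM2l; first by do !apply: mulr_ge0 => //; apply: sqr_ge0.
  have j0 : 0 <= H%:R * z ^+ 18 by apply: mulr_ge0 => //; apply: ltW.
  lra.
have -> : (224 * (A1 * A2 * t%:R * H%:R * z ^+ 9)) ^+ 2 =
   A1 ^+ 2 * A2 ^+ 2 * t%:R * H%:R * (224 ^+ 2 * t%:R * (H%:R * z ^+ 18)) by ring.
apply: ler_wpM2l; first by do !apply: mulr_ge0 => //; apply: sqr_ge0.
apply: ler_wpM2r; first by apply: mulr_ge0 => //; apply: ltW.
lra.
Qed.

(** Depends on the variables only through their product [n], so any factorisation of [n] can be
    inserted. *)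
Definition Phi (x d : R) (H : nat) (g : nat -> R) (n : nat) : R :=
  \sum_(h < 2 * H | (H <= h)%N) g h * es (x * h%:R / (n%:R + d)).

Lemma phaseE x d h n m : phase x d h n m = x * h%:R / ((m * n)%N%:R + d).
Proof. by rewrite /phase natrM. Qed.

Lemma bil_Phi x d D D' H g M N al be :
  bil x d D D' H g M N al be =
  \sum_(m < 2 * M | (M <= m)%N) \sum_(n < 2 * N | (N <= n)%N)
    (if cut D D' (m * n) then al m * be n * Phi x d H g (m * n) else 0).
Proof.
apply: eq_bigr => m _; rewrite mulr_sumr.
rewrite -[RHS]big_mkcondr /=.
under [RHS]eq_bigr => n _ do rewrite /Phi mulr_sumr.
rewrite [RHS](exchange_big_dep (fun h : 'I_(2 * H) => (H <= h)%N)) //= pair_big_dep /=.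
apply: eq_big => [[h n] | [h n] _] /=; first by rewrite /box /= !andbA; case: (_ <= h)%N; rewrite ?andbT ?andbF.
by rewrite phaseE; ring.
Qed.

Lemma sum_dyadic (G : nat -> R) J :
  \sum_(m < 2 ^ J) G m = G 0%N + \sum_(i < J) \sum_(m < 2 * 2 ^ i | (2 ^ i <= m)%N) G m.
Proof.
elim: J => [|J IH]; first by rewrite expn0 big_ord1 big_ord0 addr0.
rewrite [in RHS]big_ord_recr /= addrA -IH.
rewrite -(big_mkord (fun m => 2 ^ J <= m)%N) -(@big_nat_widenl _ _ _ (2 ^ J) 0 _ xpredT) //.
rewrite -!(big_mkord xpredT) -expnS.
rewrite [LHS](@big_cat_nat _ _ _ (2 ^ J)) //=.
by rewrite leq_exp2l.
Qed.

Lemma harmonic_dyadic J : \sum_(q < 2 ^ J | (0 < q)%N) (q%:R)^-1 <= J%:R :> R.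
Proof.
rewrite big_mkcond /= (sum_dyadic (fun q => if (0 < q)%N then (q%:R)^-1 else 0)) /= add0r.
rewrite -[J in J%:R]card_ord -sumr_const; apply: ler_sum => i _.
have p0 : (0 < 2 ^ i)%N by rewrite expn_gt0.
apply: (@le_trans _ _ (\sum_(m < 2 * 2 ^ i | (2 ^ i <= m)%N) ((2 ^ i)%N%:R)^-1)).
  apply: ler_sum => m im; have m0 : (0 < m)%N by apply: leq_trans im.
  by rewrite m0 lef_pV2 ?posrE ?ltr0n // ler_nat.
by rewrite sumr_const card_upper_half -[leLHS]mulr_natr mulVf // pnatr_eq0 -lt0n.
Qed.

Lemma count_small (y : R) W : 0 <= y -> \sum_(q < W | (0 < q)%N && (q%:R <= y)) (1 : R) <= y.
Proof.
move=> y0; have /andP[T1 _] := truncn_itv y0.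
suff h : \sum_(q < W | (0 < q)%N && (q%:R <= y)) (1 : R) <= (minn W.-1 (Num.trunc y))%:R.
  by apply: (le_trans h); apply: le_trans T1; rewrite ler_nat geq_minr.
elim: W => [|W IH]; first by rewrite big_ord0.
rewrite big_mkcond /= big_ord_recr /= -big_mkcond.
case: ifP => [/andP[W0]|_]; last first.
  rewrite addr0; apply: (le_trans IH); rewrite ler_nat; lia.
rewrite -truncn_ge_nat // => Wy; apply: (@le_trans _ _ ((minn W.-1 (Num.trunc y))%:R + 1)).
  by rewrite lerD2r.
by rewrite natr1 ler_nat; lia.
Qed.

Definition conv_sum (W D D' : nat) (al be F : nat -> R) : R :=
  \sum_(m < W) \sum_(n < W) (if cut D D' (m * n) then al m * be n * F (m * n)%N else 0).

(** The longer dyadic variable is taken as [m]. The coefficients vanish up to [2 * z ^+ 2], twice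
    the lower bound wanted for [N], because a block [[N, 2N)] may meet their support only near its
    upper end. *)
Lemma type_two_dyadic (z d A1 A2 : R) (J H t D D' : nat) (al be g : nat -> R) :
  6 <= z -> 0 <= d -> d <= 1 -> (0 < H)%N -> (0 < t)%N ->
  z ^+ 9 <= D%:R -> D%:R <= z ^+ 10 -> H%:R * z ^+ 9 <= D%:R -> (D' <= 2 * D)%N ->
  (forall w : nat, (0 < w)%N -> w%:R <= z ^+ 19 -> (size (divisors w) <= t)%N) ->
  0 <= A1 -> 0 <= A2 ->
  (forall m, `|al m| <= A1) -> (forall n, `|be n| <= A2) -> (forall h, `|g h| <= 1) ->
  (forall m, m%:R <= 2 * z ^+ 2 -> al m = 0) -> (forall m, m%:R <= 2 * z ^+ 2 -> be m = 0) ->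
  `|conv_sum (2 ^ J) D D' al be (Phi (z ^+ 19) d H g)| <=
     J%:R ^+ 2 * (224 * (A1 * A2 * t%:R * H%:R * z ^+ 9)).
Proof.
move=> z6 d0 d1 H0 t0 zD Dz HD D'D dt A10 A20 alA beA gA al0 be0.
have z0 : 0 < z by lra.
have rhs0 : 0 <= 224 * (A1 * A2 * t%:R * H%:R * z ^+ 9).
  by do !apply: mulr_ge0 => //; apply: ltW.
pose F m n := if cut D D' (m * n) then al m * be n * Phi (z ^+ 19) d H g (m * n) else 0.
pose B i k := \sum_(m < 2 * 2 ^ i | (2 ^ i <= m)%N) \sum_(n < 2 * 2 ^ k | (2 ^ k <= n)%N) F m n.
have convE : conv_sum (2 ^ J) D D' al be (Phi (z ^+ 19) d H g) = \sum_(i < J) \sum_(k < J) B i k.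
  rewrite /conv_sum (sum_dyadic (fun m => \sum_(n < 2 ^ J) F m n)) big1 ?add0r; last first.
    by move=> n _; rewrite /F mul0n.
  apply: eq_bigr => i _; rewrite /B [RHS]exchange_big /=; apply: eq_bigr => m _.
  by rewrite (sum_dyadic (F m)) /F muln0 add0r.
have small N (be' : nat -> R) : (forall m, m%:R <= 2 * z ^+ 2 -> be' m = 0) -> ~~ (z ^+ 2 <= N%:R) ->
    forall n, (n < 2 * N)%N -> be' n = 0.
  move=> b0; rewrite -ltNge => Nz n nN; apply: b0.
  have : n%:R <= (2 * N)%N%:R :> R by rewrite ler_nat ltnW.
  rewrite natrM; lra.
have BB i k : `|B i k| <= 224 * (A1 * A2 * t%:R * H%:R * z ^+ 9).
  have [ik|ik] := leqP (2 ^ k) (2 ^ i).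
    have [zN|zN] := boolP (z ^+ 2 <= (2 ^ k)%N%:R); last first.
      rewrite /B big1 ?normr0 // => m _; rewrite big1 // => n _.
      by rewrite /F (small _ _ be0 zN) // mulr0 mul0r; case: ifP.
    rewrite /B -bil_Phi; apply: type_two_large => //; by rewrite expn_gt0.
  have [zN|zN] := boolP (z ^+ 2 <= (2 ^ i)%N%:R); last first.
    rewrite /B big1 ?normr0 // => m _; rewrite big1 // => n _.
    by rewrite /F (small _ _ al0 zN) // !mul0r; case: ifP.
  rewrite /B exchange_big /=.
  under eq_bigr => n _ do under eq_bigr => m _ do rewrite /F mulnC (mulrC (al m)).
  rewrite -bil_Phi (mulrC A1); apply: type_two_large => //; first by rewrite expn_gt0.
  exact: ltnW.
rewrite convE; apply: le_trans (ler_norm_sum_const (K := J%:R * (224 * (A1 * A2 * t%:R * H%:R * z ^+ 9))) _) _.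
  move=> i _; apply: le_trans (ler_norm_sum_const (F := fun k : 'I_J => B i k) (fun k _ => BB i k)) _.
  by rewrite cardE size_enum_ord.
by rewrite cardE size_enum_ord; set X := 224 * _; rewrite expr2 -mulrA.
Qed.

(** With [V] about [D/(4 z^4)] only cofactors [q <= 8 z^4] occur. Summing [2 z^5 + z^6 / q] over
    them gives [16 z^9 + z^6 J], hence 17. The frequencies are added in absolute value. *)
Lemma type_one (z d A : R) (J H V D D' : nat) (c g : nat -> R) :
  6 <= z -> 0 <= d -> d <= 1 -> (0 < H)%N -> (0 < J)%N ->
  z ^+ 9 <= D%:R -> D%:R <= z ^+ 10 -> H%:R * z ^+ 9 <= D%:R -> (D' <= 2 * D)%N ->
  D%:R < 4 * z ^+ 4 * V.+1%:R ->
  0 <= A -> (forall q, `|c q| <= A) -> (forall h, `|g h| <= 1) ->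
  `|\sum_(q < 2 ^ J) \sum_(v < 2 ^ J | (V < v)%N && cut D D' (v * q)) c q * Phi (z ^+ 19) d H g (v * q)|
    <= 1344 * 17 * (A * J%:R * H%:R * z ^+ 9).
Proof.
move=> z6 d0 d1 H0 J0 zD Dz HD D'D DV A0 cA gA.
have z0 : 0 < z by lra.
have zX n : 0 < z ^+ n by apply: exprn_gt0.
have DR : 0 < D%:R :> R by apply: lt_le_trans zD.
have D0 : (0 < D)%N by rewrite -(ltr0n R).
have HR : 0 < H%:R :> R by rewrite ltr0n.
pose inner q h := \sum_(v < 2 ^ J | (V < v)%N && cut D D' (v * q)) es (phase (z ^+ 19) d h q v).
have ib q h : dyad H h -> `|inner q h| <=
   (if (0 < q)%N && (q%:R <= 8 * z ^+ 4) then 1344 * (2 * z ^+ 5 + z ^+ 6 * (q%:R)^-1) else 0).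
  move=> /andP[Hh h2]; case: ifP => [/andP[q0 _]|qF]; last first.
    rewrite /inner big1 ?normr0 // => v /andP[Vv /andP[Dv vD]]; case/negP: (negbT qF).
    have q0 : (0 < q)%N by case: (posnP q) Dv => // ->; rewrite muln0.
    rewrite q0 /=.
    have e1 : V.+1%:R * q%:R <= 2 * D%:R :> R.
      by rewrite -!natrM ler_nat; apply: leq_trans D'D; apply: leq_trans vD; apply: leq_mul.
    have e2 : D%:R * q%:R <= 4 * z ^+ 4 * V.+1%:R * q%:R by rewrite ler_wpM2r // ltW.
    have e3 : 4 * z ^+ 4 * (V.+1%:R * q%:R) <= 4 * z ^+ 4 * (2 * D%:R).
      by apply: ler_wpM2l => //; apply: mulr_ge0 => //; apply: ltW.
    rewrite -(ler_pM2l DR); lra.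
  have h0 : (0 < h)%N by apply: leq_trans Hh.
  have hR : 0 < h%:R :> R by rewrite ltr0n.
  have qR : 0 < q%:R :> R by rewrite ltr0n.
  pose w := Num.sqrt (z ^+ 19 * h%:R / D%:R ^+ 3).
  have a0 : 0 < z ^+ 19 * h%:R / D%:R ^+ 3.
    by apply: divr_gt0; [apply: mulr_gt0 | apply: exprn_gt0].
  have w0 : 0 < w by rewrite sqrtr_gt0.
  have w2 : w ^+ 2 = z ^+ 19 * h%:R / D%:R ^+ 3 by rewrite sqr_sqrtr // ltW.
  apply: le_trans (@single_sum_bound (z ^+ 19) d w D D' V h q (2 ^ J) (zX 19%N) d0 d1 D0 D'D q0 h0 w0 w2) _.
  rewrite ler_pM2l //; apply: lerD.
    apply: le_of_sqr; first by apply: mulr_ge0 => //; apply: ltW.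
    rewrite exprMn w2.
    have -> : D%:R ^+ 2 * (z ^+ 19 * h%:R / D%:R ^+ 3) = z ^+ 10 * (h%:R * z ^+ 9 / D%:R).
      by field; rewrite gt_eqF.
    have e1 : h%:R * z ^+ 9 / D%:R <= 2.
      rewrite ler_pdivrMr //; apply: (@le_trans _ _ (2 * H%:R * z ^+ 9)).
        by apply: ler_wpM2r; [apply: ltW | rewrite -natrM ler_nat ltnW].
      lra.
    have e2 : z ^+ 10 * (h%:R * z ^+ 9 / D%:R) <= z ^+ 10 * 2 by rewrite ler_pM2l.
    have e3 := zX 10%N.
    have -> : (2 * z ^+ 5) ^+ 2 = 4 * z ^+ 10 by ring.
    lra.
  have -> : 1 / (q%:R * w) = w^-1 * (q%:R)^-1 by field; rewrite !gt_eqF.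
  apply: ler_wpM2r; first by rewrite invr_ge0 ltW.
  apply: le_of_sqr; first exact: ltW.
  rewrite exprVn w2 invf_div ler_pdivrMr ?mulr_gt0 //.
  apply: (@le_trans _ _ ((z ^+ 10) ^+ 3)).
    by rewrite lerXn2r ?nnegrE // ltW.
  have -> : (z ^+ 6) ^+ 2 * (z ^+ 19 * h%:R) = z * (z ^+ 10) ^+ 3 * h%:R by ring.
  have h1 : 1 <= h%:R :> R by rewrite ler1n.
  have e4 : 0 < (z ^+ 10) ^+ 3 by apply: exprn_gt0.
  have e5 : 1 * (z ^+ 10) ^+ 3 * 1 <= z * (z ^+ 10) ^+ 3 * h%:R.
    apply: ler_pM => //; first by rewrite mul1r ltW.
    by rewrite ler_pM2r //; lra.
  by move: e5; rewrite mul1r mulr1.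
have -> : \sum_(q < 2 ^ J) \sum_(v < 2 ^ J | (V < v)%N && cut D D' (v * q)) c q * Phi (z ^+ 19) d H g (v * q) =
   \sum_(h < 2 * H | (H <= h)%N) \sum_(q < 2 ^ J) c q * g h * inner q h.
  rewrite [RHS]exchange_big; apply: eq_bigr => q _.
  under [RHS]eq_bigr => h _ do rewrite /inner mulr_sumr.
  rewrite [RHS]exchange_big /=; apply: eq_bigr => v _.
  by rewrite /Phi mulr_sumr; apply: eq_bigr => h _; rewrite phaseE mulrA.
pose S := \sum_(q < 2 ^ J | (0 < q)%N && (q%:R <= 8 * z ^+ 4)) A * (1344 * (2 * z ^+ 5 + z ^+ 6 * (q%:R)^-1)).
apply: le_trans (ler_norm_sum_const (K := S) _) _ => [h Hh|].
  apply: le_trans (ler_norm_sum _ _ _) _; rewrite /S [leRHS]big_mkcond /=.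
  apply: ler_sum => q _; have := ib q h; rewrite /dyad Hh ltn_ord => /(_ isT) hb.
  rewrite !normrM; apply: (@le_trans _ _ (A * 1 * `|inner q h|)).
    by apply: ler_wpM2r => //; apply: ler_pM.
  rewrite mulr1; case: ifP hb => _ hb; first by apply: ler_wpM2l.
  by move: hb; rewrite normr_le0 => /eqP ->; rewrite normr0 mulr0.
rewrite card_upper_half.
have SB : S <= A * (1344 * (2 * z ^+ 5 * (8 * z ^+ 4) + z ^+ 6 * J%:R)).
  rewrite /S -!mulr_sumr; apply: ler_wpM2l => //; apply: ler_wpM2l => //.
  rewrite big_split /=; apply: lerD.
    rewrite (eq_bigr (fun=> 2 * z ^+ 5 * 1)) => [|? _]; last by rewrite mulr1.
    rewrite -mulr_sumr; apply: ler_wpM2l; first by apply: mulr_ge0 => //; apply: ltW.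
    by apply: count_small; apply: mulr_ge0 => //; apply: ltW.
  rewrite -mulr_sumr; apply: ler_wpM2l; first exact: ltW.
  apply: le_trans (harmonic_dyadic J); rewrite [leRHS]big_mkcond [leLHS]big_mkcond /=.
  by apply: ler_sum => q _; case: (0 < q)%N; rewrite //=; case: ifP => // _; rewrite invr_ge0.
apply: (@le_trans _ _ (H%:R * (A * (1344 * (2 * z ^+ 5 * (8 * z ^+ 4) + z ^+ 6 * J%:R))))).
  by rewrite ler_pM2l.
have -> : 1344 * 17 * (A * J%:R * H%:R * z ^+ 9) = H%:R * (A * (1344 * (17 * J%:R * z ^+ 9))) by ring.
apply: ler_wpM2l => //; apply: ler_wpM2l => //; apply: ler_wpM2l => //.
have e1 : 1 * z ^+ 6 <= z ^+ 3 * z ^+ 6.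
  by apply: ler_wpM2r; [apply: ltW | rewrite exprn_ege1 //; lra].
have e2 : z ^+ 6 * J%:R <= z ^+ 9 * J%:R.
  by apply: ler_wpM2r => //; rewrite (exprD z 3 6) -[leLHS]mul1r.
have e3 : z ^+ 9 * 1 <= z ^+ 9 * J%:R by rewrite ler_pM2l // ler1n.
have -> : 2 * z ^+ 5 * (8 * z ^+ 4) = 16 * z ^+ 9 by ring.
lra.
Qed.

(** * Decomposition of the divisor function *)

(** The same counting function as [tau], by recursion on the number of factors, so that variables
    can be split off one at a time. Its value at 0 is 0 for every [k]. *)
Fixpoint tk (k n : nat) : nat :=
  if k is j.+1 then \sum_(v < n.+1) \sum_(w < n.+1 | (v * w == n)%N) tk j w else (n == 1%N).

Lemma tk0 k : tk k 0 = 0%N.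
Proof.
elim: k => [//|k IH] /=; rewrite big_ord1 (eq_bigl (fun w : 'I_1 => true)) ?big_ord1 //.
Qed.

Lemma tkS W k n : (0 < n < W)%N -> tk k.+1 n = (\sum_(v < W) \sum_(w < W | (v * w == n)%N) tk k w)%N.
Proof.
move=> /andP[n0 nW] /=.
have fac (v w : nat) : (v * w)%N = n -> (v < n.+1)%N /\ (w < n.+1)%N.
  move=> e; have : (0 < v * w)%N by rewrite e.
  rewrite muln_gt0 => /andP[v0 w0]; rewrite !ltnS -e; split; [exact: leq_pmulr | exact: leq_pmull].
rewrite (big_ord_widen W (fun v => \sum_(w < n.+1 | (v * w == n)%N) tk k w)%N) // [LHS]big_mkcond /=.
apply: eq_bigr => v _.
rewrite (big_ord_widen_cond W (fun w => v * w == n)%N (fun w => tk k w)) //.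
case: ifP => vn.
  apply: eq_bigl => w; apply/andP/idP => [[]//|e]; split=> //.
  by have [] := fac v w (eqP e).
rewrite big1 // => w /eqP /fac[]; by rewrite vn.
Qed.

Lemma count_factorizations W n t : (size (divisors n) <= t)%N -> (0 < n)%N ->
  (\sum_(v < W) \sum_(w < W | (v * w == n)%N) 1 <= t)%N.
Proof.
move=> nt n0; rewrite pair_big_dep /= sum1dep_card.
by apply: leq_trans (card_pairs_prod W W n0) nt.
Qed.

Lemma tk_le W t k n : (forall w, (0 < w < W)%N -> (size (divisors w) <= t)%N) -> (0 < t)%N ->
  (n < W)%N -> (tk k n <= t ^ k)%N.
Proof.
move=> dt t0; elim: k n => [|k IH] n nW; first by rewrite /= expn0 leq_b1.
case: (posnP n) => [->|n0]; first by rewrite tk0.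
rewrite (@tkS W) ?n0 //.
apply: (@leq_trans (\sum_(v < W) \sum_(w < W | (v * w == n)%N) 1 * t ^ k)).
  by apply: leq_sum => v _; apply: leq_sum => w _; rewrite mul1n IH.
under eq_bigr => v _ do rewrite -big_distrl.
by rewrite -big_distrl /= expnS leq_mul2r count_factorizations ?orbT // dt // n0.
Qed.

Lemma sum_delta (G : nat -> R) (W x : nat) : \sum_(q < W) (if x == q :> nat then G q else 0) = if (x < W)%N then G x else 0.
Proof.
case: ifP => xW; last by rewrite big1 // => q _; case: eqP => // e; rewrite e ltn_ord in xW.
rewrite (bigD1 (Ordinal xW)) //= eqxx big1 ?addr0 // => q qx.
by case: eqP => // e; case/eqP: qx; apply/val_inj.
Qed.

(** Coefficient of the merged variable [p = u v]. The value at 0, where the number of factorisations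
    is not controlled by divisors, is set to 0. *)
Definition mconv (W : nat) (c : nat -> nat -> R) (p : nat) : R :=
  if (0 < p < W)%N then \sum_(u < W) \sum_(v < W | (u * v == p)%N) c u v else 0.

Lemma regroup W (c : nat -> nat -> R) (G : nat -> R) : G 0%N = 0 -> (forall n, (W <= n)%N -> G n = 0) ->
  \sum_(u < W) \sum_(v < W) c u v * G (u * v)%N = \sum_(p < W) mconv W c p * G p.
Proof.
move=> G0 GW.
transitivity (\sum_(u < W) \sum_(v < W) \sum_(p < W) (if (u * v == p)%N then c u v * G p else 0)).
  apply: eq_bigr => u _; apply: eq_bigr => v _.
  rewrite (sum_delta (fun p => c u v * G p)); case: ltnP => // /GW ->; by rewrite mulr0.
under eq_bigr => u _ do rewrite exchange_big /=.
rewrite exchange_big /=; apply: eq_bigr => p _; rewrite /mconv ltn_ord andbT.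
case: (posnP p) => [->|p0] /=.
  by rewrite mul0r big1 // => u _; rewrite big1 // => v _; rewrite G0 mulr0; case: ifP.
rewrite mulr_suml; apply: eq_bigr => u _; rewrite mulr_suml [RHS]big_mkcond /=.
by apply: eq_bigr => v _.
Qed.

Lemma mconv_le W c (A : R) t p : (forall w, (0 < w < W)%N -> (size (divisors w) <= t)%N) -> 0 <= A ->
  (forall u v, (u < W)%N -> (v < W)%N -> `|c u v| <= A) -> `|mconv W c p| <= A * t%:R.
Proof.
move=> dt A0 cA; rewrite /mconv; case: ifP => pW; last by rewrite normr0 mulr_ge0.
apply: le_trans (ler_norm_sum _ _ _) _.
apply: (@le_trans _ _ (\sum_(u < W) \sum_(v < W | (u * v == p)%N) A * 1)).
  apply: ler_sum => u _; apply: le_trans (ler_norm_sum _ _ _) _.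
  by apply: ler_sum => v _; rewrite mulr1 cA.
under eq_bigr => u _ do rewrite -mulr_sumr.
rewrite -mulr_sumr; apply: ler_wpM2l => //.
have := @count_factorizations W p t (dt _ pW); case/andP: pW => p0 _ /(_ p0).
rewrite -(ler_nat R) natr_sum; apply: le_trans.
by apply: ler_sum => u _; rewrite natr_sum.
Qed.

Lemma cut_lt W D D' m n : (D' < W)%N -> cut D D' (m * n) -> (m < W)%N.
Proof.
move=> D'W /andP[Dm mD]; apply: leq_ltn_trans D'W; apply: leq_trans mD; apply: leq_pmulr.
by case: n Dm => //; rewrite muln0.
Qed.

Lemma conv_sum_tkS W D D' (a F : nat -> R) j : (D' < W)%N ->
  conv_sum W D D' a (fun q => (tk j.+1 q)%:R) F =
  \sum_(u < W) \sum_(v < W) \sum_(w < W)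
     (if cut D D' (u * v * w) then a u * (tk j w)%:R * F (u * v * w)%N else 0).
Proof.
move=> D'W; rewrite /conv_sum; apply: eq_bigr => u _.
transitivity (\sum_(q < W) \sum_(v < W) \sum_(w < W)
   (if (v * w == q)%N then (if cut D D' (u * q) then a u * (tk j w)%:R * F (u * q)%N else 0) else 0)).
  apply: eq_bigr => q _; case: ifP => cq; last first.
    by rewrite big1 // => v _; rewrite big1 // => w _; case: ifP.
  have q0 : (0 < q)%N by case/andP: cq; case: (posnP q) => // ->; rewrite muln0.
  rewrite (@tkS W) ?q0 ?ltn_ord // natr_sum mulr_sumr mulr_suml; apply: eq_bigr => v _.
  rewrite natr_sum mulr_sumr mulr_suml big_mkcond; apply: eq_bigr => w _; by case: ifP.
rewrite exchange_big /=; apply: eq_bigr => v _; rewrite exchange_big /=; apply: eq_bigr => w _.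
rewrite (sum_delta (fun q => if cut D D' (u * q) then a u * (tk j w)%:R * F (u * q)%N else 0)).
rewrite mulnA; case: ltnP => // vw; case: ifP => // c.
by have := @cut_lt W D D' (v * w) u D'W; rewrite mulnC mulnA c ltnNge vw => /(_ isT).
Qed.

(** Induction on the number [j] of variables left; [a] carries the product of those already
    multiplied, supported on [u <= 2 * z ^+ 2]. Splitting off [v] leaves [u v w] and three cases:
    [v > V] is type I; [v <= V] with [u v] beyond [2 * z ^+ 2] is type II; otherwise [u v] is the
    new partial product. Each step moves one factor [t] from the bound for [tk] to the bound for the
    coefficients, so their product stays [A * t ^ j]. *)
Lemma conv_sum_tk (z d : R) (J H t D D' : nat) (g : nat -> R) (j : nat) (a : nat -> R) (A : R) :
  6 <= z -> 0 <= d -> d <= 1 -> (0 < H)%N -> (0 < t)%N -> (0 < J)%N ->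
  z ^+ 9 <= D%:R -> D%:R <= z ^+ 10 -> H%:R * z ^+ 9 <= D%:R -> (D' <= 2 * D)%N ->
  (D' < 2 ^ J)%N -> (2 ^ J)%N%:R <= z ^+ 19 ->
  (forall w : nat, (0 < w)%N -> w%:R <= z ^+ 19 -> (size (divisors w) <= t)%N) ->
  (forall h, `|g h| <= 1) ->
  0 <= A -> (forall u, `|a u| <= A) -> (forall u, 2 * z ^+ 2 < u%:R -> a u = 0) ->
  `|conv_sum (2 ^ J) D D' a (fun q => (tk j q)%:R) (Phi (z ^+ 19) d H g)| <=
    j%:R * ((1344 * 17 + 224) * (A * t%:R ^+ j * (t%:R * J%:R ^+ 2 * H%:R * z ^+ 9))).
Proof.
move=> z6 d0 d1 H0 t0 J0 zD Dz HD D'D D'W Wz dt gA.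
have z0 : 0 < z by lra.
have zX n : 0 < z ^+ n by apply: exprn_gt0.
set W := (2 ^ J)%N in D'W Wz *.
set F := Phi (z ^+ 19) d H g.
have dtW w : (0 < w < W)%N -> (size (divisors w) <= t)%N.
  move=> /andP[w0 wW]; apply: dt => //; apply: le_trans Wz; by rewrite ler_nat ltnW.
have D0 : (0 < D)%N by rewrite -(ltr0n R); apply: lt_le_trans zD.
have DR : 0 < D%:R :> R by rewrite ltr0n.
elim: j a A => [|j IH] a A A0 aA a0.
  (* No variable is left: [u] alone exceeds [D >= z ^+ 9], beyond the support of [a]. *)
  rewrite mul0r /conv_sum big1 ?normr0 // => u _; rewrite big1 // => q _.
  case: ifP => [cu|//]; rewrite /=; move: cu.
  have [->|_] := eqVneq (q : nat) 1%N; last by rewrite /= mulr0 mul0r.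
  rewrite muln1 => /andP[Du _]; rewrite a0 ?mul0r //.
  apply: (@lt_trans _ _ D%:R); last by rewrite ltr_nat.
  apply: lt_le_trans zD.
  have h3 : 6 ^+ 7 <= z ^+ 7 by rewrite lerXn2r ?nnegrE // ltW.
  have h4 : 6 ^+ 7 * z ^+ 2 <= z ^+ 9 by rewrite (exprD z 7 2); apply: ler_wpM2r; rewrite ?sqr_ge0.
  have := zX 2%N; lra.
rewrite (@conv_sum_tkS W D D' a F j D'W).
have y0 : 0 <= D%:R / (4 * z ^+ 4) by apply: divr_ge0 => //; apply: mulr_ge0 => //; apply: ltW.
pose V := Num.trunc (D%:R / (4 * z ^+ 4)).
have /andP[V1 V2] := truncn_itv y0; rewrite -/V in V1 V2.
have {}V2 : D%:R < 4 * z ^+ 4 * V.+1%:R by move: V2; rewrite ltr_pdivrMr ?mulr_gt0 // mulrC.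
have {}V1 : 4 * z ^+ 4 * V%:R <= D%:R by move: V1; rewrite ler_pdivlMr ?mulr_gt0 // mulrC.
have tkB w : (w < W)%N -> `|(tk j w)%:R : R| <= t%:R ^+ j.
  by move=> wW; rewrite normr_nat -natrX ler_nat; apply: tk_le dtW t0 wW.
pose T u v w : R := if cut D D' (u * v * w) then a u * (tk j w)%:R * F (u * v * w)%N else 0.
pose c1 u w := a u * (tk j w)%:R.
pose c2 u v := if (v <= V)%N then a u else 0.
pose be w : R := if (w < W)%N && (2 * z ^+ 2 < w%:R) then (tk j w)%:R else 0.
pose al p := if 2 * z ^+ 2 < p%:R then mconv W c2 p else 0.
pose a' p := if 2 * z ^+ 2 < p%:R then 0 else mconv W c2 p.
(* Here [u] and [w] merge into one variable with arbitrary coefficients, and [v] stays smooth; in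
   [P2] and [P3] it is [u] and [v] that merge. *)
have P1 : \sum_(u < W) \sum_(v < W) \sum_(w < W) (if (V < v)%N then T u v w else 0) =
   \sum_(q < W) \sum_(v < W | (V < v)%N && cut D D' (v * q)) mconv W c1 q * F (v * q)%N.
  transitivity (\sum_(u < W) \sum_(w < W) c1 u w * \sum_(v < W | (V < v)%N && cut D D' (v * (u * w))) F (v * (u * w))%N).
    apply: eq_bigr => u _; rewrite exchange_big /=; apply: eq_bigr => w _.
    rewrite mulr_sumr [RHS]big_mkcond /=; apply: eq_bigr => v _.
    by rewrite /T /c1 mulnAC (mulnC (u * w)%N); case: (V < v)%N.
  rewrite (@regroup W c1 (fun q => \sum_(v < W | (V < v)%N && cut D D' (v * q)) F (v * q)%N)).
  - by apply: eq_bigr => q _; rewrite mulr_sumr.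
  - by rewrite big1 // => v; rewrite muln0 andbF.
  - move=> n Wn; rewrite big1 // => v /andP[_]; rewrite mulnC => /(cut_lt D'W).
    by rewrite ltnNge Wn.
have P2 : \sum_(u < W) \sum_(v < W) \sum_(w < W) (if ~~ (V < v)%N && (2 * z ^+ 2 < (u * v)%N%:R) then T u v w else 0) =
   conv_sum W D D' al be F.
  pose G p : R := if 2 * z ^+ 2 < p%:R then \sum_(w < W) (if cut D D' (p * w) then be w * F (p * w)%N else 0) else 0.
  transitivity (\sum_(u < W) \sum_(v < W) c2 u v * G (u * v)%N).
    apply: eq_bigr => u _; apply: eq_bigr => v _; rewrite /c2 /G -leqNgt.
    case: leqP => vV; last by rewrite mul0r big1.
    case: ltP => uv /=; last by rewrite mulr0 big1.
    rewrite mulr_sumr; apply: eq_bigr => w _; rewrite /T /be ltn_ord /=.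
    case: ifP => cw; last by rewrite mulr0.
    case: ltP => wz; first by rewrite mulrA.
    rewrite mul0r mulr0.
    (* With [u] and [w] at most [2 z^2] and [v <= V], the product would be at most [4 z^4 V <= D],
       outside the cut. Hence [be] may be set to 0 at such [w]. *)
    have [uz|uz] := ltP (2 * z ^+ 2) (u%:R : R); first by rewrite a0 // !mul0r.
    case/andP: cw => Dw _.
    have : D.+1%:R <= (u * v * w)%N%:R :> R by rewrite ler_nat.
    rewrite -natr1 !natrM.
    have : u%:R * v%:R * w%:R <= (2 * z ^+ 2) * V%:R * (2 * z ^+ 2).
      by apply: ler_pM => //; [apply: mulr_ge0 | apply: ler_pM => //; rewrite ler_nat].
    have -> : (2 * z ^+ 2) * V%:R * (2 * z ^+ 2) = 4 * z ^+ 4 * V%:R by ring.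
    lra.
  rewrite regroup.
  - rewrite /conv_sum; apply: eq_bigr => p _; rewrite /G /al.
    case: ltP => pz; last by rewrite mulr0 big1 // => w _; rewrite !mul0r; case: ifP.
    rewrite mulr_sumr; apply: eq_bigr => w _; case: ifP => _; last by rewrite mulr0.
    by rewrite mulrA.
  - rewrite /G; case: ifP => // _; rewrite big1 // => w _; rewrite mul0n; by case: ifP.
  - move=> n Wn; rewrite /G; case: ifP => // _; rewrite big1 // => w _; case: ifP => // /(cut_lt D'W).
    by rewrite ltnNge Wn.
have P3 : \sum_(u < W) \sum_(v < W) \sum_(w < W) (if ~~ (V < v)%N && ~~ (2 * z ^+ 2 < (u * v)%N%:R) then T u v w else 0) =
   conv_sum W D D' a' (fun q => (tk j q)%:R) F.
  pose G p : R := if 2 * z ^+ 2 < p%:R then 0 else \sum_(w < W) (if cut D D' (p * w) then (tk j w)%:R * F (p * w)%N else 0).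
  transitivity (\sum_(u < W) \sum_(v < W) c2 u v * G (u * v)%N).
    apply: eq_bigr => u _; apply: eq_bigr => v _; rewrite /c2 /G -leqNgt.
    case: leqP => vV; last by rewrite mul0r big1.
    case: ltP => uv /=; first by rewrite mulr0 big1.
    rewrite mulr_sumr; apply: eq_bigr => w _; rewrite /T.
    by case: ifP => cw; rewrite ?mulr0 ?mulrA.
  rewrite regroup.
  - rewrite /conv_sum; apply: eq_bigr => p _; rewrite /G /a'.
    case: ltP => pz; first by rewrite mulr0 big1 // => w _; rewrite !mul0r; case: ifP.
    rewrite mulr_sumr; apply: eq_bigr => w _; case: ifP => _; last by rewrite mulr0.
    by rewrite mulrA.
  - rewrite /G; case: ifP => // _; rewrite big1 // => w _; rewrite mul0n; by case: ifP.
  - move=> n Wn; rewrite /G; case: ifP => // _; rewrite big1 // => w _; case: ifP => // /(cut_lt D'W).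
    by rewrite ltnNge Wn.
have -> : \sum_(u < W) \sum_(v < W) \sum_(w < W)
     (if cut D D' (u * v * w) then a u * (tk j w)%:R * F (u * v * w)%N else 0) =
   \sum_(q < W) \sum_(v < W | (V < v)%N && cut D D' (v * q)) mconv W c1 q * F (v * q)%N +
   conv_sum W D D' al be F + conv_sum W D D' a' (fun q => (tk j q)%:R) F.
  rewrite -P1 -P2 -P3 -!big_split /=; apply: eq_bigr => u _.
  rewrite -!big_split /=; apply: eq_bigr => v _; rewrite -!big_split /=; apply: eq_bigr => w _.
  by rewrite -/(T u v w); case: (V < v)%N; case: (_ < _)%R; rewrite /= ?addr0 ?add0r.
have c2A u v : (u < W)%N -> (v < W)%N -> `|c2 u v| <= A.
  by move=> _ _; rewrite /c2; case: ifP; rewrite ?normr0.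
have c1A u v : (u < W)%N -> (v < W)%N -> `|c1 u v| <= A * t%:R ^+ j.
  by move=> _ vW; rewrite /c1 normrM; apply: ler_pM => //; apply: tkB.
have At0 : 0 <= A * t%:R by apply: mulr_ge0.
have Atj0 : 0 <= A * t%:R ^+ j by apply: mulr_ge0 => //; apply: exprn_ge0.
have B1 := @type_one z d (A * t%:R ^+ j * t%:R) J H V D D' (mconv W c1) g z6 d0 d1 H0 J0 zD Dz HD D'D V2
  (mulr_ge0 Atj0 (ler0n _ _)) (fun q => mconv_le q dtW Atj0 c1A) gA.
have alA p : `|al p| <= A * t%:R.
  by rewrite /al; case: ifP => _; [apply: mconv_le | rewrite normr0].
have a'A p : `|a' p| <= A * t%:R.
  by rewrite /a'; case: ifP => _; [rewrite normr0 | apply: mconv_le].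
have beA w : `|be w| <= t%:R ^+ j.
  by rewrite /be; case: ifP => [/andP[/tkB]//|_]; rewrite normr0 exprn_ge0.
have B2 := @type_two_dyadic z d (A * t%:R) (t%:R ^+ j) J H t D D' al be g z6 d0 d1 H0 t0 zD Dz HD D'D dt
  At0 (exprn_ge0 _ (ler0n _ _)) alA beA gA _ _.
have {}B2 := B2 _ _.
have B3 := IH a' (A * t%:R) At0 a'A _.
rewrite -/W -/F in B1 B2 B3.
apply: le_trans (ler_normD _ _) _; apply: le_trans (lerD (ler_normD _ _) (lexx _)) _.
apply: le_trans (lerD (lerD B1 (B2 _ _)) (B3 _)) _.
- by move=> m mz; rewrite /al ltNge mz.
- by move=> m mz; rewrite /be ltNge mz andbF.
- by move=> u uz; rewrite /a' uz.
have X0 : 0 <= A * t%:R ^+ j * t%:R * t%:R * H%:R * z ^+ 9.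
  by apply: mulr_ge0; [do !apply: mulr_ge0 => // | apply: ltW].
have J1 : 1 <= J%:R :> R by rewrite ler1n.
have t1 : 1 <= t%:R :> R by rewrite ler1n.
have Y : A * t%:R ^+ j * t%:R * J%:R * H%:R * z ^+ 9 <= A * t%:R ^+ j.+1 * (t%:R * J%:R ^+ 2 * H%:R * z ^+ 9).
  have -> : A * t%:R ^+ j * t%:R * J%:R * H%:R * z ^+ 9 = (A * t%:R ^+ j * t%:R * H%:R * z ^+ 9 * J%:R) * 1 by ring.
  have -> : A * t%:R ^+ j.+1 * (t%:R * J%:R ^+ 2 * H%:R * z ^+ 9) =
     (A * t%:R ^+ j * t%:R * H%:R * z ^+ 9 * J%:R) * (t%:R * J%:R) by rewrite (exprS _ j); ring.
  apply: ler_wpM2l; last by apply: mulr_ege1.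
  by apply: mulr_ge0 => //; apply: mulr_ge0; [do !apply: mulr_ge0 => // | apply: ltW].
have -> : J%:R ^+ 2 * (224 * (A * t%:R * t%:R ^+ j * t%:R * H%:R * z ^+ 9)) =
   224 * (A * t%:R ^+ j.+1 * (t%:R * J%:R ^+ 2 * H%:R * z ^+ 9)) by rewrite (exprS _ j); ring.
have -> : j%:R * ((1344 * 17 + 224) * (A * t%:R * t%:R ^+ j * (t%:R * J%:R ^+ 2 * H%:R * z ^+ 9))) =
   j%:R * ((1344 * 17 + 224) * (A * t%:R ^+ j.+1 * (t%:R * J%:R ^+ 2 * H%:R * z ^+ 9))) by rewrite (exprS _ j); ring.
move: Y; set Y1 := A * t%:R ^+ j * t%:R * J%:R * H%:R * z ^+ 9; set Y2 := A * t%:R ^+ j.+1 * _ => Y.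
have -> : j.+1%:R = j%:R + 1 :> R by rewrite natr1.
rewrite (mulrDl j%:R 1) mul1r; set Z := j%:R * _; rewrite addrC lerD2l (mulrDl (1344 * 17) 224 Y2) lerD2r.
by apply: ler_wpM2l => //; apply: mulr_ge0.
Qed.

(** * The fractional part sum over a dyadic block *)

Lemma sum_shift_ord (F : nat -> R) H W : (H < W)%N ->
  \sum_(h < H) F h.+1 = \sum_(h < W) (if (0 < h <= H)%N then F h else 0).
Proof.
move=> HW; rewrite -(big_mkord xpredT (fun h => F h.+1)) -(big_add1 _ _ 0 H.+1 xpredT F).
rewrite (big_nat_widen _ _ _ _ _ HW) big_geq_mkord big_mkcond /=.
by apply: eq_bigr => h _; rewrite ltnS andbC.
Qed.

Lemma conv_sum_one W D D' (b F : nat -> R) : (1 < W)%N ->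
  conv_sum W D D' (fun u => (u == 1%N)%:R) b F = \sum_(n < W) (if cut D D' n then b n * F n else 0).
Proof.
move=> W1; rewrite /conv_sum (bigD1 (Ordinal W1)) //= [X in _ + X]big1 ?addr0 => [|u u1].
  by apply: eq_bigr => n _; rewrite mul1n mul1r.
rewrite big1 // => n _; rewrite (negbTE (_ : nat_of_ord u != 1%N)) ?mul0r; first by case: ifP.
by apply: contra u1 => /eqP u1; apply/eqP/val_inj.
Qed.

(** Cost of one step of [conv_sum_tk]: one type I and one type II bound. *)
Definition c_bil : R := 1344 * 17 + 224.

(** On [[M, 2M)] the weight [1/(pi h)] is [g h / M] with [|g h| <= 1]. The [1/M] cancels the factor
    [M] that the bilinear bound owes to the number of frequencies, so all dyadic ranges cost the
    same. Cutting [g] at [H] handles the incomplete last range. *)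
Lemma saw_block (z d : R) (J H t k D D' : nat) :
  6 <= z -> 0 <= d -> d <= 1 -> (0 < t)%N -> (0 < J)%N ->
  z ^+ 9 <= D%:R -> D%:R <= z ^+ 10 -> H%:R * z ^+ 9 <= D%:R -> (D' <= 2 * D)%N ->
  (D' < 2 ^ J)%N -> (H < 2 ^ J)%N -> (2 ^ J)%N%:R <= z ^+ 19 ->
  (forall w : nat, (0 < w)%N -> w%:R <= z ^+ 19 -> (size (divisors w) <= t)%N) ->
  `|\sum_(n < 2 ^ J) (if cut D D' n then (tk k n)%:R * saw H (z ^+ 19 / (n%:R + d)) else 0)| <=
    J%:R * (k%:R * (c_bil * (t%:R ^+ k * (t%:R * J%:R ^+ 2 * z ^+ 9)))).
Proof.
move=> z6 d0 d1 t0 J0 zD Dz HD D'D D'W HW Wz dt.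
have z0 : 0 < z by lra.
have p3 := PI_gt3.
pose y n := z ^+ 19 / (n%:R + d).
pose G h := if (0 < h <= H)%N then
  \sum_(n < 2 ^ J) (if cut D D' n then (tk k n)%:R * (es (y n * h%:R) / (PI * h%:R)) else 0) else 0.
have -> : \sum_(n < 2 ^ J) (if cut D D' n then (tk k n)%:R * saw H (z ^+ 19 / (n%:R + d)) else 0) =
   \sum_(h < 2 ^ J) G h.
  rewrite /G; under [RHS]eq_bigr => h _ do rewrite big_mkcond.
  transitivity (\sum_(h < 2 ^ J) \sum_(n < 2 ^ J) (if (0 < h <= H)%N then
    (if cut D D' n then (tk k n)%:R * (es (y n * h%:R) / (PI * h%:R)) else 0) else 0)).
    rewrite exchange_big /=; apply: eq_bigr => n _; case: ifP => cn; last by rewrite big1 // => h _; case: ifP.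
    rewrite /saw (sum_shift_ord (fun h => es (y n * h%:R) / (PI * h%:R)) HW) mulr_sumr.
    by apply: eq_bigr => h _; case: ifP; rewrite ?mulr0.
  by apply: eq_bigr => h _; case: ifP => // _; rewrite big1.
rewrite sum_dyadic {1}/G /= add0r.
have K0 : 0 <= k%:R * (c_bil * (t%:R ^+ k * (t%:R * J%:R ^+ 2 * z ^+ 9))).
  apply: mulr_ge0 => //; apply: mulr_ge0; first by rewrite /c_bil addr_ge0 // mulr_ge0.
  apply: mulr_ge0; first exact: exprn_ge0.
  by apply: mulr_ge0; [apply: mulr_ge0 => //; apply: sqr_ge0 | apply: exprn_ge0; apply: ltW].
apply: le_trans (ler_norm_sum_const (K := k%:R * (c_bil * (t%:R ^+ k * (t%:R * J%:R ^+ 2 * z ^+ 9)))) _) _.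
  move=> i _; pose M := (2 ^ i)%N; rewrite -/M.
  have M0 : (0 < M)%N by rewrite expn_gt0.
  have MR : 0 < M%:R :> R by rewrite ltr0n.
  have [MH|MH] := leqP M H; last first.
    rewrite big1 ?normr0 // => h Mh; rewrite /G; case: ifP => // /andP[_ hH].
    by move: MH; rewrite ltnNge (leq_trans Mh hH).
  pose g h : R := if (M <= h <= H)%N then M%:R / (PI * h%:R) else 0.
  have gA h : `|g h| <= 1.
    rewrite /g; case: ifP => [/andP[Mh _]|_]; last by rewrite normr0.
    have hR : M%:R <= h%:R :> R by rewrite ler_nat.
    have h0 : 0 < h%:R :> R by apply: lt_le_trans hR.
    have ph : 0 < PI * h%:R by apply: mulr_gt0 => //; lra.
    rewrite ger0_norm; last by apply: divr_ge0 => //; apply: ltW.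
    rewrite ler_pdivrMr // mul1r; apply: (le_trans hR); rewrite ler_peMl //; lra.
  have -> : \sum_(h < 2 * M | (M <= h)%N) G h =
     M%:R^-1 * conv_sum (2 ^ J) D D' (fun u => (u == 1%N)%:R) (fun q => (tk k q)%:R) (Phi (z ^+ 19) d M g).
    rewrite conv_sum_one; last by rewrite -{1}(expn0 2) ltn_exp2l.
    rewrite mulr_sumr.
    transitivity (\sum_(h < 2 * M | (M <= h)%N) \sum_(n < 2 ^ J) (if cut D D' n then M%:R^-1 * ((tk k n)%:R * (g h * es (z ^+ 19 * h%:R / (n%:R + d)))) else 0)).
      apply: eq_bigr => h Mh; have h0 : (0 < h)%N by apply: leq_trans Mh.
      rewrite /G /g h0 Mh /=; case: ifP => hH; last by rewrite big1 // => n _; rewrite mul0r !mulr0; case: ifP.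
      apply: eq_bigr => n _; case: ifP => // _.
      rewrite /y (mulrAC (z ^+ 19)); field.
      by rewrite !gt_eqF ?ltr0n //; lra.
    rewrite exchange_big /=; apply: eq_bigr => n _; case: ifP => _; last by rewrite mulr0 big1.
    by rewrite -mulr_sumr -mulr_sumr.
  rewrite normrM ger0_norm ?invr_ge0 // ler_pdivrMl //.
  have HD' : M%:R * z ^+ 9 <= D%:R.
    by apply: le_trans HD; apply: ler_wpM2r; [apply: exprn_ge0; apply: ltW | rewrite ler_nat].
  have a1 u : `|(u == 1%N)%:R : R| <= 1 by case: eqP => _; rewrite ?normr1 ?normr0.
  have a0 u : 2 * z ^+ 2 < u%:R -> (u == 1%N)%:R = 0 :> R.
    case: eqP => // -> h; exfalso; move: h; apply/negP; rewrite -leNgt expr2; nra.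
  have := @conv_sum_tk z d J M t D D' g k _ 1 z6 d0 d1 M0 t0 J0 zD Dz HD' D'D D'W Wz dt gA ler01 a1 a0.
  move=> h; apply: (le_trans h); rewrite /c_bil le_eqVlt; apply/orP; left; apply/eqP; ring.
by rewrite cardE size_enum_ord.
Qed.

Lemma card_cut_le W D D' : (#|[pred n : 'I_W | cut D D' n]| <= D' - D)%N.
Proof.
rewrite -sum1_card -(big_mkord (cut D D') (fun=> 1%N)).
apply: (@leq_trans (\sum_(0 <= i < maxn W D'.+1 | cut D D' i) 1)%N).
  rewrite (big_nat_widen _ _ _ _ _ (leq_maxl W D'.+1)) big_mkcond [leqRHS]big_mkcond /=.
  by apply: leq_sum => i _; case: (cut D D' i); case: (i < W)%N.
rewrite (eq_bigl (fun i => (D.+1 <= i)%N && (i < D'.+1)%N)); last by move=> i; rewrite /cut ltnS.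
have DM : (D'.+1 <= maxn W D'.+1)%N by apply: leq_maxr.
rewrite -(big_nat_widen 0 D'.+1 _ (fun i => D.+1 <= i)%N _ DM) -(@big_nat_widenl _ _ _ D.+1 0 D'.+1 xpredT) //.
by rewrite sum_nat_const_nat muln1 subSS.
Qed.

(** [H] of order [D / z^9] is long enough for the majorant's diagonal [D J / H] to be of order
    [z^9 J] and short enough for the bilinear bounds. Since the majorant is nonnegative, [tk k n] is
    replaced there by [t ^ k], and what remains is a cosine sum over a single smooth variable
    ([q = 1]). *)
Lemma psi_block (z d : R) (J t k D D' : nat) :
  6 <= z -> 0 <= d -> d <= 1 -> (0 < t)%N -> (0 < J)%N ->
  z ^+ 9 <= D%:R -> D%:R <= z ^+ 10 -> (D' <= 2 * D)%N ->
  (D' < 2 ^ J)%N -> (D < 2 ^ J)%N -> (2 ^ J)%N%:R <= z ^+ 19 ->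
  (forall w : nat, (0 < w)%N -> w%:R <= z ^+ 19 -> (size (divisors w) <= t)%N) ->
  `|\sum_(n < 2 ^ J) (if cut D D' n then (tk k n)%:R * psi (z ^+ 19 / (n%:R + d)) else 0)| <=
    (k%:R * c_bil + 8 * (2 + 2 * 1344)) * (t%:R ^+ k.+1 * J%:R ^+ 3 * z ^+ 9).
Proof.
move=> z6 d0 d1 t0 J0 zD Dz D'D D'W DW Wz dt.
have z0 : 0 < z by lra.
have zX n : 0 < z ^+ n by apply: exprn_gt0.
have DR : 0 < D%:R :> R by apply: lt_le_trans zD.
have D0 : (0 < D)%N by rewrite -(ltr0n R).
pose H := Num.trunc (D%:R / z ^+ 9).
have q0 : 0 <= D%:R / z ^+ 9 by apply: divr_ge0 => //; apply: ltW.
have /andP[H1 H2] := truncn_itv q0; rewrite -/H in H1 H2.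
have H0 : (0 < H)%N by rewrite /H truncn_gt0 ler_pdivlMr // mul1r.
have HR : 0 < H%:R :> R by rewrite ltr0n.
have HD : H%:R * z ^+ 9 <= D%:R by rewrite -ler_pdivlMr.
have D2 : D%:R <= 2 * H%:R * z ^+ 9.
  have h1 : D%:R < H.+1%:R * z ^+ 9 by rewrite -ltr_pdivrMr.
  apply: (le_trans (ltW h1)); apply: ler_wpM2r; first exact: ltW.
  by rewrite -natrM ler_nat; nlia.
have HW : (H < 2 ^ J)%N.
  apply: leq_ltn_trans DW; rewrite -(ler_nat R); apply: le_trans HD.
  by rewrite ler_peMr // exprn_ege1 //; lra.
pose y n := z ^+ 19 / (n%:R + d).
have dtW w : (0 < w < 2 ^ J)%N -> (size (divisors w) <= t)%N.
  move=> /andP[w0 wW]; apply: dt => //; apply: le_trans Wz; by rewrite ler_nat ltnW.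
have tR : 1 <= t%:R :> R by rewrite ler1n.
have J1 : 1 <= J%:R :> R by rewrite ler1n.
have tk0' : 0 <= t%:R ^+ k :> R by apply: exprn_ge0.
have A := @saw_block z d J H t k D D' z6 d0 d1 t0 J0 zD Dz HD D'D D'W HW Wz dt.
have Hs : \sum_(K < H) K.+1%:R^-1 <= J%:R :> R.
  apply: le_trans (harmonic_dyadic J); rewrite (sum_shift_ord (fun h => (h%:R)^-1) HW) [leRHS]big_mkcond /=.
  by apply: ler_sum => h _; case: (0 < h)%N => //=; case: ifP => // _; rewrite invr_ge0.
have E l : (0 < l < H)%N -> `|\sum_(n < 2 ^ J | cut D D' n) ec (y n * l%:R)| <= 1344 * (2 * z ^+ 9).
  move=> /andP[l0 lH]; have lR : 0 < l%:R :> R by rewrite ltr0n.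
  have a0 : 0 < z ^+ 19 * l%:R / D%:R ^+ 3.
    by apply: divr_gt0; [apply: mulr_gt0 | apply: exprn_gt0].
  pose w := Num.sqrt (z ^+ 19 * l%:R / D%:R ^+ 3).
  have w0 : 0 < w by rewrite sqrtr_gt0.
  have w2 : w ^+ 2 = z ^+ 19 * l%:R / D%:R ^+ 3 by rewrite sqr_sqrtr // ltW.
  have := @single_sum_bound_shift (z ^+ 19) d w 0 D D' 0 l 1 (2 ^ J) (zX 19%N) d0 d1 D0 D'D isT l0 w0 w2.
  have -> : \sum_(m < 2 ^ J | (0 < m)%N && cut D D' (m * 1)) ec (phase (z ^+ 19) d l 1 m - 0) =
      \sum_(n < 2 ^ J | cut D D' n) ec (y n * l%:R).
    apply: eq_big => [n | n _]; first by rewrite muln1 /cut; case: (posnP n) => // ->.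
    by rewrite subr0 phaseE muln1 /y mulrAC.
  move=> h; apply: (le_trans h); rewrite ler_pM2l // mul1r.
  have e1 : D%:R * w <= z ^+ 5.
    apply: le_of_sqr; first exact: ltW.
    rewrite exprMn w2.
    have -> : D%:R ^+ 2 * (z ^+ 19 * l%:R / D%:R ^+ 3) = z ^+ 10 * (l%:R * z ^+ 9 / D%:R).
      by field; rewrite gt_eqF.
    have -> : (z ^+ 5) ^+ 2 = z ^+ 10 * 1 by ring.
    rewrite ler_pM2l // ler_pdivrMr // mul1r; apply: le_trans HD.
    by apply: ler_wpM2r; [apply: ltW | rewrite ler_nat ltnW].
  have e2 : 1 / w <= z ^+ 6.
    rewrite div1r; apply: le_of_sqr; first exact: ltW.
    rewrite exprVn w2 invf_div ler_pdivrMr ?mulr_gt0 //.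
    apply: (@le_trans _ _ ((z ^+ 10) ^+ 3)); first by rewrite lerXn2r ?nnegrE // ltW.
    have -> : (z ^+ 6) ^+ 2 * (z ^+ 19 * l%:R) = (z ^+ 10) ^+ 3 * (z * l%:R) by ring.
    rewrite ler_peMr //; first by rewrite exprn_ge0 // ltW.
    by apply: mulr_ege1; [lra | rewrite ler1n].
  have e3 : z ^+ 5 <= z ^+ 9 by apply: ler_weXn2l => //; lra.
  have e4 : z ^+ 6 <= z ^+ 9 by apply: ler_weXn2l => //; lra.
  by rewrite mul1r in e2 *; lra.
have E0 : 0 <= 1344 * (2 * z ^+ 9) by apply: mulr_ge0 => //; apply: mulr_ge0 => //; apply: ltW.
have FS := fejer_sum_le H0 E0 E Hs.
have card_le : #|[pred n : 'I_(2 ^ J) | cut D D' n]|%:R * J%:R / H%:R <= 2 * z ^+ 9 * J%:R.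
  rewrite ler_pdivrMr //; apply: (@le_trans _ _ (D%:R * J%:R)).
    apply: ler_wpM2r => //; rewrite ler_nat; apply: leq_trans (card_cut_le _ _ _) _; nlia.
  have : D%:R * J%:R <= 2 * H%:R * z ^+ 9 * J%:R by apply: ler_wpM2r.
  by move=> h; apply: (le_trans h); rewrite le_eqVlt; apply/orP; left; apply/eqP; ring.
have B : `|\sum_(n < 2 ^ J) (if cut D D' n then (tk k n)%:R * (psi (y n) + saw H (y n)) else 0)| <=
    t%:R ^+ k * (8 * (2 * z ^+ 9 * J%:R + 1344 * (2 * z ^+ 9))).
  rewrite -big_mkcond /=; apply: le_trans (ler_norm_sum _ _ _) _.
  apply: (@le_trans _ _ (\sum_(n < 2 ^ J | cut D D' n) t%:R ^+ k * (8 * fejer H (y n)))).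
    apply: ler_sum => n _; rewrite normrM; apply: ler_pM => //; last exact: psi_fejer.
    by rewrite normr_nat -natrX ler_nat; apply: tk_le dtW t0 (ltn_ord n).
  rewrite -mulr_sumr -mulr_sumr; apply: ler_wpM2l => //; apply: ler_wpM2l => //.
  by apply: (le_trans FS); rewrite lerD2r.
have -> : \sum_(n < 2 ^ J) (if cut D D' n then (tk k n)%:R * psi (z ^+ 19 / (n%:R + d)) else 0) =
   \sum_(n < 2 ^ J) (if cut D D' n then (tk k n)%:R * (psi (y n) + saw H (y n)) else 0) -
   \sum_(n < 2 ^ J) (if cut D D' n then (tk k n)%:R * saw H (z ^+ 19 / (n%:R + d)) else 0).
  rewrite -sumrB; apply: eq_bigr => n _; case: ifP => _; last by rewrite subr0.
  by rewrite -/(y n); ring.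
apply: le_trans (ler_normB _ _) _; apply: le_trans (lerD B A) _.
have t1 : t%:R ^+ k * 1 <= t%:R ^+ k * t%:R :> R by apply: ler_wpM2l.
have P0 : 0 <= t%:R ^+ k.+1 * z ^+ 9 by apply: mulr_ge0; [apply: exprn_ge0 | apply: ltW].
have J2 : J%:R <= J%:R ^+ 3 :> R by rewrite -[leLHS]expr1; apply: ler_weXn2l.
have J3 : 1 <= J%:R ^+ 3 :> R by apply: le_trans J2.
have b1 : t%:R ^+ k * (8 * (2 * z ^+ 9 * J%:R + 1344 * (2 * z ^+ 9))) <=
   8 * (2 + 2 * 1344) * (t%:R ^+ k.+1 * J%:R ^+ 3 * z ^+ 9).
  have -> : t%:R ^+ k * (8 * (2 * z ^+ 9 * J%:R + 1344 * (2 * z ^+ 9))) =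
    8 * (t%:R ^+ k * 1 * z ^+ 9 * (2 * J%:R + 2 * 1344 * 1)) by ring.
  have -> : 8 * (2 + 2 * 1344) * (t%:R ^+ k.+1 * J%:R ^+ 3 * z ^+ 9) =
    8 * (t%:R ^+ k * t%:R * z ^+ 9 * (2 * J%:R ^+ 3 + 2 * 1344 * J%:R ^+ 3)) by rewrite (exprS _ k); ring.
  apply: ler_wpM2l => //; apply: ler_pM.
  - by apply: mulr_ge0; [rewrite mulr1 | apply: ltW].
  - by apply: addr_ge0; apply: mulr_ge0 => //; apply: mulr_ge0.
  - by apply: ler_wpM2r => //; apply: ltW.
  - by apply: lerD; apply: ler_wpM2l => //; apply: mulr_ge0.
have b2 : J%:R * (k%:R * (c_bil * (t%:R ^+ k * (t%:R * J%:R ^+ 2 * z ^+ 9)))) =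
   k%:R * c_bil * (t%:R ^+ k.+1 * J%:R ^+ 3 * z ^+ 9) by rewrite (exprS _ k); ring.
rewrite b2 [leRHS]mulrDl addrC lerD2l; exact: b1.
Qed.

(** * Grouping by the value of the quotient *)

Lemma floor_trunc (y : R) : 0 <= y -> Num.floor y = (Num.trunc y)%:Z.
Proof.
move=> y0; have /andP[t1 t2] := truncn_itv y0.
by apply: floor_def; rewrite t1 /= intrD natr1.
Qed.

Lemma truncE_psi (y : R) : 0 <= y -> (Num.trunc y)%:R = y - psi y - 1 / 2.
Proof. by move=> y0; rewrite /psi floor_trunc // -pmulrn; ring. Qed.

Lemma normr_psi (y : R) : `|psi y| <= 1 / 2.
Proof.
have /andP[h1 h2] := floor_itv y; move: h2; rewrite intrD /psi => h2.
by rewrite ler_norml; apply/andP; split; lra.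
Qed.

(** Both sides say [n d <= x]. *)
Lemma leq_truncn_sym (x : R) (n d : nat) : 0 <= x -> (0 < n)%N -> (0 < d)%N ->
  (d <= Num.trunc (x / n%:R))%N = (n <= Num.trunc (x / d%:R))%N.
Proof.
move=> x0 n0 d0; have nR : 0 < n%:R :> R by rewrite ltr0n.
have dR : 0 < d%:R :> R by rewrite ltr0n.
rewrite !truncn_ge_nat ?divr_ge0 //.
by rewrite !ler_pdivlMr // mulrC.
Qed.

Lemma count_upto X m : (m <= X)%N -> \sum_(1 <= n < X.+1) (n <= m)%:R = m%:R :> R.
Proof.
move=> mX; rewrite (@big_cat_nat _ _ _ m.+1) //= [X in _ + X]big1_seq ?addr0; last first.
  by move=> n /=; rewrite mem_index_iota => /andP[mn _]; rewrite leqNgt mn.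
rewrite (eq_big_seq (fun=> 1)) => [|n]; last by rewrite mem_index_iota ltnS => /andP[_ ->].
by rewrite big_const_nat subSS subn0 iter_addr addr0.
Qed.

(** By [leq_truncn_sym] the [n] with quotient at least [d] are those up to [[x/d]]; the count is the
    difference for [d] and [d.+1]. *)
Lemma card_trunc_eq (x : R) (X d : nat) : 0 <= x -> X = Num.trunc x -> (0 < d)%N ->
  \sum_(1 <= n < X.+1) (Num.trunc (x / n%:R) == d)%:R =
  (Num.trunc (x / d%:R))%:R - (Num.trunc (x / d.+1%:R))%:R :> R.
Proof.
move=> x0 XE d0.
have NX e : (0 < e)%N -> (Num.trunc (x / e%:R) <= X)%N.
  move=> e0; rewrite XE; apply: le_truncn; rewrite ler_piMr // invf_le1 ?ltr0n // ler1n //.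
rewrite -(count_upto (NX d d0)) -(count_upto (NX d.+1 isT)) -sumrB.
apply: eq_big_nat => n /andP[n0 _].
rewrite -(leq_truncn_sym x0 n0 d0) -(leq_truncn_sym x0 n0 (ltn0Sn d)); case: (ltngtP d (Num.trunc (x / n%:R))) => _; rewrite ?subr0 ?subrr //.
Qed.

Lemma dyadic_cover (g : nat -> R) (W A B j : nat) :
  \sum_(n < W | cut A (minn (A * 2 ^ j) B) n) g n =
  \sum_(i < j) \sum_(n < W | cut (A * 2 ^ i) (minn (A * 2 ^ i.+1) B) n) g n.
Proof.
elim: j => [|j IH].
  rewrite big_ord0 big1 // => n; rewrite /cut expn0 muln1; lia.
rewrite big_ord_recr /= -IH [LHS]big_mkcond [X in _ = X + _]big_mkcond [X in _ = _ + X]big_mkcond -big_split /=.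
apply: eq_bigr => n _; rewrite /cut.
have h : (A * 2 ^ j <= A * 2 ^ j.+1)%N by rewrite leq_mul2l leq_exp2l ?leqnSn ?orbT.
have h0 : (A <= A * 2 ^ j)%N by rewrite leq_pmulr // expn_gt0.
move: (A * 2 ^ j)%N (A * 2 ^ j.+1)%N h h0 => a b ab Aa.
case: ifP => c1; case: ifP => c2; case: ifP => c3; rewrite ?addr0 ?add0r //; exfalso; lia.
Qed.

Lemma divisor_sum_large (z : R) (J t k : nat) :
  6 <= z -> (0 < t)%N -> (0 < J)%N -> z ^+ 10 < (2 ^ J)%N%:R -> (2 ^ J)%N%:R <= z ^+ 19 ->
  (forall w : nat, (0 < w)%N -> w%:R <= z ^+ 19 -> (size (divisors w) <= t)%N) ->
  `|\sum_(1 <= n < (Num.trunc (z ^+ 19)).+1) (tk k (Num.trunc (z ^+ 19 / n%:R)))%:R -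
    z ^+ 19 * \sum_(1 <= d < (Num.trunc (z ^+ 10)).+1) (tk k d)%:R / (d%:R * d.+1%:R)| <=
  (3 + 2 * (k%:R * c_bil + 8 * (2 + 2 * 1344))) * (t%:R ^+ k.+1 * J%:R ^+ 4 * z ^+ 9).
Proof.
move=> z6 t0 J0 zJ Jz dt.
have z0 : 0 < z by lra.
have zX n : 0 < z ^+ n by apply: exprn_gt0.
set x := z ^+ 19; set X := Num.trunc x; set B := Num.trunc (z ^+ 10).
have x0 : 0 < x by apply: zX.
have /andP[X1 X2] := truncn_itv (ltW x0); rewrite -/X in X1 X2.
have /andP[B1 B2] := truncn_itv (ltW (zX 10%N)); rewrite -/B in B1 B2.
have BW : (B < 2 ^ J)%N by rewrite -(ltr_nat R); apply: le_lt_trans zJ.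
pose f d : R := (tk k d)%:R.
pose N (e : nat) := Num.trunc (x / e%:R).
have NX e : (0 < e)%N -> (N e <= X)%N.
  move=> e0; apply: le_truncn; rewrite ler_piMr ?(ltW x0) // invf_le1 ?ltr0n // ler1n //.
have dtX w : (0 < w < X.+1)%N -> (size (divisors w) <= t)%N.
  move=> /andP[w0 wX]; apply: dt => //; apply: le_trans X1; by rewrite ler_nat -ltnS.
have fF d : (d <= X)%N -> 0 <= f d <= t%:R ^+ k.
  by move=> dX; rewrite ler0n /f -natrX ler_nat; apply: tk_le dtX t0 _.
have tk1 : 0 <= t%:R ^+ k :> R by apply: exprn_ge0.
have BX : (B <= X)%N.
  by apply: le_truncn; apply: ler_weXn2l => //; lra.
pose g d : R := f d * (psi (x / d.+1%:R) - psi (x / d%:R)).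
have split1 : \sum_(1 <= n < X.+1) f (N n) =
   \sum_(1 <= n < X.+1) (if (B < N n)%N then f (N n) else 0) +
   \sum_(1 <= d < B.+1) f d * ((N d)%:R - (N d.+1)%:R).
  transitivity (\sum_(1 <= n < X.+1) (if (B < N n)%N then f (N n) else 0) +
     \sum_(1 <= n < X.+1) \sum_(1 <= d < B.+1) f d * (N n == d)%:R).
    rewrite -big_split /=; apply: eq_big_nat => n /andP[n0 nX].
    have N1 : (0 < N n)%N.
      by rewrite /N truncn_gt0 ler_pdivlMr ?ltr0n // mul1r; apply: le_trans X1; rewrite ler_nat -ltnS.
    case: ltnP => BN.
      rewrite big1_seq ?addr0 // => d /=; rewrite mem_index_iota => /andP[_ dB].
      by rewrite (gtn_eqF (leq_trans dB BN)) mulr0.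
    rewrite add0r (bigD1_seq (N n)) ?mem_index_iota ?iota_uniq ?N1 //= eqxx mulr1 big1 ?addr0 //.
    by move=> d dN; rewrite eq_sym (negbTE dN) mulr0.
  congr (_ + _); rewrite exchange_big /=; apply: eq_big_nat => d /andP[d0 _].
  by rewrite -mulr_sumr (@card_trunc_eq x X d (ltW x0) erefl d0).
(* Each floor is written as [y - psi y - 1/2]; the halves cancel, the linear parts give the main
   term and [g] collects the sawtooth values. *)
have split2 : \sum_(1 <= d < B.+1) f d * ((N d)%:R - (N d.+1)%:R) =
   x * (\sum_(1 <= d < B.+1) f d / (d%:R * d.+1%:R)) + \sum_(1 <= d < B.+1) g d.
  rewrite mulr_sumr -big_split /=; apply: eq_big_nat => d /andP[d0 _].
  have dR : 0 < d%:R :> R by rewrite ltr0n.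
  have dR1 : 0 < d.+1%:R :> R by rewrite ltr0n.
  rewrite /N !truncE_psi ?divr_ge0 ?ltW // /g.
  have -> : x * (f d / (d%:R * d.+1%:R)) = f d * (x / d%:R - x / d.+1%:R).
    rewrite -(natr1 d); rewrite -(natr1 d) in dR1; field; by rewrite !gt_eqF.
  by ring.
(* [[x/n] > B] means [n <= [x/(B+1)]], and [B + 1 > z^10] keeps this below [z^9]. *)
have big1' : `|\sum_(1 <= n < X.+1) (if (B < N n)%N then f (N n) else 0)| <= t%:R ^+ k * z ^+ 9.
  apply: le_trans (ler_norm_sum _ _ _) _.
  apply: (@le_trans _ _ (\sum_(1 <= n < X.+1) t%:R ^+ k * (n <= N B.+1)%:R)).
    apply: ler_sum_nat => n /andP[n0 nX].
    rewrite -(leq_truncn_sym (ltW x0) n0 (ltn0Sn B)) -/(N n); case: ifP => BN; last by rewrite normr0 mulr0.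
    by rewrite mulr1; have /andP[f1 f2] := fF _ (NX n n0); rewrite ger0_norm.
  rewrite -mulr_sumr count_upto ?NX //; apply: ler_wpM2l => //.
  have BR : 0 < B.+1%:R :> R by rewrite ltr0n.
  have y0 : 0 <= x / B.+1%:R by apply: divr_ge0 => //; apply: ltW.
  have /andP[h _] := truncn_itv y0; apply: (le_trans h).
  rewrite ler_pdivrMr // /x (exprD z 9 10) ler_pM2l //; exact: ltW.
have gF d : (d <= X)%N -> `|g d| <= t%:R ^+ k.
  move=> dX; have /andP[f1 f2] := fF _ dX; rewrite /g normrM -[leRHS]mulr1.
  apply: ler_pM => //; first by rewrite ger0_norm.
  apply: le_trans (ler_normB _ _) _; have := normr_psi (x / d.+1%:R); have := normr_psi (x / d%:R); lra.
(* The successor ensures [z ^+ 9 <= A], which every block start [A * 2 ^ i] inherits; the [d] up to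
   [A] are bounded trivially. *)
pose A := (Num.trunc (z ^+ 9)).+1.
have /andP[A1 A2] := truncn_itv (ltW (zX 9%N)).
have zA : z ^+ 9 <= A%:R by apply: ltW.
have Az : A%:R <= 2 * z ^+ 9.
  have : 1 <= z ^+ 9 by apply: exprn_ege1; lra.
  by rewrite /A -natr1; lra.
have AB : (B <= A * 2 ^ J)%N.
  by apply: (leq_trans (ltnW BW)); rewrite leq_pmull.
have split3 : \sum_(1 <= d < B.+1) g d =
   \sum_(d < 2 ^ J | cut 0 (minn A B) d) g d + \sum_(d < 2 ^ J | cut A B d) g d.
  have -> : \sum_(1 <= d < B.+1) g d = \sum_(d < 2 ^ J | cut 0 B d) g d.
    rewrite (big_nat_widen _ _ _ _ _ BW) big_geq_mkord /=; apply: eq_bigl => d.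
    by rewrite /cut ltnS andbC.
  rewrite big_mkcond [X in _ = X + _]big_mkcond [X in _ = _ + X]big_mkcond -big_split /=.
  apply: eq_bigr => d _; rewrite /cut.
  by case: ifP => c1; case: ifP => c2; case: ifP => c3; rewrite ?addr0 ?add0r //; exfalso;
    clearbody A B; move: c1 c2 c3; clear; lia.
pose Cb : R := (k%:R * c_bil + 8 * (2 + 2 * 1344)) * (t%:R ^+ k.+1 * J%:R ^+ 3 * z ^+ 9).
have cb0 : 0 <= k%:R * c_bil + 8 * (2 + 2 * 1344).
  by rewrite addr_ge0 ?mulr_ge0 // /c_bil ?addr_ge0 ?mulr_ge0.
have Cb0 : 0 <= Cb.
  apply: mulr_ge0 => //; apply: mulr_ge0; last exact: ltW.
  by apply: mulr_ge0; apply: exprn_ge0.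
have small : `|\sum_(d < 2 ^ J | cut 0 (minn A B) d) g d| <= t%:R ^+ k * (2 * z ^+ 9).
  apply: le_trans (ler_norm_sum_const (K := t%:R ^+ k) _) _ => [d /andP[_ dm]|].
    apply: gF; apply: leq_trans BX; apply: (leq_trans dm); exact: geq_minr.
  rewrite mulrC; apply: ler_wpM2l => //; apply: le_trans Az; rewrite ler_nat.
  by apply: leq_trans (card_cut_le _ _ _) _; rewrite subn0 geq_minl.
have blocks : `|\sum_(d < 2 ^ J | cut A B d) g d| <= J%:R * (2 * Cb).
  have -> : \sum_(d < 2 ^ J | cut A B d) g d = \sum_(d < 2 ^ J | cut A (minn (A * 2 ^ J) B) d) g d.
    by rewrite (minn_idPr AB).
  rewrite dyadic_cover; apply: le_trans (ler_norm_sum_const (K := 2 * Cb) _) _; last by rewrite cardE size_enum_ord.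
  move=> i _; set D := (A * 2 ^ i)%N; set D' := minn _ B.
  have [DB|DB] := leqP D B; last first.
    rewrite big1 ?normr0; first by apply: mulr_ge0.
    by move=> n /andP[Dn nD]; move: (leq_trans nD (geq_minr _ _)); rewrite leqNgt (ltn_trans DB Dn).
  have AD : (A <= D)%N by rewrite leq_pmulr // expn_gt0.
  have zD : z ^+ 9 <= D%:R by apply: (le_trans zA); rewrite ler_nat.
  have Dz : D%:R <= z ^+ 10 by apply: le_trans B1; rewrite ler_nat.
  have D'D : (D' <= 2 * D)%N.
    by apply: (leq_trans (geq_minl _ _)); rewrite expnS /D mulnCA.
  have D'W : (D' < 2 ^ J)%N by apply: leq_ltn_trans BW; apply: geq_minr.
  have DW : (D < 2 ^ J)%N by apply: leq_ltn_trans BW.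
  (* The two sawtooth terms of [g] are the shifts 1 and 0. *)
  have p1 := @psi_block z 1 J t k D D' z6 ler01 (lexx _) t0 J0 zD Dz D'D D'W DW Jz dt.
  have p0 := @psi_block z 0 J t k D D' z6 (lexx _) ler01 t0 J0 zD Dz D'D D'W DW Jz dt.
  have -> : \sum_(n < 2 ^ J | cut D D' n) g n =
     \sum_(n < 2 ^ J) (if cut D D' n then (tk k n)%:R * psi (z ^+ 19 / (n%:R + 1)) else 0) -
     \sum_(n < 2 ^ J) (if cut D D' n then (tk k n)%:R * psi (z ^+ 19 / (n%:R + 0)) else 0).
    rewrite big_mkcond -sumrB; apply: eq_bigr => n _; case: ifP => _; last by rewrite subr0.
    by rewrite /g addr0 natr1 mulrBr.
  apply: le_trans (ler_normB _ _) _; apply: le_trans (lerD p1 p0) _.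
  by rewrite -/Cb; lra.
rewrite -/(f _) -/(N _) split1 split2 split3.
have -> : \sum_(1 <= n < X.+1) (if (B < N n)%N then f (N n) else 0) +
   (x * (\sum_(1 <= d < B.+1) f d / (d%:R * d.+1%:R)) +
   (\sum_(d < 2 ^ J | cut 0 (minn A B) d) g d + \sum_(d < 2 ^ J | cut A B d) g d)) -
   x * (\sum_(1 <= d < B.+1) f d / (d%:R * d.+1%:R)) =
   \sum_(1 <= n < X.+1) (if (B < N n)%N then f (N n) else 0) +
   \sum_(d < 2 ^ J | cut 0 (minn A B) d) g d + \sum_(d < 2 ^ J | cut A B d) g d by ring.
apply: le_trans (ler_normD _ _) _; apply: le_trans (lerD (ler_normD _ _) (lexx _)) _.
apply: le_trans (lerD (lerD big1' small) blocks) _.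
have J1 : 1 <= J%:R :> R by rewrite ler1n.
have tR : 1 <= t%:R :> R by rewrite ler1n.
have m1 : t%:R ^+ k * z ^+ 9 <= t%:R ^+ k.+1 * J%:R ^+ 4 * z ^+ 9.
  apply: ler_wpM2r; first exact: ltW.
  rewrite (exprS _ k) mulrAC ler_peMl // mulr_ege1 //; exact: exprn_ege1.
have m2 : J%:R * (2 * Cb) = 2 * (k%:R * c_bil + 8 * (2 + 2 * 1344)) * (t%:R ^+ k.+1 * J%:R ^+ 4 * z ^+ 9).
  by rewrite /Cb; ring.
by rewrite m2 [leRHS]mulrDl lerD2r; lra.
Qed.

(** * Divisor bounds *)

Lemma size_divisors_pfactor p n : prime p -> (0 < n)%N ->
  exists m, [/\ (0 < m)%N, coprime p m, n = (m * p ^ logn p n)%N &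
    (size (divisors n) <= (logn p n).+1 * size (divisors m))%N].
Proof.
move=> pp n0; have [m pm nE] := pfactor_coprime pp n0.
have m0 : (0 < m)%N by case: m nE {pm} => // nE; rewrite nE in n0.
exists m; split=> //.
set a := logn p n.
have -> : (a.+1 * size (divisors m) = size [seq (i * (p ^ j))%N | i <- divisors m, j <- iota 0 a.+1])%N.
  by rewrite size_allpairs size_iota mulnC.
apply: uniq_leq_size; first exact: divisors_uniq.
move=> e; rewrite -dvdn_divisors // => en.
have e0 : (0 < e)%N by apply: dvdn_gt0 en.
have [e' pe' eE] := pfactor_coprime pp e0.
rewrite {1}eE; apply/allpairsP; exists (e', logn p e); split; [|by rewrite mem_iota add0n ltnS dvdn_leq_log|by []].
rewrite -dvdn_divisors //=; have : (e' %| n)%N by apply: dvdn_trans en; rewrite eE dvdn_mulr.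
by rewrite nE mulnC Gauss_dvdr // coprime_sym coprimeXl.
Qed.

Lemma bernoulli (c : R) a : 0 <= c -> 1 + c * a%:R <= (1 + c) ^+ a.
Proof.
move=> c0; elim: a => [|a IH]; first by rewrite mulr0 addr0.
rewrite exprS; apply: (@le_trans _ _ ((1 + c) * (1 + c * a%:R))); last by rewrite ler_pM2l //; lra.
have : 0 <= c * c * a%:R by rewrite !mulr_ge0.
rewrite -(natr1 a); lra.
Qed.

(** [phi n] will be [n^eta]. Over the prime powers [p^a] dividing [n] exactly,
    [a + 1 <= 2^a <= phi(p)^a] as soon as [phi p >= 2]; each of the finitely many primes below [P0]
    costs one factor [K]. *)
Section DivisorBound.
Variables (phi : nat -> R) (P0 : nat) (c K : R).
Hypothesis phiM : forall m n, (0 < m)%N -> (0 < n)%N -> phi (m * n) = phi m * phi n.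
Hypothesis phi1 : forall n, (0 < n)%N -> 1 <= phi n.
Hypothesis c0 : 0 < c.
Hypothesis phi_c : forall p, (2 <= p)%N -> 1 + c <= phi p.
Hypothesis phi2 : forall p, (P0 <= p)%N -> 2 <= phi p.
Hypothesis K1 : 1 <= K.
Hypothesis Kc : 1 <= K * c.

Lemma phiX p a : (0 < p)%N -> phi (p ^ a) = phi p ^+ a.
Proof.
move=> p0; have h : phi 1 = 1.
  have := phi1 (ltnSn 0); have := @phiM 1 1 isT isT; rewrite muln1 => e f1.
  have : phi 1 * (phi 1 - 1) = 0 by rewrite mulrBr mulr1 -e subrr.
  by move/eqP; rewrite mulf_eq0 subr_eq0 => /orP[/eqP|/eqP] //; lra.
elim: a => [|a IH]; first by rewrite expn0 expr0.
by rewrite expnS exprS phiM ?expn_gt0 ?p0 // IH.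
Qed.

(** Bernoulli's inequality: [a + 1 <= K (1 + c a) <= K (1 + c)^a], by [K >= 1] and [K c >= 1]. *)
Lemma succ_le_phiX p a : (2 <= p)%N -> a.+1%:R <= K * phi p ^+ a.
Proof.
have k1 := K1; have kc := Kc; have cc := c0.
move=> p2; apply: (@le_trans _ _ (K * (1 + c * a%:R))).
  rewrite mulrDr mulr1 mulrA -natr1.
  have : 1 * a%:R <= K * c * a%:R by apply: ler_wpM2r.
  lra.
apply: ler_wpM2l; first lra.
apply: le_trans (bernoulli a (ltW c0)) _.
by rewrite lerXn2r ?nnegrE //; [lra | have := phi_c p2; lra | exact: phi_c].
Qed.

Lemma succ_le_phiX_large p a : (P0 <= p)%N -> a.+1%:R <= phi p ^+ a.
Proof.
move=> pP; apply: (@le_trans _ _ ((1 + 1) ^+ a)).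
  by have := @bernoulli 1 a ler01; rewrite mul1r -natr1 addrC.
by rewrite lerXn2r ?nnegrE //; have := phi2 pP; lra.
Qed.

(** Induction on a strict bound [P] for the prime divisors: a step removes the full power of one
    prime and spends a [K] only if that prime is below [P0], hence the minimum. *)
Lemma divisor_bound_aux P n : (0 < n)%N -> (forall p, prime p -> (p %| n)%N -> (p < P)%N) ->
  (size (divisors n))%:R <= K ^+ minn P P0 * phi n.
Proof.
have k1 := K1.
elim: P n => [|P IH] n n0 np.
  have [n1|] := ltnP 1 n; first by have := np _ (pdiv_prime n1) (pdiv_dvd n).
  move=> n1; have -> : n = 1%N by lia.
  by rewrite min0n expr0 mul1r /=; apply: phi1.
have Kmon : K ^+ minn P P0 <= K ^+ minn P.+1 P0.
  by apply: ler_weXn2l => //; lia.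
have [/andP[Pp Pn]|nP] := boolP (prime P && (P %| n)%N); last first.
  apply: (@le_trans _ _ (K ^+ minn P P0 * phi n)).
    apply: IH => // p pp pn; have := np p pp pn; rewrite ltnS leq_eqVlt => /orP[/eqP pP|//].
    by move: nP; rewrite -pP pp pn.
  by apply: ler_wpM2r => //; have := phi1 n0; lra.
have [m [m0 Pm nE sz]] := size_divisors_pfactor Pp n0.
set a := logn P n in nE sz.
have P2 := prime_gt1 Pp.
have Pa0 : (0 < P ^ a)%N by rewrite expn_gt0 (ltnW P2).
have mIH : (size (divisors m))%:R <= K ^+ minn P P0 * phi m.
  apply: IH => // p pp pm; have pn : (p %| n)%N by rewrite nE dvdn_mulr.
  have := np p pp pn; rewrite ltnS leq_eqVlt => /orP[/eqP pP|//].
  by move: Pm; rewrite -pP prime_coprime // pm.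
apply: (@le_trans _ _ (a.+1%:R * (size (divisors m))%:R)); first by rewrite -natrM ler_nat.
have -> : phi n = phi m * phi P ^+ a by rewrite [in LHS]nE phiM // phiX // ltnW.
have pm1 := phi1 m0; have pP1 := phi1 (ltnW P2).
have KP : 0 <= K ^+ minn P P0 by apply: exprn_ge0; lra.
have [PP|PP] := leqP P0 P.
  apply: (@le_trans _ _ (phi P ^+ a * (K ^+ minn P P0 * phi m))).
    by apply: ler_pM => //; apply: succ_le_phiX_large.
  rewrite mulrC -mulrA; apply: ler_wpM2r => //.
  by apply: mulr_ge0; [lra | apply: exprn_ge0; lra].
apply: (@le_trans _ _ (K * phi P ^+ a * (K ^+ minn P P0 * phi m))).
  by apply: ler_pM => //; apply: succ_le_phiX.
have -> : minn P.+1 P0 = (minn P P0).+1 by lia.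
by rewrite (exprS K) le_eqVlt; apply/orP; left; apply/eqP; ring.
Qed.

Lemma divisor_bound n : (0 < n)%N -> (size (divisors n))%:R <= K ^+ P0 * phi n.
Proof.
have k1 := K1; move=> n0; apply: le_trans (@divisor_bound_aux n.+1 n n0 _) _.
  by move=> p _ /dvdn_leq; rewrite ltnS; apply.
apply: ler_wpM2r; first by have := phi1 n0; lra.
by apply: ler_weXn2l => //; apply: geq_minr.
Qed.

End DivisorBound.

(** The codomain ['I_W] is decoupled from [n] because the induction passes from [n] to [n %/ v];
    [tau] is the case [W = n.+1]. *)
Lemma card_ffun_prod k W n : (0 < n < W)%N ->
  #|[set t : {ffun 'I_k -> 'I_W} | [forall i, 0 < nat_of_ord (t i)]%N && (\prod_(i < k) nat_of_ord (t i) == n)%N]| = tk k n.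
Proof.
elim: k n => [|k IH] n /andP[n0 nW].
  rewrite /=; have [->|n1] := eqVneq n 1%N.
    rewrite (_ : [set t | _] = setT); first by rewrite cardsT card_ffun !card_ord.
    by apply/setP => t; rewrite !inE big_ord0 eqxx andbT; apply/forallP => -[].
  apply/eqP; rewrite cards_eq0; apply/eqP/setP => t; rewrite !inE big_ord0 eq_sym (negbTE n1) andbF //.
rewrite (@tkS W) ?n0 //.
(* [h] puts an entry in front of a tuple, [h'] drops the first entry. *)
pose h (v : 'I_W) (s : {ffun 'I_k -> 'I_W}) : {ffun 'I_k.+1 -> 'I_W} :=
  [ffun i => if unlift ord0 i is Some j then s j else v].
pose h' (t : {ffun 'I_k.+1 -> 'I_W}) : {ffun 'I_k -> 'I_W} := [ffun j => t (lift ord0 j)].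
have h0 v s : h v s ord0 = v by rewrite ffunE unlift_none.
have hl v s j : h v s (lift ord0 j) = s j by rewrite ffunE liftK.
rewrite -sum1dep_card (partition_big (fun t : {ffun 'I_k.+1 -> 'I_W} => t ord0) xpredT) //=.
apply: eq_bigr => v _.
rewrite (reindex_onto (h v) h') /=; last first.
  move=> t /andP[_ /eqP tv]; apply/ffunP => i; rewrite ffunE.
  by case: unliftP => [j ->|->]; rewrite ?ffunE.
have cond s : [&& [forall i, 0 < h v s i]%N && (\prod_(i < k.+1) h v s i == n)%N, h v s ord0 == v & h' (h v s) == s] =
    (0 < v)%N && ([forall i, 0 < s i]%N && (v * \prod_(i < k) s i == n)%N).
  have -> : h' (h v s) == s by apply/eqP/ffunP => j; rewrite ffunE hl.
  rewrite h0 eqxx !andbT big_ord_recl h0; under eq_bigr => i _ do rewrite hl.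
  rewrite andbA; congr (_ && _); apply/forallP/andP => [H|[v0 /forallP H] i].
    by split; [have := H ord0; rewrite h0 | apply/forallP => j; have := H (lift ord0 j); rewrite hl].
  by case: (unliftP ord0 i) => [j ->|->]; rewrite ?hl ?h0.
rewrite (eq_bigl (fun s : {ffun 'I_k -> 'I_W} => (0 < v)%N && ([forall i, 0 < s i]%N && (v * \prod_(i < k) s i == n)%N))); last first.
  by move=> s; rewrite -cond -!andbA.
case: (posnP v) => [v0|v0] /=.
  rewrite big_pred0 // big_pred0 // => w; rewrite v0 mul0n; apply/negbTE; by rewrite neq_ltn n0.
have [vn|vn] := boolP (v %| n)%N; last first.
  rewrite !big_pred0 //.
    by move=> w; apply/negbTE; apply: contra vn => /eqP <-; apply: dvdn_mulr.
  by move=> s; apply/negbTE; apply: contra vn => /andP[_ /eqP <-]; apply: dvdn_mulr.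
have qW : (n %/ v < W)%N by apply: leq_ltn_trans nW; apply: leq_div.
have eqv (w : nat) : (v * w == n)%N = (w == n %/ v)%N.
  by rewrite -[RHS](eqn_pmul2l v0) [(v * (n %/ v))%N]mulnC divnK.
rewrite (eq_bigl (fun w : 'I_W => w == Ordinal qW)) => [|w]; last by rewrite eqv.
rewrite big_pred1_eq /= -IH; last by rewrite qW divn_gt0 // dvdn_leq.
by rewrite sum1dep_card; apply: eq_card => s; rewrite !inE eqv.
Qed.

Lemma tau_tk k n : (0 < n)%N -> tau k n = tk k n.
Proof. by move=> n0; apply: card_ffun_prod; rewrite n0 ltnSn. Qed.

(** * Real powers and losses of size [x^eta] *)

Definition pw (x a : R) : R := Rpower x a.

Lemma pwD x a b : pw x (a + b) = pw x a * pw x b.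
Proof. exact: Rpower_plus. Qed.

Lemma pwA x a b : pw (pw x a) b = pw x (a * b).
Proof. exact: Rpower_mult. Qed.

Lemma pw_gt0 x a : 0 < pw x a.
Proof. by apply/RltP; exact: exp_pos. Qed.

Lemma pwM x y a : 0 < x -> 0 < y -> pw (x * y) a = pw x a * pw y a.
Proof. by move=> /RltP x0 /RltP y0; symmetry; apply: Rpower_mult_distr. Qed.

Lemma pw_le x a b : 1 <= x -> a <= b -> pw x a <= pw x b.
Proof. by move=> /RleP x1 /RleP ab; apply/RleP/Rle_Rpower. Qed.

Lemma pw_lt x a b : 1 < x -> a < b -> pw x a < pw x b.
Proof. by move=> /RltP x1 /RltP ab; apply/RltP/Rpower_lt. Qed.

Lemma pw_base x y a : 0 <= a -> 0 < x -> x <= y -> pw x a <= pw y a.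
Proof. by move=> /RleP a0 /RltP x0 /RleP xy; apply/RleP/Rle_Rpower_l. Qed.

Lemma pw0 x : 0 < x -> pw x 0 = 1.
Proof. by move=> /RltP x0; apply: Rpower_O. Qed.

Lemma pw1 x : 0 < x -> pw x 1 = x.
Proof. by move=> /RltP x0; apply: Rpower_1. Qed.

Lemma pwN x a : pw x (- a) = (pw x a)^-1.
Proof. by rewrite /pw [LHS]Rpower_Ropp. Qed.

Lemma pw_ge1 x a : 1 <= x -> 0 <= a -> 1 <= pw x a.
Proof. by move=> x1 a0; rewrite -(@pw0 x); [apply: pw_le | apply: lt_le_trans x1]. Qed.

Lemma pwX x a n : (pw x a) ^+ n = pw x (a * n%:R).
Proof.
elim: n => [|n IH]; last by rewrite exprS IH -natr1 mulrDr mulr1 pwD mulrC.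
by rewrite expr0 mulr0 /pw /Rpower; symmetry; rewrite (_ : Rmult 0%R _ = 0%R) ?exp_0 //; exact: Rmult_0_l.
Qed.

(** [P0] lies beyond [2^(1/eta)], from where [p^eta >= 2]. The last claim bounds a logarithm by a
    power; it is applied to the number of dyadic scales. The exponent [P0.+1] of [K] serves both
    claims. *)
Lemma divisor_bound_power (eta : R) : 0 < eta -> exists C : R, [/\ 1 <= C,
  forall n, (0 < n)%N -> (size (divisors n))%:R <= C * pw n%:R eta &
  forall a, a.+1%:R <= C * pw (2 ^ a)%N%:R eta].
Proof.
move=> e0; pose phi (n : nat) := pw n%:R eta.
have phiM m n : (0 < m)%N -> (0 < n)%N -> phi (m * n)%N = phi m * phi n.
  by move=> m0 n0; rewrite /phi natrM pwM // ltr0n.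
have phi1 n : (0 < n)%N -> 1 <= phi n.
  by move=> n0; apply: pw_ge1; [rewrite ler1n | apply: ltW].
pose c := phi 2 - 1.
have c0 : 0 < c.
  by rewrite /c subr_gt0 -[ltLHS](@pw0 2) //; apply: pw_lt => //; rewrite ltr1n.
have phi_c p : (2 <= p)%N -> 1 + c <= phi p.
  move=> p2; rewrite /c addrC subrK; apply: pw_base => //; first exact: ltW.
  by rewrite ler_nat.
pose y := pw 2 (eta^-1).
have y0 : 0 < y by apply: pw_gt0.
pose P0 := (Num.trunc y).+1.
have phi2 p : (P0 <= p)%N -> 2 <= phi p.
  move=> pP; have /andP[_ yP] := truncn_itv (ltW y0).
  have e : pw y eta = 2 by rewrite /y pwA mulVf ?gt_eqF // pw1.
  rewrite -e; apply: pw_base => //; first exact: ltW.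
  by apply: (le_trans (ltW yP)); rewrite ler_nat.
pose K := 1 + c^-1.
have ci : 0 < c^-1 by rewrite invr_gt0.
have K1 : 1 <= K by rewrite /K; lra.
have Kc : 1 <= K * c by rewrite /K mulrDl mulVf ?gt_eqF //; lra.
exists (K ^+ P0.+1); split.
- exact: exprn_ege1.
- move=> n n0; apply: (le_trans (divisor_bound phiM phi1 c0 phi_c phi2 K1 Kc n0)).
  apply: ler_wpM2r; first by apply: ltW; apply: pw_gt0.
  by apply: ler_weXn2l.
- move=> a; apply: (le_trans (succ_le_phiX c0 phi_c K1 Kc a (leqnn 2))).
  rewrite -(phiX phiM phi1) //; apply: ler_wpM2r; first by apply: ltW; apply: pw_gt0.
  by rewrite -[leLHS]expr1; apply: ler_weXn2l.
Qed.

Lemma nat_le_trunc_succ (n : nat) (y : R) : n%:R <= y -> (n <= (Num.trunc y).+1)%N.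
Proof.
move=> ny; have y0 : 0 <= y by apply: le_trans ny.
by apply: leqW; rewrite truncn_ge_nat.
Qed.

Lemma tk_bound_power (eta C : R) k d : 0 < eta -> 1 <= C ->
  (forall n, (0 < n)%N -> (size (divisors n))%:R <= C * pw n%:R eta) -> (0 < d)%N ->
  (tk k d)%:R <= (2 * C) ^+ k * pw d%:R (eta * k%:R).
Proof.
move=> e0 C1 Cb d0.
have dR : 1 <= d%:R :> R by rewrite ler1n.
pose t := (Num.trunc (C * pw d%:R eta)).+1.
have p1 : 1 <= pw d%:R eta by apply: pw_ge1 => //; apply: ltW.
have Cp1 : 1 <= C * pw d%:R eta by apply: mulr_ege1.
have tB : t%:R <= 2 * C * pw d%:R eta.
  have /andP[h _] := truncn_itv (le_trans ler01 Cp1).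
  by rewrite /t -natr1 -mulrA; lra.
have h : (tk k d <= t ^ k)%N.
  apply: (@tk_le d.+1) => // w /andP[w0 wd]; apply: nat_le_trunc_succ.
  apply: (le_trans (Cb w w0)); apply: ler_wpM2l; first by lra.
  by apply: pw_base; [apply: ltW | rewrite ltr0n | rewrite ler_nat -ltnS].
apply: (@le_trans _ _ (t%:R ^+ k)); first by rewrite -natrX ler_nat.
rewrite -pwX -exprMn lerXn2r ?nnegrE //; apply: mulr_ge0; first by lra.
exact: ltW (pw_gt0 _ _).
Qed.

(** [Rpower_tail_step] makes the sum telescope, and the negative end term is dropped, so the bound
    does not depend on [M]. *)
Lemma tail_sum (f : nat -> R) (C2 kap : R) B M : 0 <= C2 -> 0 <= kap -> kap <= 1 / 2 -> (B <= M)%N ->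
  (forall d, (0 < d)%N -> 0 <= f d <= C2 * pw d%:R kap) ->
  0 <= \sum_(B.+1 <= d < M.+1) f d / (d%:R * d.+1%:R) <= 4 * C2 * pw B.+1%:R (kap - 1).
Proof.
move=> C0 k0 k1 BM fB; apply/andP; split.
  rewrite big_nat; apply: sumr_ge0 => d /andP[d0 _].
  by apply: divr_ge0; [have /andP[] := fB d (leq_ltn_trans (leq0n B) d0) | rewrite mulr_ge0].
pose u d := pw d%:R (kap - 1).
apply: (@le_trans _ _ (\sum_(B.+1 <= d < M.+1) 4 * C2 * (u d - u d.+1))).
  apply: ler_sum_nat => d /andP[d0 _]; have d1 : (0 < d)%N by apply: leq_ltn_trans d0.
  have dR : 1 <= d%:R :> R by rewrite ler1n.
  have st : pw d%:R kap / (d%:R * (d%:R + 1)) <= 4 * (u d - u d.+1).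
    have := @Rpower_tail_step kap d%:R; rewrite /u -(natr1 d) /pw !RE /= => h.
    by apply/RleP/h; apply/RleP; rewrite ?RE /=.
  have /andP[_ f2] := fB d d1.
  apply: (@le_trans _ _ (C2 * (pw d%:R kap / (d%:R * (d%:R + 1))))).
    rewrite mulrA natr1; apply: ler_wpM2r => //.
    by rewrite invr_ge0 mulr_ge0.
  have -> : 4 * C2 * (u d - u d.+1) = C2 * (4 * (u d - u d.+1)) by ring.
  by apply: ler_wpM2l.
rewrite -mulr_sumr; apply: ler_wpM2l; first by rewrite mulr_ge0.
have -> : \sum_(B.+1 <= d < M.+1) (u d - u d.+1) = u B.+1 - u M.+1.
  transitivity (- \sum_(B.+1 <= d < M.+1) (u d.+1 - u d)).
    by rewrite -sumrN; apply: eq_bigr => d _; rewrite opprB.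
  by rewrite telescope_sumr ?opprB.
have := pw_gt0 M.+1%:R (kap - 1); rewrite /u; lra.
Qed.

Lemma dyadic_exponent (y : R) : 1 <= y -> exists j, (2 ^ j)%N%:R <= y /\ y < (2 ^ j.+1)%N%:R.
Proof.
move=> y1; have /andP[B1 B2] := truncn_itv (le_trans ler01 y1).
have B0 : (0 < Num.trunc y)%N by rewrite truncn_gt0.
have /andP[j1 j2] := trunc_log_bounds (ltnSn 1) B0.
exists (trunc_log 2 (Num.trunc y)); split; first by apply: le_trans B1; rewrite ler_nat.
by apply: (lt_le_trans B2); rewrite ler_nat.
Qed.

Lemma two_pow_le (z : R) : 6 <= z -> 2 * z ^+ 10 <= z ^+ 19.
Proof.
move=> z6; rewrite (exprD z 9 10); apply: ler_wpM2r; first by apply: exprn_ge0; lra.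
rewrite (exprS z 8); apply: (@le_trans _ _ (z * 1)); first by lra.
by apply: ler_wpM2l; [lra | apply: exprn_ege1; lra].
Qed.

(** The series appears as its partial sum up to any [M >= [x]], with [C] independent of [M]. *)
Lemma divisor_sum_asymptotic (k : nat) (eps : R) : 0 < eps -> exists C : R, forall x : R, 2 <= x ->
  forall M, (Num.trunc x <= M)%N ->
  `|\sum_(1 <= n < (Num.trunc x).+1) (tk k (Num.trunc (x / n%:R)))%:R -
    x * \sum_(1 <= d < M.+1) (tk k d)%:R / (d%:R * d.+1%:R)| <= C * pw x (9 / 19 + eps).
Proof.
move=> e0.
(* The cap 1/2 is there for [tail_sum]; a smaller exponent gives a stronger bound, as [x >= 1]. *)
pose e1 := Num.min eps (1 / 2).
have e10 : 0 < e1 by rewrite lt_min e0 /=; lra.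
have e1e : e1 <= eps by rewrite ge_min lexx.
have e1h : e1 <= 1 / 2 by rewrite ge_min lexx orbT.
have k5 : 0 < (k + 5)%N%:R :> R by rewrite ltr0n addnS.
(* [t^(k+1) J^4] contains [k + 5] factors of size [x^eta]. *)
pose eta := e1 / (k + 5)%N%:R.
have eta0 : 0 < eta by rewrite divr_gt0.
have etaE : eta * (k + 5)%N%:R = e1 by rewrite /eta divfK // gt_eqF.
pose kap := eta * k%:R.
have kap0 : 0 <= kap by rewrite mulr_ge0 // ltW.
have kape : kap <= e1.
  by rewrite -etaE /kap; apply: ler_wpM2l; [apply: ltW | rewrite ler_nat leq_addr].
have kaph : kap <= 1 / 2 by lra.
have [C [C1 Cb CJ]] := divisor_bound_power eta0.
pose C2 := (2 * C) ^+ k.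
have C20 : 0 <= C2 by apply: exprn_ge0; lra.
have tkB d : (0 < d)%N -> 0 <= ((tk k d)%:R : R) <= C2 * pw d%:R kap.
  by move=> d0; rewrite ler0n /=; apply: tk_bound_power.
pose C3 : R := (3 + 2 * (k%:R * c_bil + 8 * (2 + 2 * 1344))) * ((2 * C) ^+ k.+1 * C ^+ 4).
pose Z : R := 6 ^+ 19.
have Z0 : 0 < Z by apply: exprn_gt0.
have C30 : 0 <= C3.
  apply: mulr_ge0; last by apply: mulr_ge0; apply: exprn_ge0; lra.
  by rewrite addr_ge0 // mulr_ge0 // addr_ge0 ?mulr_ge0 // /c_bil addr_ge0 // mulr_ge0.
exists (C3 + 4 * C2 + (Z * (C2 * Z) + Z * (4 * C2))) => x x2 M XM.
have x0 : 0 < x by lra.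
have x1 : 1 <= x by lra.
set X := Num.trunc x in XM *.
have /andP[X1 X2] := truncn_itv (ltW x0); rewrite -/X in X1 X2.
pose z := pw x (1 / 19).
have z0 : 0 < z by apply: pw_gt0.
have z19 : z ^+ 19 = x by rewrite /z pwX (_ : 1 / 19 * 19%:R = 1) ?pw1 //; field.
have pe : 1 <= pw x (9 / 19 + eps) by apply: pw_ge1 => //; lra.
have pe1 : pw x (9 / 19 + e1) <= pw x (9 / 19 + eps) by apply: pw_le => //; lra.
have q1 : 0 <= C3 + 4 * C2 by lra.
have ZC : 0 <= Z * (C2 * Z) + Z * (4 * C2).
  by apply: addr_ge0; apply: mulr_ge0; rewrite ?(ltW Z0) //; apply: mulr_ge0; rewrite // ltW.
(* For [x < 6^19] both the sum and the main term are bounded by constants, and the right side is at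
   least its constant. *)
have [z6|z6] := leP 6 z; last first.
  have xZ : x <= Z.
    by rewrite -z19 /Z; apply: lerXn2r; rewrite ?nnegrE ?(ltW z0) // ltW.
  have S1 : `|\sum_(1 <= n < X.+1) (tk k (Num.trunc (x / n%:R)))%:R| <= Z * (C2 * Z).
    apply: le_trans (ler_norm_sum _ _ _) _.
    apply: (@le_trans _ _ (\sum_(1 <= n < X.+1) C2 * Z)).
      apply: ler_sum_nat => n /andP[n0 nX].
      have nR : 0 < n%:R :> R by rewrite ltr0n.
      have N1 : (0 < Num.trunc (x / n%:R))%N.
        by rewrite truncn_gt0 ler_pdivlMr // mul1r; apply: le_trans X1; rewrite ler_nat -ltnS.
      have /andP[_ h] := tkB _ N1; rewrite normr_nat; apply: (le_trans h).
      apply: ler_wpM2l => //; apply: le_trans xZ.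
      have y0 : 0 <= x / n%:R by apply: divr_ge0; apply: ltW.
      have /andP[y1 _] := truncn_itv y0.
      have NR : 1 <= (Num.trunc (x / n%:R))%:R :> R by rewrite ler1n.
      apply: (@le_trans _ _ (pw (Num.trunc (x / n%:R))%:R 1)); first by apply: pw_le => //; lra.
      rewrite pw1 ?ltr0n //; apply: (le_trans y1); rewrite ler_pdivrMr // ler_peMr ?(ltW x0) // ler1n //.
    rewrite big_const_nat subSS subn0 iter_addr addr0 -[leLHS]mulr_natl.
    apply: ler_wpM2r; first by apply: mulr_ge0 => //; apply: ltW.
    by apply: (le_trans X1).
  have /andP[T0 T1] := @tail_sum (fun d => (tk k d)%:R) C2 kap 0 M C20 kap0 kaph (leq0n M) tkB.
  have {}T1 : \sum_(1 <= d < M.+1) (tk k d)%:R / (d%:R * d.+1%:R) <= 4 * C2.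
    apply: (le_trans T1); rewrite -[leRHS]mulr1; apply: ler_wpM2l; first by rewrite mulr_ge0.
    by rewrite -[leRHS](@pw0 1) //; apply: pw_le => //; lra.
  apply: le_trans (ler_normB _ _) _.
  have S2 : `|x * \sum_(1 <= d < M.+1) (tk k d)%:R / (d%:R * d.+1%:R)| <= Z * (4 * C2).
    by rewrite normrM !ger0_norm // ?(ltW x0) //; apply: ler_pM => //; apply: ltW.
  apply: (le_trans (lerD S1 S2)).
  apply: (@le_trans _ _ ((Z * (C2 * Z) + Z * (4 * C2)) * pw x (9 / 19 + eps))).
    by rewrite -[leLHS]mulr1; apply: ler_wpM2l.
  by rewrite ler_pM2r ?pw_gt0 // lerDr.
pose B := Num.trunc (z ^+ 10).
have z10 : 0 < z ^+ 10 by apply: exprn_gt0.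
have /andP[B1 B2] := truncn_itv (ltW z10); rewrite -/B in B1 B2.
have z1 : 1 <= z by lra.
have [j [J1R zJ]] := dyadic_exponent (exprn_ege1 10 z1).
have Jz : (2 ^ j.+1)%N%:R <= z ^+ 19.
  by rewrite expnS natrM; apply: le_trans (two_pow_le z6); apply: ler_wpM2l.
pose t := (Num.trunc (C * pw x eta)).+1.
have px1 : 1 <= pw x eta by apply: pw_ge1 => //; apply: ltW.
have Cp1 : 1 <= C * pw x eta by apply: mulr_ege1.
have tB : t%:R <= 2 * C * pw x eta.
  have /andP[h _] := truncn_itv (le_trans ler01 Cp1).
  by rewrite /t -natr1 -mulrA; lra.
have dt w : (0 < w)%N -> w%:R <= z ^+ 19 -> (size (divisors w) <= t)%N.
  rewrite z19 => w0 wx; apply: nat_le_trunc_succ; apply: (le_trans (Cb w w0)).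
  apply: ler_wpM2l; first by lra.
  by apply: pw_base => //; [apply: ltW | rewrite ltr0n].
have JB : j.+1%:R <= C * pw x eta.
  apply: (le_trans (CJ j)); apply: ler_wpM2l; first by lra.
  apply: pw_base; [exact: ltW | by rewrite ltr0n expn_gt0 |].
  apply: (le_trans J1R); rewrite -z19; apply: ler_weXn2l => //; lra.
have main := @divisor_sum_large z j.+1 t k z6 (ltn0Sn _) (ltn0Sn _) zJ Jz dt.
rewrite z19 -/X -/B in main.
have z9 : z ^+ 9 = pw x (9 / 19) by rewrite /z pwX; congr pw; field.
have mainB : (3 + 2 * (k%:R * c_bil + 8 * (2 + 2 * 1344))) * (t%:R ^+ k.+1 * j.+1%:R ^+ 4 * z ^+ 9) <=
   C3 * pw x (9 / 19 + e1).
  rewrite /C3 -[leRHS]mulrA; apply: ler_wpM2l.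
    by rewrite addr_ge0 // mulr_ge0 // addr_ge0 ?mulr_ge0 // /c_bil addr_ge0 // mulr_ge0.
  rewrite z9 pwD (mulrC (pw x (9 / 19))) [leRHS]mulrA; apply: ler_wpM2r; first by apply: ltW; apply: pw_gt0.
  apply: (@le_trans _ _ ((2 * C * pw x eta) ^+ k.+1 * (C * pw x eta) ^+ 4)).
    apply: ler_pM; rewrite ?exprn_ge0 //; apply: lerXn2r; rewrite ?nnegrE //; lra.
  rewrite !exprMn !pwX -etaE le_eqVlt; apply/orP; left; apply/eqP.
  have -> : eta * (k + 5)%N%:R = eta * k.+1%:R + eta * 4%:R by rewrite -mulrDr -natrD addSnnS.
  by rewrite pwD; ring.
have BX : (B <= X)%N.
  by apply: le_truncn; rewrite -z19; apply: ler_weXn2l => //; lra.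
have BM : (B <= M)%N by apply: leq_trans XM.
have /andP[T0 T1] := @tail_sum (fun d => (tk k d)%:R) C2 kap B M C20 kap0 kaph BM tkB.
have split : \sum_(1 <= d < M.+1) (tk k d)%:R / (d%:R * d.+1%:R) =
   \sum_(1 <= d < B.+1) (tk k d)%:R / (d%:R * d.+1%:R) +
   \sum_(B.+1 <= d < M.+1) (tk k d)%:R / (d%:R * d.+1%:R) :> R.
  by rewrite (@big_cat_nat _ _ _ B.+1).
rewrite split mulrDr opprD addrA; apply: le_trans (ler_normB _ _) _.
(* The tail beyond [z^10] gives [x (z^10)^(kap - 1) = x^(9/19 + (10/19) kap)], and [kap <= e1]. *)
have tailB : `|x * \sum_(B.+1 <= d < M.+1) (tk k d)%:R / (d%:R * d.+1%:R)| <= 4 * C2 * pw x (9 / 19 + e1).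
  rewrite normrM !ger0_norm // ?(ltW x0) //.
  apply: (@le_trans _ _ (x * (4 * C2 * pw B.+1%:R (kap - 1)))); first by rewrite ler_pM2l.
  rewrite mulrCA; apply: ler_wpM2l; first by rewrite mulr_ge0.
  have u1 : pw B.+1%:R (kap - 1) <= pw (z ^+ 10) (kap - 1).
    rewrite -(opprB 1 kap) !pwN lef_pV2 ?posrE ?pw_gt0 //.
    by apply: pw_base; [lra | by [] | exact: ltW].
  apply: (@le_trans _ _ (x * pw (z ^+ 10) (kap - 1))); first by rewrite ler_pM2l.
  rewrite /z pwX pwA -{1}(pw1 x0) -pwD; apply: pw_le => //.
  have -> : 1 + 1 / 19 * 10%:R * (kap - 1) = 9 / 19 + (10 / 19) * kap by field.
  lra.
apply: (le_trans (lerD (le_trans main mainB) tailB)).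
rewrite -mulrDl; apply: (@le_trans _ _ ((C3 + 4 * C2) * pw x (9 / 19 + eps))); first by apply: ler_wpM2l.
by rewrite ler_pM2r ?pw_gt0 // lerDl.
Qed.

(** * The asymptotic formula *)

Lemma floor_natE (x : R) : 0 <= x -> floor_nat x = Num.trunc x.
Proof.
move=> x0; symmetry; apply: truncn_def.
have [/RleP h1 /RltP h2] : Rle (INR (floor_nat x)) x /\ Rlt x (Rplus (INR (floor_nat x)) (IZR 1)).
  by apply: floor_nat_spec; apply/RleP.
by rewrite INRE in h1; rewrite RplusE INRE R1E in h2; rewrite h1 -natr1.
Qed.

Lemma sum_n_m_big (f : nat -> R) X : sum_n_m f 1 X = \sum_(1 <= n < X.+1) f n.
Proof.
elim: X => [|X IH]; first by rewrite sum_n_m_zero ?big_geq //; exact: Nat.lt_0_1.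
rewrite sum_n_Sm; last by apply: le_n_S; apply: Nat.le_0_l.
by rewrite IH [RHS]big_nat_recr.
Qed.

Definition tau_term (k n : nat) : R := Rdiv (INR (tau k (S n))) (Rmult (INR (S n)) (INR (S (S n)))).

(** [sum_n] runs over the indices 0 to [M], that is over [d] from 1 to [M.+1]. *)
Lemma sum_tau_term k M : sum_n (tau_term k) M = \sum_(1 <= d < M.+2) (tk k d)%:R / (d%:R * d.+1%:R).
Proof.
rewrite big_add1 /=; elim: M => [|M IH].
  by rewrite sum_O big_nat1 /tau_term tau_tk // !INRE RmultE RdivE.
by rewrite sum_Sn IH [RHS]big_nat_recr //= /tau_term tau_tk // !INRE RmultE RdivE.
Qed.

Lemma tau_term_ge0 k n : Rle (IZR 0) (tau_term k n).
Proof. by apply/RleP; rewrite /tau_term !INRE RmultE RdivE R0E; apply: divr_ge0 => //; apply: mulr_ge0. Qed.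

Lemma tau_sum_partial (k : nat) (eps : R) : Rlt (IZR 0) eps -> exists C : R, forall x : R, Rle (IZR 2) x ->
  forall M, (floor_nat x <= M)%coq_nat ->
  Rle (Rabs (Rminus (sum_n_m (fun n : nat => INR (tau k (floor_nat (Rdiv x (INR n))))) 1 (floor_nat x))
        (Rmult x (sum_n (tau_term k) M)))) (Rmult C (Rpower x (Rplus (Rdiv (IZR 9) (IZR 19)) eps))).
Proof.
move=> /RltP e0; have [C CP] := divisor_sum_asymptotic k e0.
exists C => x x2 M /ssrnat.leP XM.
have {}x2 : 2 <= x by move: x2; rewrite IZRposE INRE /= => /RleP.
have x0 : 0 <= x by lra.
rewrite floor_natE // in XM *.
have := CP x x2 M.+1 (leqW XM); rewrite /pw -sum_tau_term.
have -> : \sum_(1 <= n < (Num.trunc x).+1) (tk k (Num.trunc (x / n%:R)))%:R =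
  sum_n_m (fun n : nat => INR (tau k (floor_nat (Rdiv x (INR n))))) 1 (Num.trunc x).
  rewrite sum_n_m_big; apply: eq_big_nat => n /andP[n0 nX].
  have nR : 0 < n%:R :> R by rewrite ltr0n.
  rewrite !INRE RdivE floor_natE ?divr_ge0 // tau_tk //.
  rewrite truncn_gt0 ler_pdivlMr // mul1r; have /andP[h _] := truncn_itv x0.
  by apply: le_trans h; rewrite ler_nat -ltnS.
move/RleP; rewrite -RabsE -RmultE.
have -> : (9 / 19 : R) = Rdiv (IZR 9) (IZR 19) by rewrite !IZRposE !INRE RdivE.
by [].
Qed.

End TauSums.

(** * Convergence of the series and passage to the limit *)

Open Scope R_scope.

Theorem theorem1 (k : nat) (hk : (2 <= k)%nat) (eps : R) (heps : 0 < eps) :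
  ex_series (fun n : nat => INR (tau k (S n)) / (INR (S n) * INR (S (S n)))) /\
  exists C : R, forall x : R, 2 <= x ->
    Rabs (sum_n_m (fun n : nat => INR (tau k (floor_nat (x / INR n)))) 1 (floor_nat x)
          - x * Series (fun n : nat => INR (tau k (S n)) / (INR (S n) * INR (S (S n)))))
    <= C * Rpower x (9 / 19 + eps).
Proof.
destruct (TauSums.tau_sum_partial k heps) as [C hC].
set (s := sum_n (TauSums.tau_term k)) in *.
assert (mono : forall n, s n <= s (S n)).
  intros n. unfold s. rewrite sum_Sn. unfold plus; simpl.
  assert (h := TauSums.tau_term_ge0 k (S n)). Lra.lra.
assert (mono2 : forall n m, s n <= s (n + m)%nat).
  intros n m. induction m as [|m IH].
  - rewrite Nat.add_0_r. apply Rle_refl.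
  - rewrite Nat.add_succ_r. apply Rle_trans with (1 := IH), mono.
(* Convergence is read off from the estimate at [x = 2]: the left sum [S2] is fixed, so the
   increasing partial sums are bounded. *)
assert (lim : ex_finite_lim_seq s).
  set (S2 := sum_n_m (fun n => INR (tau k (floor_nat (2 / INR n)))) 1 (floor_nat 2)).
  set (K := C * Rpower 2 (9 / 19 + eps)).
  apply ex_finite_lim_seq_incr with ((Rabs S2 + K) / 2); [exact mono|].
  (* The estimate holds from index [floor_nat 2] on; monotonicity covers the earlier indices. *)
  intros n. apply Rle_trans with (1 := mono2 n (floor_nat 2)).
  assert (h := hC 2 (Rle_refl 2) (n + floor_nat 2)%nat (Nat.le_add_l _ _)).
  fold S2 K in h.
  apply Rabs_le_between in h. assert (h2 := Rle_abs S2). Lra.lra.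
destruct lim as [l hl].
assert (sl : is_series (TauSums.tau_term k) l) by exact hl.
split; [exists l; exact sl|].
exists C. intros x hx.
change (fun n => INR (tau k (S n)) / (INR (S n) * INR (S (S n)))) with (TauSums.tau_term k).
rewrite (is_series_unique _ _ sl).
set (T := sum_n_m _ 1 (floor_nat x)). set (X := floor_nat x).
(* The constant is uniform in the cutoff, so the inequality passes to the limit along the indices
   [n + X], all of them admissible. *)
assert (hl' : is_lim_seq (fun n => s (n + X)%nat) l) by (apply is_lim_seq_incr_n; exact hl).
assert (h1 : is_lim_seq (fun n => Rabs (T - x * s (n + X)%nat)) (Rabs (T - x * l))).
  apply (is_lim_seq_abs _ (Finite (T - x * l))).
  apply is_lim_seq_minus'; [apply is_lim_seq_const|].
  exact (is_lim_seq_scal_l _ x (Finite l) hl').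
refine (is_lim_seq_le _ (fun _ => C * Rpower x (9 / 19 + eps)) (Finite _) (Finite _) _ h1 (is_lim_seq_const _)).
intros n. exact (hC x hx (n + X)%nat (Nat.le_add_l _ _)).
Qed.
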